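(* Let $\Phi$ be a kernel of finite smoothness on $\mathbb{R}^d$, i.e. for some $\beta>d$ there are constants $c,c_0,c_1>0$ with $c_0\|\omega\|_2^{-\beta}\le\hat\Phi(\omega)\le c_1\|\omega\|_2^{-\beta}$ for $\|\omega\|_2\ge c$. Let $X\subset\Omega$ be a member of an asymptotically uniformly placed family of finite point sets, sufficiently dense in $\Omega$, and let $f\in\mathcal{H}_\Phi$, $f\ne0$. Then the standard error bound $\epsilon\mapsto\sup_{x\in\Omega}P_{X,\Phi_\epsilon}(x)\,\|f\|_{\Phi_\epsilon}$ is $$\mathcal{O}(1)\ \text{ for }\epsilon\to0,\qquad \mathcal{O}(\epsilon^{\beta})\ \text{ for }\epsilon\to\infty.$$ In the Sobolev space $W_2^m(\mathbb{R}^d)$ with integer $m>d/2$, i.e. for $\hat\Phi(\omega)=(1+\|\omega\|_2^2)^{-m}$, the square of the bound behaves for $\epsilon\to0$ like $$\epsilon^{2m}\sum_{j=0}^m\binom{m}{j}\epsilon^{-2j}\,|f|^2_{W_2^j(\mathbb{R}^d)},$$ i.e. for all sufficiently small $\epsilon>0$ it is bounded above and below by positive constants, independent of $\epsilon$, times this expression.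
   Context: Functions are real-valued and Fourier transformable on $\mathbb{R}^d$. The kernel is a translation-invariant radial positive definite function $\Phi:\mathbb{R}^d\to\mathbb{R}$ with continuous, strictly positive Fourier transform $\hat\Phi$. Its native space $\mathcal{H}_\Phi$ is the reproducing kernel Hilbert space on $\mathbb{R}^d$ with inner product $(f,g)_{\mathcal{H}_\Phi}=(2\pi)^{-d/2}\int_{\mathbb{R}^d}\frac{\hat f(\omega)\overline{\hat g(\omega)}}{\hat\Phi(\omega)}\,d\omega$. For $\epsilon>0$ the scaled kernel is $\Phi_\epsilon(x)=\Phi(\epsilon x)$, with $\hat\Phi_\epsilon(\omega)=\epsilon^{-d}\hat\Phi(\omega/\epsilon)$ and $\|f\|_{\Phi_\epsilon}^2=(2\pi)^{-d/2}\int_{\mathbb{R}^d}|\hat f(\omega)|^2/\hat\Phi_\epsilon(\omega)\,d\omega$. For integer $j\ge0$, $|f|^2_{W_2^j(\mathbb{R}^d)}=(2\pi)^{-d/2}\int_{\mathbb{R}^d}|\hat f(\omega)|^2\|\omega\|_2^{2j}\,d\omega$. For a finite set $X=\{x_1,\dots,x_n\}$ the power function is $P_{X,\Phi}(x)=\inf_{a\in\mathbb{R}^n}\big\|\delta_x-\sum_{j=1}^na_j\delta_{x_j}\big\|_{\Phi}$, where $\delta_x$ is point evaluation at $x$ and the norm is that of the dual of $\mathcal{H}_\Phi$, so $(\delta_x,\delta_y)_\Phi=\Phi(x-y)$; $P_{X,\Phi_\epsilon}$ is the same with $\Phi_\epsilon$ in place of $\Phi$. The standard error bound is $|f(x)-s_{f,X,\Phi_\epsilon}(x)|\le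 P_{X,\Phi_\epsilon}(x)\|f\|_{\Phi_\epsilon}$, where $s_{f,X,\Phi_\epsilon}\in\mathrm{span}\{\Phi_\epsilon(\cdot-x_j)\}$ interpolates $f$ on $X$. $\Omega\subset\mathbb{R}^d$ is a bounded domain satisfying an interior cone condition. The fill distance is $h(X,\Omega)=\sup_{y\in\Omega}\min_{x\in X}\|x-y\|_2$. A family of finite sets $X\subset\Omega$ is asymptotically uniformly placed if $h(X,\Omega)\le C\min_{x\neq y\in X}\|x-y\|_2$ with a constant $C$ common to the family. ''Sufficiently dense'' means $h(X,\Omega)\le h_0$ for some $h_0>0$ depending only on $\Omega$, $\Phi$ and $C$. The constants in the $\mathcal{O}$ notation and in ''behaves like'' may depend on $\Phi,\Omega,X,f$ but not on $\epsilon$. *)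

(* Defs.v *)
From HB Require Import structures.
From mathcomp Require Import all_boot all_order all_algebra complex.
From mathcomp Require Import finmap all_classical all_reals all_analysis.

Set Implicit Arguments.
Unset Strict Implicit.
Unset Printing Implicit Defensive.

Import Order.TTheory GRing.Theory Num.Theory.
Import numFieldNormedType.Exports.

Local Open Scope classical_set_scope.
Local Open Scope ring_scope.

(* 'rV[R]_d carries the sigma-algebra generated by the coordinate maps, which
   is its Borel sigma-algebra; this mirrors the library's instance on tuples. *)
Section measurable_rV.
Context (R : realType) (d : nat).

Let coors (i : 'I_d) (v : 'rV[R]_d) : measurableTypeR R := v ord0 i.

Let rV_set0 : g_sigma_preimage coors set0.
Proof. exact: sigma_algebra0. Qed.

Let rV_setC A : g_sigma_preimage coors A -> g_sigma_preimage coors (~` A).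
Proof. exact: sigma_algebraC. Qed.

Let rV_bigcup (F : _^nat) : (forall i, g_sigma_preimage coors (F i)) ->
  g_sigma_preimage coors (\bigcup_i (F i)).
Proof. exact: sigma_algebra_bigcup. Qed.

HB.instance Definition _ := @isMeasurable.Build default_measure_display
  'rV[R]_d (g_sigma_preimage coors) rV_set0 rV_setC rV_bigcup.

End measurable_rV.

Section measurable_rV_lemmas.
Context (R : realType).

Lemma measurable_coord (d : nat) (i : 'I_d) :
  measurable_fun [set: 'rV[R]_d] (fun v => v ord0 i : measurableTypeR R).
Proof.
move=> _ Y mY; rewrite setTI; apply: sub_sigma_algebra => /=.
rewrite -bigcup_seq/=; exists i => /=; first by rewrite mem_index_enum.
by exists Y => //; rewrite setTI.
Qed.

Lemma measurable_fun_rVP d1 (T : measurableType d1) (d : nat)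
    (f : T -> 'rV[R]_d) :
  (forall i, measurable_fun setT (fun x => f x ord0 i : measurableTypeR R)) ->
  measurable_fun [set: T] f.
Proof.
move=> mf; apply: (@measurability _ _ _ _ setT f _ erefl) => //.
move=> _ [A + <-].
rewrite -bigcup_seq/= => -[i _ [B mB <-]].
by rewrite setTI -comp_preimage; exact: mf.
Qed.

Definition rV_cons (d : nat) (p : measurableTypeR R * 'rV[R]_d) : 'rV[R]_d.+1 :=
  row_mx (p.1%:M : 'M[R]_1) p.2.

Definition rV_uncons (d : nat) (v : 'rV[R]_d.+1) :
    measurableTypeR R * 'rV[R]_d :=
  (v ord0 ord0, \row_i v ord0 (lift ord0 i)).

Lemma rV_consE0 (d : nat) p : @rV_cons d p ord0 ord0 = p.1.
Proof. by rewrite mxE; case: splitP => // j _; rewrite mxE (ord1 j). Qed.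

Lemma rV_consES (d : nat) p i : @rV_cons d p ord0 (lift ord0 i) = p.2 ord0 i.
Proof.
rewrite mxE; case: splitP => [j|j /= [ij]]; first by rewrite ord1.
by congr (p.2 _ _); exact/val_inj.
Qed.

Lemma rV_consK (d : nat) : cancel (@rV_cons d) (@rV_uncons d).
Proof.
move=> [x v]; rewrite /rV_uncons rV_consE0; congr pair.
by apply/rowP => i; rewrite mxE rV_consES.
Qed.

Lemma measurable_rV_cons (d : nat) : measurable_fun setT (@rV_cons d).
Proof.
apply: measurable_fun_rVP => i.
have [j ->|->] := unliftP ord0 i.
  rewrite (_ : (fun _ => _) = (fun v : 'rV[R]_d => v ord0 j) \o snd); last first.
    by apply/funext => p; rewrite rV_consES.
  by apply: measurableT_comp; [exact: measurable_coord|exact: measurable_snd].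
rewrite (_ : (fun _ => _) = fst); last by apply/funext => p; rewrite rV_consE0.
exact: measurable_fst.
Qed.

Lemma measurable_rV_uncons (d : nat) : measurable_fun setT (@rV_uncons d).
Proof.
apply: measurable_fun_pair; first exact: measurable_coord.
apply: measurable_fun_rVP => i.
rewrite (_ : (fun _ => _) = fun v : 'rV[R]_d.+1 => v ord0 (lift ord0 i)).
  exact: measurable_coord.
by apply/funext => v; rewrite mxE.
Qed.

End measurable_rV_lemmas.

Section lebesgue_step.
Context (R : realType) (d : nat).
Variable m : {sigma_finite_measure set 'rV[R]_d -> \bar R}.

Definition lebesgue_step : set 'rV[R]_d.+1 -> \bar R :=
  pushforward (@lebesgue_measure R \x m)%E (@rV_cons R d).

HB.instance Definition _ := Measure.copy lebesgue_step
  (measure_function_pushforward__canonical__measure_function_Measure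
     (@lebesgue_measure R \x m)%E (@measurable_rV_cons R d)).

Let lebesgue_step_sigma_finite : sigma_finite setT lebesgue_step.
Proof.
have /sigma_finiteP[F [TF ndF Foo]] := sigma_finiteT (@lebesgue_measure R).
have /sigma_finiteP[G [TG ndG Goo]] := sigma_finiteT m.
exists (fun n => @rV_uncons R d @^-1` (F n `*` G n)).
  rewrite -preimage_bigcup -[LHS](preimage_setT (@rV_uncons R d)).
  congr (_ @^-1` _); rewrite -setXTT TF TG predeqE => -[x y]; split.
    move=> [/= [n _ Fnx] [k _ Gky]]; exists (maxn n k) => //; split.
    - by move: x Fnx; exact/subsetPset/ndF/leq_maxl.
    - by move: y Gky; exact/subsetPset/ndG/leq_maxr.
  by move=> [n _ []/= ? ?]; split; exists n.
move=> n; have [? ?] := Foo n; have [? ?] := Goo n; split.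
  rewrite -[X in measurable X]setTI; apply: measurable_rV_uncons => //.
  exact: measurableX.
rewrite /lebesgue_step /pushforward.
have -> : @rV_cons R d @^-1` (@rV_uncons R d @^-1` (F n `*` G n)) =
    F n `*` G n.
  by rewrite -comp_preimage (_ : _ \o _ = id)//; apply/funext; exact: rV_consK.
by rewrite product_measure1E// lte_mul_pinfty// ge0_fin_numE.
Qed.

HB.instance Definition _ := Measure_isSigmaFinite.Build _ _ _ lebesgue_step
  lebesgue_step_sigma_finite.

End lebesgue_step.

(* Lebesgue measure on R^d, as the d-fold product of that of the line. *)
Fixpoint lebesgue_rV (R : realType) (d : nat) :
    {sigma_finite_measure set 'rV[R]_d -> \bar R} :=
  match d with
  | 0 => [the {sigma_finite_measure set _ -> \bar R} of \d_(0 : 'rV[R]_0)]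
  | d'.+1 => [the {sigma_finite_measure set _ -> \bar R} of
               lebesgue_step (lebesgue_rV R d')]
  end.

Lemma lebesgue_rV_box (R : realType) (d : nat)
    (A : 'I_d -> set (measurableTypeR R)) :
  (forall i, measurable (A i)) ->
  lebesgue_rV R d [set v | forall i, A i (v ord0 i)] =
  (\prod_(i < d) @lebesgue_measure R (A i))%E.
Proof.
elim: d A => [|d IH] A mA /=.
  by rewrite big_ord0 diracE mem_set// => -[].
rewrite /lebesgue_step /pushforward big_ord_recl -IH//.
rewrite -product_measure1E//; last first.
  rewrite (_ : [set _ | _] =
      \bigcap_(i in [set: 'I_d]) ((fun v => v ord0 i) @^-1` A (lift ord0 i))).
    apply: fin_bigcap_measurable => // i _.
    by rewrite -[X in measurable X]setTI; exact: measurable_coord.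
  by apply/seteqP; split=> v //= vA i; [move=> _; exact: vA|exact: vA].
congr ((_ \x _)%E _); apply/seteqP; split=> [[x v] /= Av|[x v] /= [Ax Av] i].
  split=> [|i]; first by have := Av ord0; rewrite rV_consE0.
  by have := Av (lift ord0 i); rewrite rV_consES.
by have [j ->|->] := unliftP ord0 i; rewrite ?rV_consES ?rV_consE0//; exact: Av.
Qed.

Section euclidean.
Context (R : realType) (d : nat).
Implicit Types (x y : 'rV[R]_d) (Omega : set 'rV[R]_d).

Definition dot x y : R := \sum_i x ord0 i * y ord0 i.

(* The library norm on 'rV[R]_d is the sup norm; it gives the same topology. *)
Definition enorm x : R := Num.sqrt (dot x x).

Definition bounded_domain Omega :=
  [/\ open Omega, connected Omega, Omega !=set0 & bounded_set Omega].

Definition interior_cone_condition Omega :=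
  exists theta r : R, [/\ 0 < theta, theta < pi / 2, 0 < r &
    forall x, Omega x -> exists xi, enorm xi = 1 /\
      forall y (l : R), enorm y = 1 -> cos theta <= dot y xi ->
        0 <= l -> l <= r -> Omega (x + l *: y)].

(* The infimum of the empty set is +oo: the fill distance of the empty set is
   +oo, and so is the separation of a set with at most one point. *)
Definition fill_distance (X : {fset 'rV[R]_d}) Omega : \bar R :=
  ereal_sup [set ereal_inf [set (enorm (x - y))%:E | x in [set` X]]
            | y in Omega].

Definition separation (X : {fset 'rV[R]_d}) : \bar R :=
  ereal_inf [set (enorm (p.1 - p.2))%:E | p in
              [set p | [/\ p.1 \in X, p.2 \in X & p.1 != p.2]]].

Definition asymptotically_uniformly_placed Omega (C : R)
    (F : set {fset 'rV[R]_d}) :=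
  forall X, F X -> [set` X] `<=` Omega /\
    (fill_distance X Omega <= C%:E * separation X)%E.

End euclidean.

Section fourier.
Context (R : realType) (d : nat).
Implicit Types (f : 'rV[R]_d -> R) (g : 'rV[R]_d -> R[i]) (x w : 'rV[R]_d).
Local Notation mu := (lebesgue_rV R d).

Definition twopi_factor : R := (2 * pi) `^ (- (d%:R / 2)).

Definition sqnormc (z : R[i]) : R := complex.Re z ^+ 2 + complex.Im z ^+ 2.

(* Unitary convention: (2 pi)^(-d/2) times the integral of
   f(x) exp(-i x.w). *)
Definition fourier_L1 f w : R[i] :=
  ((twopi_factor * \int[mu]_x (f x * cos (dot x w)))
    +i* (- (twopi_factor * \int[mu]_x (f x * sin (dot x w)))))%C.

(* g is (a representative of) the Fourier-Plancherel transform of f in L^2: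
   the continuous extension to L^2 of the transform on L^1 `&` L^2. *)
Definition is_fourier f g :=
  [/\ f \in Lfun mu 2%:E,
      measurable_fun setT (fun w => complex.Re (g w)),
      measurable_fun setT (fun w => complex.Im (g w)) &
      exists F : nat -> 'rV[R]_d -> R, [/\
        forall n, F n \in Lfun mu 1%:E /\ F n \in Lfun mu 2%:E,
        (\int[mu]_x ((F n x - f x) ^+ 2)%:E @[n --> \oo] --> 0)%E &
        (\int[mu]_w (sqnormc (fourier_L1 (F n) w - g w))%:E
           @[n --> \oo] --> 0)%E]].

(* Determined up to a null set, hence only ever used under an integral. *)
Definition fourier f : 'rV[R]_d -> R[i] :=
  xget (fun=> 0) [set g | is_fourier f g].

Definition sobolev_seminorm_sq (j : nat) f : \bar R :=
  (twopi_factor%:E *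
    \int[mu]_w (sqnormc (fourier f w) * enorm w ^+ (2 * j))%:E)%E.

End fourier.

(* A translation-invariant kernel (x, y) |-> kfun (x - y) together with its
   Fourier transform khat; is_kernel links the two. *)
Record ti_kernel (R : realType) (d : nat) := TIKernel {
  kfun : 'rV[R]_d -> R;
  khat : 'rV[R]_d -> R }.

Section kernels.
Context (R : realType) (d : nat).
Implicit Types (K : ti_kernel R d) (f : 'rV[R]_d -> R) (x : 'rV[R]_d).
Implicit Types (X : {fset 'rV[R]_d}) (Omega : set 'rV[R]_d).
Local Notation mu := (lebesgue_rV R d).

Definition radial f := exists phi : R -> R, forall x, f x = phi (enorm x).

Definition positive_definite f :=
  forall n (x : 'I_n -> 'rV[R]_d) (a : 'I_n -> R),
    injective x -> (exists i, a i != 0) ->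
    0 < \sum_i \sum_j a i * a j * f (x i - x j).

Definition is_kernel K :=
  [/\ radial (kfun K), positive_definite (kfun K),
      is_fourier (kfun K) (fun w => (khat K w)%:C%C),
      continuous (khat K) & forall w, 0 < khat K w].

Definition finite_smoothness K (beta : R) :=
  exists c c0 c1 : R, [/\ 0 < c, 0 < c0, 0 < c1 &
    forall w, c <= enorm w ->
      c0 * enorm w `^ (- beta) <= khat K w /\
      khat K w <= c1 * enorm w `^ (- beta)].

(* khat is the transform of the dilated function kfun (e *: -), for e > 0. *)
Definition scale_kernel (e : R) K : ti_kernel R d := {|
  kfun := fun x => kfun K (e *: x);
  khat := fun w => e ^- d * khat K (e^-1 *: w) |}.

Definition native_sqnorm K f : \bar R :=
  ((twopi_factor R d)%:E *
    \int[mu]_w (sqnormc (fourier f w) / khat K w)%:E)%E.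

Definition native_norm K f : \bar R := sqrte (native_sqnorm K f).

(* Elements are functions rather than classes, on which point evaluation makes
   sense: each class of finite norm has exactly one continuous member. *)
Definition native_space K : set ('rV[R]_d -> R) :=
  [set f | [/\ continuous f, exists g, is_fourier f g &
               (native_sqnorm K f < +oo)%E]].

(* Operator norm, over the native space, of a linear functional l. *)
Definition dual_norm K (l : ('rV[R]_d -> R) -> R) : \bar R :=
  ereal_sup [set `|l f|%:E | f in
              [set f | native_space K f /\ (native_norm K f <= 1)%E]].

Definition power_function K X x : \bar R :=
  ereal_inf [set dual_norm K (fun f => f x - \sum_(y : X) a y * f (val y))
            | a in [set: {ffun X -> R}]].

Definition error_bound K X Omega f (e : R) : \bar R :=
  ereal_sup [set (power_function (scale_kernel e K) X x *
                  native_norm (scale_kernel e K) f)%E | x in Omega].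

Definition sobolev_expansion (m : nat) f (e : R) : \bar R :=
  ((e ^+ (2 * m))%:E *
    \sum_(j < m.+1) ('C(m, j)%:R * e ^- (2 * j))%:E *
                    sobolev_seminorm_sq j f)%E.

End kernels.

(* Main.v *)
Require Import Defs.
From mathcomp Require Import all_boot all_order all_algebra complex perm.
From mathcomp Require Import finmap all_classical all_reals all_analysis measurable_realfun.
From mathcomp Require Import ring lra.

Set Implicit Arguments.
Unset Strict Implicit.
Unset Printing Implicit Defensive.

Import Order.TTheory GRing.Theory Num.Theory.
Import numFieldNormedType.Exports.

Local Open Scope classical_set_scope.
Local Open Scope ring_scope.

(** Throughout, [e ^- d * khat K (e^-1 w)] is replaced by its order of magnitude.
Finite smoothness, with continuity and positivity of [khat K], puts [khat K]
between two multiples of (1 + |w|^2)^(-s), where s = beta / 2, and hence the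
scaled transform between two multiples of e^(2s-d) (e^2 + |w|^2)^(-s). Both
factors of the error bound are governed by this power of [e] and by a weight
that becomes singular at the origin as [e] tends to 0.

The power function. Fourier inversion writes f(x) - sum_y a_y f(y) as the
integral, against the transform of [f], of exp(i x.w) - sum_y a_y exp(i y.w), so
that by Cauchy-Schwarz the square of the power function is at most the integral
of the squared modulus of that difference (the [defect]) against the scaled
transform of the kernel ([power_function_le]). A set [X] that is dense enough
admits coefficients, bounded uniformly in [x], that reproduce the polynomials of
degree at most [l], the integer part of [s] ([polynomial_reproduction]). By
Taylor's formula the defect is then O(|w|^(2l+2)) at the origin
([defect_le_pow]), and 2l + 2 >= 2s is just what makes the integral bounded as
[e] tends to 0. This gives a power function of order e^((2s-d)/2)
([power_flat_limit]), while the norm of [f] is at most of order e^((d-2s)/2)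
since (e^2 + |w|^2)^s <= (1 + |w|^2)^s ([native_norm_scale_le]): the product is
bounded. For large [e], zero coefficients already give order e^((2s-d)/2) for the
power function, and the norm is at most of order e^((d-2s)/2) e^s.

The Sobolev case. Here the weight is a polynomial in |w|^2, and the binomial
theorem identifies the given expression with e^(2m-d) times the squared norm of
[f] ([sobolev_expansionE]). So the claim is that the power function is exactly of
order e^((2m-d)/2). The lower bound is needed at a single point: a bump that
vanishes on [X] but not at that point is a test function for all coefficients at
once, and its norm in the scaled space is at most of order e^((d-2m)/2)
([power_scale_ge]).

Fourier analysis. The transform of [f] is only given as a limit in L^2, so two
facts are needed: weighted integrals of its squared modulus do not depend on the
representative ([eq_fourier_integral], from the inequality half of Plancherel's
theorem, [plancherel_le]), and continuous functions with integrable transform are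
recovered pointwise ([fourier_inversion]). Both come from Gaussian multipliers. A
Gaussian on the transform side is, by Fubini, a convolution with a narrow
Gaussian of fixed mass on the other side ([wave_gauss_fourier_L1]), and the
Gaussians are then made to tend to 1. The transform of the Gaussian itself is
found on the line by solving a differential equation ([osc1_gauss]) and carried
to R^d by the product structure ([osc_tensor]). *)

(** * Integration on products of lines *)

Section integration.
Context d (T : measurableType d) (R : realType).
Variable mu : {measure set T -> \bar R}.
Implicit Types f g : T -> R.

Lemma dominated_integrable f g : measurable_fun setT f ->
  (forall x, `|f x| <= g x) -> mu.-integrable setT (EFin \o g) ->
  mu.-integrable setT (EFin \o f).
Proof.
move=> mf fg; apply: le_integrable => //; first exact/measurable_EFinP.
by move=> x _ /=; rewrite lee_fin (le_trans (fg x))// ler_norm.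
Qed.

Lemma ge0_lty_integrable f : measurable_fun setT f -> (forall x, 0 <= f x) ->
  (\int[mu]_x (f x)%:E < +oo)%E -> mu.-integrable setT (EFin \o f).
Proof.
move=> mf f0 foo; apply/integrableP; split; first exact/measurable_EFinP.
by under eq_integral => x _ do rewrite /= ger0_norm//.
Qed.

Lemma integrable_lty_norm f : mu.-integrable setT (EFin \o f) ->
  (\int[mu]_x `|f x|%:E < +oo)%E.
Proof. by move=> /integrableP[]. Qed.

Lemma integrable_congr f g : f =1 g -> mu.-integrable setT (EFin \o f) ->
  mu.-integrable setT (EFin \o g).
Proof. by move=> /funext ->. Qed.

Lemma integrable_mfun f : mu.-integrable setT (EFin \o f) ->
  measurable_fun setT f.
Proof. by move=> /integrableP[/measurable_EFinP]. Qed.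

Lemma RintegralE f : mu.-integrable setT (EFin \o f) ->
  (\int[mu]_x (f x)%:E)%E = (\int[mu]_x f x)%:E.
Proof. by move=> fi; rewrite /Rintegral fineK// integrable_fin_num. Qed.

Lemma integrableM_bounded f g (M : R) : measurable_fun setT g ->
  (forall x, `|g x| <= M) -> mu.-integrable setT (EFin \o f) ->
  mu.-integrable setT (EFin \o (fun x => f x * g x)).
Proof.
move=> mg gM fi; apply: (@dominated_integrable _ (fun x => M * `|f x|)).
- by apply: measurable_funM => //; exact: integrable_mfun.
- by move=> x; rewrite normrM mulrC ler_wpM2r.
- have := integrableZl measurableT M (integrable_norm fi).
  by apply: eq_integrable.
Qed.

Lemma integrable_mulZl f (k : R) : mu.-integrable setT (EFin \o f) ->
  mu.-integrable setT (EFin \o (fun x => k * f x)).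
Proof. by move/(integrableZl measurableT k); apply: eq_integrable. Qed.

Lemma integrable_addr f g : mu.-integrable setT (EFin \o f) ->
  mu.-integrable setT (EFin \o g) ->
  mu.-integrable setT (EFin \o (fun x => f x + g x)).
Proof.
by move=> fi gi; have := integrableD measurableT fi gi; apply: eq_integrable.
Qed.

Lemma integrable_subr f g : mu.-integrable setT (EFin \o f) ->
  mu.-integrable setT (EFin \o g) ->
  mu.-integrable setT (EFin \o (fun x => f x - g x)).
Proof.
by move=> fi gi; have := integrableB measurableT fi gi; apply: eq_integrable.
Qed.

End integration.

Section product_integrals.
Context d1 d2 (T1 : measurableType d1) (T2 : measurableType d2) (R : realType).
Variable m1 : {sigma_finite_measure set T1 -> \bar R}.
Variable m2 : {sigma_finite_measure set T2 -> \bar R}.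

Lemma integrable_prodM (a : T1 -> R) (b : T2 -> R) :
  m1.-integrable setT (EFin \o a) -> m2.-integrable setT (EFin \o b) ->
  (m1 \x m2)%E.-integrable setT (EFin \o (fun z => a z.1 * b z.2)).
Proof.
move=> ia ib.
have ma := integrable_mfun ia; have mb := integrable_mfun ib.
apply/integrable12ltyP.
  apply/measurable_EFinP; apply: measurable_funM.
  - exact: (measurableT_comp ma measurable_fst).
  - exact: (measurableT_comp mb measurable_snd).
have E x : (\int[m2]_y `|(EFin \o (fun z => a z.1 * b z.2)%R) (x, y)| =
    `|a x|%:E * \int[m2]_y `|b y|%:E)%E.
  under eq_integral => y _ do rewrite /= normrM EFinM.
  by rewrite ge0_integralZl//; exact/measurable_EFinP/measurableT_comp.
under eq_integral => x _ do rewrite E.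
rewrite ge0_integralZr//; last 2 first.
- exact/measurable_EFinP/measurableT_comp.
- by apply: integral_ge0 => y _; rewrite lee_fin.
apply: lte_mul_pinfty; first by apply: integral_ge0 => x _; rewrite lee_fin.
- rewrite ge0_fin_numE; first exact: integrable_lty_norm.
  by apply: integral_ge0 => x _; rewrite lee_fin.
- exact: integrable_lty_norm.
Qed.

Lemma Rintegral_prodM (a : T1 -> R) (b : T2 -> R) :
  m1.-integrable setT (EFin \o a) -> m2.-integrable setT (EFin \o b) ->
  (\int[(m1 \x m2)%E]_z (a z.1 * b z.2) =
   (\int[m1]_x a x) * (\int[m2]_y b y))%R.
Proof.
move=> ia ib; have iab := integrable_prodM ia ib.
apply: EFin_inj; rewrite -RintegralE// -(integral12_prod_meas1 iab).
have E x : (fubini_F m2 (EFin \o (fun z => a z.1 * b z.2)%R) x =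
    (a x)%:E * (\int[m2]_y b y)%R%:E)%E.
  rewrite /fubini_F /=; under eq_integral => y _ do rewrite EFinM.
  by rewrite integralZl// RintegralE.
under eq_integral => x _ do rewrite E.
rewrite /= EFinM -(RintegralE ia) -integralZr//.
Qed.

Lemma ge0_integral_prodM (a : T1 -> R) (b : T2 -> R) :
  measurable_fun setT a -> measurable_fun setT b ->
  (forall x, 0 <= a x) -> (forall x, 0 <= b x) ->
  (\int[m1 \x m2]_z (a z.1 * b z.2)%:E =
   (\int[m1]_x (a x)%:E) * (\int[m2]_y (b y)%:E))%E.
Proof.
move=> ma mb a0 b0; rewrite fubini_tonelli1; last 2 first.
- apply/measurable_EFinP; apply: measurable_funM.
  + exact: (measurableT_comp ma measurable_fst).
  + exact: (measurableT_comp mb measurable_snd).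
- by move=> x; rewrite lee_fin mulr_ge0.
have E x : (fubini_F m2 (fun z => (a z.1 * b z.2)%:E) x =
    (a x)%:E * \int[m2]_y (b y)%:E)%E.
  rewrite /fubini_F /=; under eq_integral => y _ do rewrite EFinM.
  rewrite ge0_integralZl//; first exact/measurable_EFinP.
  - by move=> y _; rewrite lee_fin.
  - by rewrite lee_fin.
transitivity (\int[m1]_x ((a x)%:E * \int[m2]_y (b y)%:E))%E.
  by apply: eq_integral => x _; exact: E.
rewrite ge0_integralZr//; first exact/measurable_EFinP.
- by move=> x _; rewrite lee_fin.
- by apply: integral_ge0 => y _; rewrite lee_fin.
Qed.

End product_integrals.

Lemma measurable_cos (R : realType) : measurable_fun setT (@cos R).
Proof. by apply: continuous_measurable_fun; exact: continuous_cos. Qed.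

Lemma measurable_sin (R : realType) : measurable_fun setT (@sin R).
Proof. by apply: continuous_measurable_fun; exact: continuous_sin. Qed.

Lemma norm_cos_le1 (R : realType) (x : R) : `|cos x| <= 1.
Proof. by rewrite ler_norml cos_geN1 cos_le1. Qed.

Lemma norm_sin_le1 (R : realType) (x : R) : `|sin x| <= 1.
Proof. by rewrite ler_norml sin_geN1 sin_le1. Qed.

Section rV_integrals.
Context (R : realType).
Local Notation leb := (@lebesgue_measure R).

Lemma ge0_integral_rVS d (f : 'rV[R]_d.+1 -> \bar R) :
  measurable_fun setT f -> (forall x, (0 <= f x)%E) ->
  (\int[lebesgue_rV R d.+1]_v f v =
   \int[leb \x lebesgue_rV R d]_z f (rV_cons z))%E.
Proof.
move=> mf f0; rewrite /= /lebesgue_step ge0_integral_pushforward//.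
exact: measurable_rV_cons.
Qed.

Lemma integrable_rVS d (f : 'rV[R]_d.+1 -> \bar R) :
  measurable_fun setT f ->
  (leb \x lebesgue_rV R d)%E.-integrable setT (f \o @rV_cons R d) ->
  (lebesgue_rV R d.+1).-integrable setT f.
Proof.
move=> mf fi; apply: (integrable_pushforward _ mf) => //.
exact: measurable_rV_cons.
Qed.

Lemma integral_rVS d (f : 'rV[R]_d.+1 -> \bar R) :
  measurable_fun setT f ->
  (leb \x lebesgue_rV R d)%E.-integrable setT (f \o @rV_cons R d) ->
  (\int[lebesgue_rV R d.+1]_v f v =
   \int[leb \x lebesgue_rV R d]_z f (rV_cons z))%E.
Proof.
move=> mf fi; rewrite /= /lebesgue_step integral_pushforward//.
exact: measurable_rV_cons.
Qed.

Definition tensor d (phi : 'I_d -> R -> R) (v : 'rV[R]_d) : R :=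
  \prod_i phi i (v ord0 i).

Lemma measurable_tensor d (phi : 'I_d -> R -> R) :
  (forall i, measurable_fun setT (phi i : measurableTypeR R -> R)) ->
  measurable_fun setT (tensor phi).
Proof.
move=> mphi; apply: measurable_prod => i _.
exact: (measurableT_comp (mphi i) (measurable_coord i)).
Qed.

Lemma tensor_cons d (phi : 'I_d.+1 -> R -> R) z :
  tensor phi (rV_cons z) =
  phi ord0 z.1 * tensor (fun i => phi (lift ord0 i)) z.2.
Proof.
rewrite /tensor big_ord_recl rV_consE0; congr (_ * _).
by apply: eq_bigr => i _; rewrite rV_consES.
Qed.

Lemma ge0_integral_tensor d (phi : 'I_d -> R -> R) :
  (forall i, measurable_fun setT (phi i : measurableTypeR R -> R)) ->
  (forall i x, 0 <= phi i x) ->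
  (\int[lebesgue_rV R d]_v (tensor phi v)%:E =
   \prod_i \int[leb]_x (phi i x)%:E)%E.
Proof.
elim: d phi => [|d IH] phi mphi phi0.
  rewrite /= integral_dirac//; last by apply/measurable_EFinP; exact: measurable_tensor mphi.
  by rewrite diracT mul1e /tensor !big_ord0.
rewrite ge0_integral_rVS; last 2 first.
- by apply/measurable_EFinP; exact: measurable_tensor mphi.
- by move=> x; rewrite lee_fin; apply: prodr_ge0.
under eq_integral => z _ do rewrite tensor_cons.
rewrite (ge0_integral_prodM _ _ (mphi ord0)
  (measurable_tensor (fun i => mphi (lift ord0 i)))) ?big_ord_recl ?IH//.
by move=> x; apply: prodr_ge0.
Qed.

Lemma integrable_tensor d (phi : 'I_d -> R -> R) :
  (forall i, leb.-integrable setT (EFin \o phi i)) ->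
  (lebesgue_rV R d).-integrable setT (EFin \o tensor phi).
Proof.
elim: d phi => [|d IH] phi iphi.
  have mt := measurable_tensor (fun i => integrable_mfun (iphi i)).
  apply/integrableP; split; first exact/measurable_EFinP.
  rewrite integral_dirac//; last first.
    have /measurable_EFinP mn : measurable_fun setT (Num.norm \o tensor phi).
      exact: measurableT_comp.
    exact: mn.
  by rewrite diracT mul1e ltry.
apply: integrable_rVS.
  apply/measurable_EFinP; apply: measurable_tensor => i.
  exact: integrable_mfun (iphi i).
have := integrable_prodM (m2 := lebesgue_rV R d) (iphi ord0)
  (IH _ (fun i => iphi (lift ord0 i))).
by apply: integrable_congr => z; rewrite /= tensor_cons.
Qed.

Lemma measurable_dot d1 (T : measurableType d1) d (f g : T -> 'rV[R]_d) :
  measurable_fun setT f -> measurable_fun setT g ->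
  measurable_fun setT (fun x => dot (f x) (g x)).
Proof.
move=> mf mg; apply: measurable_sum => i; apply: measurable_funM.
- exact: (measurableT_comp (measurable_coord i) mf).
- exact: (measurableT_comp (measurable_coord i) mg).
Qed.

Lemma measurable_dotl d (w : 'rV[R]_d) : measurable_fun setT (fun v => dot v w).
Proof. by apply: measurable_dot. Qed.

Lemma dot_cons d (z : measurableTypeR R * 'rV[R]_d) (w : 'rV[R]_d.+1) :
  dot (rV_cons z) w = z.1 * w ord0 ord0 + dot z.2 (\row_i w ord0 (lift ord0 i)).
Proof.
rewrite /dot big_ord_recl rV_consE0; congr (_ + _).
by apply: eq_bigr => i _; rewrite rV_consES mxE.
Qed.

(** The transform with the factor [exp (i x.w)] and no normalising constant, for
   which a product of functions of one variable has a product as transform. *)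
Definition osc d (mu : {measure set 'rV[R]_d -> \bar R}) (f : 'rV[R]_d -> R)
    (w : 'rV[R]_d) : R[i] :=
  ((\int[mu]_x (f x * cos (dot x w))) +i*
   (\int[mu]_x (f x * sin (dot x w))))%C.

Definition osc1 (f : R -> R) (w : R) : R[i] :=
  ((\int[leb]_x (f x * cos (x * w))) +i*
   (\int[leb]_x (f x * sin (x * w))))%C.

(** Fubini, one coordinate at a time: by the addition formulas, the oscillating
   factor at [rV_cons z] is the complex product of those at the head and at the
   tail. *)
Lemma osc_tensor d (phi : 'I_d -> R -> R) w :
  (forall i, leb.-integrable setT (EFin \o phi i)) ->
  osc (lebesgue_rV R d) (tensor phi) w = \prod_i osc1 (phi i) (w ord0 i).
Proof.
elim: d phi w => [|d IH] phi w iphi.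
  have mt0 := measurable_tensor (fun i => integrable_mfun (iphi i)).
  rewrite big_ord0 /osc /Rintegral !integral_dirac//; last 2 first.
  - apply/measurable_EFinP; apply: measurable_funM; first exact: mt0.
    exact: (measurableT_comp (@measurable_sin R) (measurable_dotl w)).
  - apply/measurable_EFinP; apply: measurable_funM; first exact: mt0.
    exact: (measurableT_comp (@measurable_cos R) (measurable_dotl w)).
  rewrite diracT !mul1e /= /tensor !big_ord0 /dot !big_ord0 cos0 sin0.
  by rewrite mulr1 mulr0.
rewrite big_ord_recl.
set w' : 'rV[R]_d := \row_i w ord0 (lift ord0 i).
have -> : \prod_i osc1 (phi (lift ord0 i)) (w ord0 (lift ord0 i)) =
    osc (lebesgue_rV R d) (tensor (fun i => phi (lift ord0 i))) w'.
  by rewrite IH//; apply: eq_bigr => i _; rewrite mxE.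
set psi := tensor (fun i => phi (lift ord0 i)).
have ipsi : (lebesgue_rV R d).-integrable setT (EFin \o psi).
  exact: integrable_tensor.
have cle := @norm_cos_le1 R.
have sle := @norm_sin_le1 R.
have ic1 : leb.-integrable setT
    (EFin \o fun x => phi ord0 x * cos (x * w ord0 ord0)).
  apply: (integrableM_bounded (M := 1)) => //.
  apply: (measurableT_comp (@measurable_cos R)).
  exact: measurable_funM.
have is1 : leb.-integrable setT
    (EFin \o fun x => phi ord0 x * sin (x * w ord0 ord0)).
  apply: (integrableM_bounded (M := 1)) => //.
  apply: (measurableT_comp (@measurable_sin R)).
  exact: measurable_funM.
have ic2 : (lebesgue_rV R d).-integrable setT
    (EFin \o fun x => psi x * cos (dot x w')).
  apply: (integrableM_bounded (M := 1)) => //.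
  exact: (measurableT_comp (@measurable_cos R) (measurable_dotl w')).
have is2 : (lebesgue_rV R d).-integrable setT
    (EFin \o fun x => psi x * sin (dot x w')).
  apply: (integrableM_bounded (M := 1)) => //.
  exact: (measurableT_comp (@measurable_sin R) (measurable_dotl w')).
have mt : measurable_fun setT (tensor phi).
  apply: measurable_tensor => i; exact: integrable_mfun (iphi i).
have icc := integrable_prodM ic1 ic2; have iss := integrable_prodM is1 is2.
have ics := integrable_prodM ic1 is2; have isc := integrable_prodM is1 ic2.
rewrite /osc /osc1 /=; simpc; congr (_ +i* _)%C.
- rewrite -!Rintegral_prodM// -RintegralB//; congr fine.
  have E z : (tensor phi (rV_cons z) * cos (dot (rV_cons z) w))%:E =
      (phi ord0 z.1 * cos (z.1 * w ord0 ord0) * (psi z.2 * cos (dot z.2 w')) -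
       phi ord0 z.1 * sin (z.1 * w ord0 ord0) * (psi z.2 * sin (dot z.2 w')))%:E.
    by rewrite tensor_cons dot_cons cosD; congr EFin; rewrite -/psi -/w'; ring.
  rewrite (integral_rVS (f := fun v => (tensor phi v * cos (dot v w))%:E)).
  + by apply: eq_integral => z _; rewrite E.
  + apply/measurable_EFinP; apply: measurable_funM => //.
    exact: (measurableT_comp (@measurable_cos R) (measurable_dotl w)).
  + have := integrable_subr icc iss.
    by apply: integrable_congr => z; apply: EFin_inj; rewrite /= E.
- rewrite -!Rintegral_prodM// -RintegralD//; congr fine.
  have E z : (tensor phi (rV_cons z) * sin (dot (rV_cons z) w))%:E =
      (phi ord0 z.1 * cos (z.1 * w ord0 ord0) * (psi z.2 * sin (dot z.2 w')) +
       phi ord0 z.1 * sin (z.1 * w ord0 ord0) * (psi z.2 * cos (dot z.2 w')))%:E.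
    by rewrite tensor_cons dot_cons sinD; congr EFin; rewrite -/psi -/w'; ring.
  rewrite (integral_rVS (f := fun v => (tensor phi v * sin (dot v w))%:E)).
  + by apply: eq_integral => z _; rewrite E.
  + apply/measurable_EFinP; apply: measurable_funM => //.
    exact: (measurableT_comp (@measurable_sin R) (measurable_dotl w)).
  + have := integrable_addr ics isc.
    by apply: integrable_congr => z; apply: EFin_inj; rewrite /= E.
Qed.

End rV_integrals.

(** * The Gaussian and its transform on the line *)
Section dominated.
Context d (T : measurableType d) (R : realType).
Variable mu : {measure set T -> \bar R}.

Lemma Rdominated_cvg (f_ : nat -> T -> R) (f g : T -> R) :
  (forall n, measurable_fun setT (f_ n)) ->
  (forall x, f_ n x @[n --> \oo] --> f x) ->
  mu.-integrable setT (EFin \o g) -> (forall n x, `|f_ n x| <= g x) ->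
  mu.-integrable setT (EFin \o f) /\
  (\int[mu]_x f_ n x)%R @[n --> \oo] --> (\int[mu]_x f x)%R.
Proof.
move=> mf_ ff gi fg.
have mf : measurable_fun setT f.
  by apply: (measurable_fun_cvg mf_) => x _; exact: ff.
have [||||fi _ fl] := @dominated_convergence _ _ _ mu _ measurableT
    (fun n => EFin \o f_ n) (EFin \o f) (EFin \o g) _ _ _ gi.
- by move=> n; exact/measurable_EFinP.
- exact/measurable_EFinP.
- apply/aeW => x _; apply: cvg_EFin; first exact: nearW.
  exact: ff.
- by apply/aeW => x n _ /=; rewrite lee_fin.
split => //; apply: fine_cvg.
by rewrite -RintegralE//.
Qed.

Lemma le_RintegralT (f g : T -> R) :
  mu.-integrable setT (EFin \o f) -> mu.-integrable setT (EFin \o g) ->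
  (forall x, f x <= g x) -> (\int[mu]_x f x <= \int[mu]_x g x)%R.
Proof. by move=> fi gi fg; apply: le_Rintegral. Qed.

Lemma RintegralDT (f g : T -> R) :
  mu.-integrable setT (EFin \o f) -> mu.-integrable setT (EFin \o g) ->
  (\int[mu]_x (f x + g x) = \int[mu]_x f x + \int[mu]_x g x)%R.
Proof. by move=> fi gi; rewrite RintegralD. Qed.

Lemma RintegralBT (f g : T -> R) :
  mu.-integrable setT (EFin \o f) -> mu.-integrable setT (EFin \o g) ->
  (\int[mu]_x (f x - g x) = \int[mu]_x f x - \int[mu]_x g x)%R.
Proof. by move=> fi gi; rewrite RintegralB. Qed.

Lemma RintegralZT k (f : T -> R) :
  mu.-integrable setT (EFin \o f) ->
  (\int[mu]_x (k * f x) = k * \int[mu]_x f x)%R.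
Proof. by move=> fi; rewrite RintegralZl. Qed.

Lemma norm_RintegralT (f g : T -> R) :
  measurable_fun setT f -> mu.-integrable setT (EFin \o g) ->
  (forall x, `|f x| <= g x) ->
  `|\int[mu]_x f x| <= (\int[mu]_x g x)%R.
Proof.
move=> mf gi fg; have fi := dominated_integrable mf fg gi.
rewrite (le_trans (le_normr_Rintegral measurableT fi))//.
by apply: le_RintegralT => //; exact: integrable_norm.
Qed.

End dominated.

Section line.
Context (R : realType).
Local Notation leb := (@lebesgue_measure R).

Lemma integral_is_derive (F f : R -> R) a b : a < b ->
  (forall x : R, is_derive x 1 F (f x)) -> continuous f ->
  (\int[leb]_(x in `[a, b]) (f x)%:E = (F b)%:E - (F a)%:E)%E.
Proof.
move=> ab dF cf.
have cF : continuous F.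
  by move=> x; apply: differentiable_continuous; exact/derivable1_diffP.
apply: continuous_FTC2 => //.
- exact: continuous_subspaceT.
- by split => // *; [apply: cvg_at_right_filter; exact: cF|
    apply: cvg_at_left_filter; exact: cF].
- by move=> x _; rewrite derive1E; apply: derive_val.
Qed.

Lemma Rintegral_is_derive (F f : R -> R) a b : a < b ->
  (forall x : R, is_derive x 1 F (f x)) -> continuous f ->
  (\int[leb]_(x in `[a, b]) f x)%R = F b - F a.
Proof. by move=> ab dF cf; rewrite /Rintegral (integral_is_derive ab dF cf). Qed.

(** Serves as integration by parts on the whole line: the fundamental theorem on
   [`[- n, n]] leaves two values of [H], which tend to 0. *)
Lemma Rintegral_derive_eq0 (H h : R -> R) :
  (forall x : R, is_derive x 1 H (h x)) -> continuous h ->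
  leb.-integrable setT (EFin \o h) ->
  H n%:R @[n --> \oo] --> 0 -> H (- n%:R) @[n --> \oo] --> 0 ->
  (\int[leb]_x h x)%R = 0.
Proof.
move=> dH ch ih H0 H0'.
pose h_ (n : nat) x := h x * \1_(`[- n%:R, n%:R]) x.
have mh := integrable_mfun ih.
have [_ hl] : leb.-integrable setT (EFin \o h) /\
   (\int[leb]_x h_ n x)%R @[n --> \oo] --> (\int[leb]_x h x)%R.
  apply: (@Rdominated_cvg _ _ _ leb h_ h (fun x => `|h x|)).
  - by move=> n; apply: measurable_funM => //; exact: measurable_indic.
  - move=> x; apply: cvg_near_cst; near=> n.
    rewrite /h_ indicE mem_set ?mulr1//= in_itv/= -ler_norml.
    by near: n; exact: nbhs_infty_ger.
  - exact: integrable_norm ih.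
  - move=> n x; rewrite /h_ normrM ler_piMr//.
    by rewrite indicE; case: (_ \in _); rewrite ?normr1 ?normr0.
apply: (cvg_unique _ hl) => //.
rewrite -(subr0 0); apply: (cvg_trans _ (cvgB H0 H0')).
apply: near_eq_cvg; near=> n.
have n0 : 0 < n%:R :> R by rewrite ltr0n; near: n; exact: nbhs_infty_gt.
rewrite -[LHS](@Rintegral_is_derive H h)//; last by lra.
rewrite Rintegral_mkcond; apply: eq_Rintegral => x _.
by rewrite /h_ patchE indicE; case: (_ \in _); rewrite ?mulr1 ?mulr0.
Unshelve. all: by end_near. Qed.

Definition gauss (a x : R) : R := expR (- (a * x) ^+ 2 / 2).

Lemma gauss_normal_fun a c t : 0 < a -> gauss a (c - t) = normal_fun c a^-1 t.
Proof.
by move=> a0; rewrite /gauss /normal_fun; congr expR; field; rewrite gt_eqF.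
Qed.

Lemma measurable_gauss a : measurable_fun setT (gauss a).
Proof.
apply: measurableT_comp => //=; apply: measurable_funM => //=.
by apply: measurableT_comp => //=; apply: measurable_funX => //=.
Qed.

Lemma measurable_gauss_sub a (c : R) :
  measurable_fun setT (fun t : R => gauss a (c - t)).
Proof.
by apply: (measurableT_comp (measurable_gauss a)); exact: measurable_funB.
Qed.

Lemma integral_gauss_sub a c : 0 < a ->
  (\int[leb]_t (gauss a (c - t))%:E = (Num.sqrt (2 * pi) / a)%:E)%E.
Proof.
move=> a0; have V0 : a^-1 != 0 by rewrite invr_eq0 gt_eqF.
have := integral_normal_pdf c a^-1; rewrite normal_pdfE//.
under eq_integral => t _ do rewrite -gauss_normal_fun// EFinM.
rewrite ge0_integralZl//; last 3 first.
- by apply/measurable_EFinP; exact: measurable_gauss_sub.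
- by move=> x _; rewrite lee_fin expR_ge0.
- by rewrite lee_fin normal_peak_ge0.
have p0 := normal_peak_gt0 V0.
have -> : normal_peak a^-1 = a / Num.sqrt (2 * pi).
  rewrite /normal_peak.
  rewrite (_ : a^-1 ^+ 2 * pi *+ 2 = a^-1 ^+ 2 * (2 * pi)); last by ring.
  by rewrite sqrtrM ?sqr_ge0// sqrtr_sqr gtr0_norm ?invr_gt0// invfM invrK.
move=> E.
have s0 : 0 < Num.sqrt (2 * pi) :> R by rewrite sqrtr_gt0 mulr_gt0// pi_gt0.
have F : Num.sqrt (2 * pi) / a * (a / Num.sqrt (2 * pi)) = 1 :> R.
  by field; rewrite !gt_eqF.
by rewrite -[RHS]mule1 -E muleA -EFinM F mul1e.
Qed.

Lemma integral_gauss a : 0 < a ->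
  (\int[leb]_x (gauss a x)%:E = (Num.sqrt (2 * pi) / a)%:E)%E.
Proof.
move=> a0; rewrite -(integral_gauss_sub 0 a0); apply: eq_integral => t _.
by rewrite /gauss sub0r mulrN sqrrN.
Qed.

Lemma integrable_gauss a : 0 < a -> leb.-integrable setT (EFin \o gauss a).
Proof.
move=> a0; apply: ge0_lty_integrable; first exact: measurable_gauss.
- by move=> x; exact: expR_ge0.
- by rewrite integral_gauss// ltry.
Qed.

Lemma is_derive_gauss a (x : R) :
  is_derive x 1 (gauss a) (- (a ^+ 2 * x) * gauss a x).
Proof.
have -> : gauss a = expR \o (fun x => - (a ^+ 2 / 2) * x ^+ 2).
  by apply/funext => y; rewrite /gauss /=; congr expR; by field.
apply: is_derive_eq; rewrite /= /GRing.scale /=; by field.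
Qed.

Lemma integrable_mul_gauss a : 0 < a ->
  leb.-integrable setT (EFin \o (fun x => x * gauss a x)).
Proof.
move=> a0; have s2 : 0 < Num.sqrt 2 :> R by rewrite sqrtr_gt0.
(* Half of the exponent absorbs the factor [x], as [t <= exp (t ^+ 2 / 4)]. *)
have [b b0 b2] : exists2 b, 0 < b & b ^+ 2 = a ^+ 2 / 2.
  by exists (a / Num.sqrt 2); [rewrite divr_gt0|rewrite expr_div_n sqr_sqrtr].
apply: (@dominated_integrable _ _ _ leb _ (fun x => a^-1 * gauss b x)); first 1 last.
- move=> x; rewrite normrM (ger0_norm (expR_ge0 _)) -ler_pdivrMr ?expR_gt0//.
  rewrite /gauss -mulrA -expRN -expRD.
  have -> : (b * x) ^+ 2 = (a * x) ^+ 2 / 2 by rewrite !exprMn b2; ring.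
  rewrite (_ : _ + _ = - ((a * x) ^+ 2 / 4)); last by field.
  rewrite expRN ler_pdivrMr ?expR_gt0//.
  rewrite ler_pdivlMl//; apply: le_trans (expR_ge1Dx _).
  rewrite -{1}(gtr0_norm a0) -normrM.
  have := sqr_ge0 (`|a * x| / 2 - 1); rewrite -(real_normK (num_real (a * x))).
  by nra.
- exact: (integrable_mulZl a^-1 (integrable_gauss b0)).
- by apply: measurable_funM => //; exact: measurable_gauss.
Qed.

Lemma gauss_cvg0 a (u : nat -> R) : 0 < a ->
  (forall n, n%:R <= `|u n|) -> gauss a (u n) @[n --> \oo] --> 0.
Proof.
move=> a0 un.
have e n : (0 < n)%N -> gauss a (u n) <= 2 / a ^+ 2 * n%:R^-1.
  move=> n0; rewrite /gauss mulNr expRN.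
  have nn : 0 < n%:R :> R by rewrite ltr0n.
  rewrite (_ : 2 / a ^+ 2 * n%:R^-1 = ((a ^+ 2 * n%:R) / 2)^-1); last first.
    by rewrite !invfM invrK; ring.
  rewrite lef_pV2 ?posrE ?expR_gt0 ?divr_gt0 ?mulr_gt0 ?exprn_gt0//.
  apply: le_trans (expR_ge1Dx _).
  rewrite exprMn -(real_normK (num_real (u n))).
  have n1 : 1 <= n%:R :> R by rewrite ler1n.
  have nu : n%:R <= `|u n| ^+ 2 by have := un n; nra.
  have a2 : 0 <= a ^+ 2 by exact: sqr_ge0.
  by have := ler_wpM2l a2 nu; lra.
apply: (@squeeze_cvgr _ _ _ _ (cst 0) (fun n => 2 / a ^+ 2 * n%:R^-1)).
- near=> n; rewrite expR_ge0/=; apply: e; near: n; exact: nbhs_infty_gt.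
- exact: cvg_cst.
- rewrite -[X in _ --> X](mulr0 (2 / a ^+ 2)); apply: cvgMr.
  by rewrite -cvg_shiftS; exact: cvg_harmonic.
Unshelve. all: by end_near. Qed.

(* [c = 0] and [c = pi / 2] give the cosine and the sine transforms. *)
Let phase a c u := (\int[leb]_x (gauss a x * cos (x * u - c)))%R.

Let integrable_gaussM a (f : R -> R) : 0 < a -> measurable_fun setT f ->
  (forall x, `|f x| <= 1) ->
  leb.-integrable setT (EFin \o (fun x => gauss a x * f x)).
Proof.
by move=> a0 mf f1; apply: (@integrableM_bounded _ _ _ leb _ f 1 mf f1); exact: integrable_gauss.
Qed.

Let integrable_xgaussM a (f : R -> R) : 0 < a -> measurable_fun setT f ->
  (forall x, `|f x| <= 1) ->
  leb.-integrable setT (EFin \o (fun x => x * gauss a x * f x)).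
Proof.
move=> a0 mf f1; apply: (@integrableM_bounded _ _ _ leb _ f 1 mf f1).
exact: integrable_mul_gauss.
Qed.

Let mcos u c : measurable_fun setT (fun x : R => cos (x * u - c)).
Proof.
apply: (measurableT_comp (@measurable_cos R)).
by apply: measurable_funB => //; exact: measurable_funM.
Qed.

Let msin u c : measurable_fun setT (fun x : R => sin (x * u - c)).
Proof.
apply: (measurableT_comp (@measurable_sin R)).
by apply: measurable_funB => //; exact: measurable_funM.
Qed.

(** Integration by parts, as [- a ^+ 2 * x * gauss a x] is the derivative of the
   Gaussian. *)
Let xsin_phase a c u : 0 < a ->
  a ^+ 2 * (\int[leb]_x (x * gauss a x * sin (x * u - c)))%R = u * phase a c u.
Proof.
move=> a0; apply/eqP; rewrite -subr_eq0; apply/eqP.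
have ic := integrable_gaussM a0 (mcos u c) (fun x => norm_cos_le1 _).
have is_ := integrable_xgaussM a0 (msin u c) (fun x => norm_sin_le1 _).
pose h x := a ^+ 2 * (x * gauss a x * sin (x * u - c)) -
  u * (gauss a x * cos (x * u - c)).
have ih : leb.-integrable setT (EFin \o h).
  by apply: integrable_subr; exact: integrable_mulZl.
rewrite -RintegralZT// -RintegralZT// -RintegralBT//; last 2 first.
- exact: integrable_mulZl.
- exact: integrable_mulZl.
rewrite -/h.
pose H x := - (gauss a x * sin (x * u - c)).
have dH (x : R) : is_derive x 1 H (h x).
  have dg := is_derive_gauss a x.
  by apply: is_derive_eq; rewrite /h /GRing.scale /= /GRing.scale /=; ring.
have H0 (v : nat -> R) : (forall n, n%:R <= `|v n|) ->
    H (v n) @[n --> \oo] --> 0.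
  move=> vn; apply/norm_cvg0P.
  apply: (@squeeze_cvgr _ _ _ _ (cst 0) (fun n => gauss a (v n))).
  - apply: nearW => n; rewrite normr_ge0 normrN normrM (ger0_norm (expR_ge0 _)).
    by rewrite ler_piMr ?expR_ge0// norm_sin_le1.
  - exact: cvg_cst.
  - exact: gauss_cvg0.
apply: (@Rintegral_derive_eq0 H h) => //.
- move=> x; apply: differentiable_continuous; apply/derivable1_diffP.
  by have dg := is_derive_gauss a x; apply: ex_derive.
- by apply: (H0 (fun n => n%:R)) => n; rewrite normr_nat.
- by apply: (H0 (fun n => - n%:R)) => n; rewrite normrN normr_nat.
Qed.

(** Differentiation under the integral sign brings down a factor [x], which
   [xsin_phase] removes again: the transform solves the equation of the
   Gaussian [gauss a^-1]. *)
Let is_derive_phase (a c u : R) : 0 < a ->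
  is_derive u 1 (phase a c) (- (u / a ^+ 2) * phase a c u).
Proof.
move=> a0.
pose f (v x : R) := gauss a x * cos (x * v - c).
have df (v x : R) : is_derive v 1 (f ^~ x) (- (x * gauss a x * sin (x * v - c))).
  by apply: is_derive_eq; rewrite /GRing.scale /= /GRing.scale /=; ring.
pose G (x : R) := `|x * gauss a x|.
have G0 x : 0 <= G x by exact: normr_ge0.
have Iu : `]u - 1, u + 1[%classic u by rewrite /= in_itv/=; apply/andP; split; lra.
have fi (x : R) : `]u - 1, u + 1[%classic x -> leb.-integrable setT (EFin \o f x).
  by move=> _; apply: integrable_gaussM => // y; exact: norm_cos_le1.
have fd (x y : R) : `]u - 1, u + 1[%classic x -> setT y -> derivable (f ^~ y) x 1.
  by move=> _ _; have [] := df x y.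
have Gi : leb.-integrable setT (EFin \o G).
  by apply: integrable_norm; exact: integrable_mul_gauss.
have fG (x y : R) : `]u - 1, u + 1[%classic x -> setT y -> `|partial1of2 f x y| <= G y.
  move=> _ _; rewrite partial1of2E (@derive_val _ _ _ _ _ _ _ (df x y)).
  by rewrite normrN normrM ler_piMr// norm_sin_le1.
have D := derivable_under_integral measurableT Iu fi fd G0 Gi fG.
have V := differentiation_under_integral measurableT Iu fi fd G0 Gi fG.
apply: DeriveDef; first exact: D.
rewrite -derive1E V.
transitivity (\int[leb]_x (- 1 * (x * gauss a x * sin (x * u - c))))%R.
  apply: eq_Rintegral => x _.
  by rewrite partial1of2E (@derive_val _ _ _ _ _ _ _ (df u x)) mulN1r.
rewrite RintegralZT; last exact: (integrable_xgaussM a0 (msin u c) (fun=> norm_sin_le1 _)).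
have a2 : a ^+ 2 != 0 by rewrite expf_neq0// gt_eqF.
apply: (mulfI a2); rewrite mulN1r mulrN xsin_phase//.
by field; rewrite gt_eqF.
Qed.

Let phaseE (a c u : R) : 0 < a ->
  phase a c u = Num.sqrt (2 * pi) / a * cos c * gauss a^-1 u.
Proof.
move=> a0.
(* Both sides solve the same linear equation of order one, so their quotient is
   constant. *)
pose q (v : R) := phase a c v / gauss a^-1 v.
have dq (v : R) : is_derive v 1 q 0.
  have dp := is_derive_phase c v a0; have dg := is_derive_gauss a^-1 v.
  have g0 : gauss a^-1 v != 0 by rewrite gt_eqF// expR_gt0.
  have dV : is_derive v 1 (fun x => (gauss a^-1 x)^-1)
      (- (gauss a^-1 v) ^- 2 *: (- (a^-1 ^+ 2 * v) * gauss a^-1 v)).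
    exact: is_deriveV.
  apply: is_derive_eq; rewrite /GRing.scale /=; field.
  by rewrite g0 gt_eqF.
have qc : q u = q 0.
  exact: is_derive_0_is_cst.
have g00 : gauss a^-1 0 = 1 by rewrite /gauss mulr0 expr0n/= oppr0 mul0r expR0.
have p0 : phase a c 0 = Num.sqrt (2 * pi) / a * cos c.
  rewrite /phase; under eq_Rintegral do rewrite mulr0 sub0r cosN mulrC.
  rewrite RintegralZT; last exact: integrable_gauss.
  by rewrite mulrC /Rintegral integral_gauss.
have g0 : gauss a^-1 u != 0 by rewrite gt_eqF// expR_gt0.
by move: qc; rewrite /q g00 p0 divr1 => <-; rewrite divfK.
Qed.

Lemma osc1_gauss (a u : R) : 0 < a ->
  osc1 (gauss a) u = (Num.sqrt (2 * pi) / a * gauss a^-1 u)%:C%C.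
Proof.
move=> a0; rewrite /osc1; congr (_ +i* _)%C.
- by have := phaseE 0 u a0; rewrite cos0 mulr1 => <-; rewrite /phase;
    under [RHS]eq_Rintegral do rewrite subr0.
- have := phaseE (pi / 2) u a0; rewrite cos_pihalf mulr0 mul0r => <-.
  by rewrite /phase; apply: eq_Rintegral => x _; rewrite cosBpihalf.
Qed.

End line.

(** * The Gaussian on the space *)
Section gaussd.
Context (R : realType) (d : nat).
Local Notation mu := (lebesgue_rV R d).
Local Notation leb := (@lebesgue_measure R).
Local Notation kappa := (twopi_factor R d).
Implicit Types (x y u v w : 'rV[R]_d).

Lemma dotC x y : dot x y = dot y x.
Proof. by apply: eq_bigr => i _; rewrite mulrC. Qed.

Lemma dotBl x y w : dot (x - y) w = dot x w - dot y w.
Proof.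
by rewrite /dot -sumrB; apply: eq_bigr => i _; rewrite !mxE mulrBl.
Qed.

Lemma dot_ge0 x : 0 <= dot x x.
Proof. by apply: sumr_ge0 => i _; rewrite -expr2 sqr_ge0. Qed.

Lemma measurable_subr_rV x : measurable_fun setT (fun y : 'rV[R]_d => x - y).
Proof.
apply: measurable_fun_rVP => i.
rewrite (_ : (fun _ => _) = (fun y : 'rV[R]_d => x ord0 i - y ord0 i)).
  by apply: measurable_funB => //; exact: measurable_coord.
by apply/funext => y; rewrite !mxE.
Qed.

Definition gaussd (a : R) w : R := expR (- (a ^+ 2 * dot w w) / 2).

Lemma gaussdE a w : gaussd a w = tensor (fun=> gauss a) w.
Proof.
rewrite /gaussd /tensor /gauss -expR_sum; congr expR.
rewrite -mulr_suml sumrN; congr (- _ / _).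
by rewrite /dot mulr_sumr; apply: eq_bigr => i _; rewrite exprMn expr2 (expr2 (w _ _)).
Qed.

Lemma gaussd_subE a x y :
  gaussd a (x - y) = tensor (fun i t => gauss a (x ord0 i - t)) y.
Proof. by rewrite gaussdE /tensor; apply: eq_bigr => i _; rewrite !mxE. Qed.

Lemma gaussd_ge0 a w : 0 <= gaussd a w. Proof. exact: expR_ge0. Qed.

Lemma gaussd_le1 a w : gaussd a w <= 1.
Proof.
rewrite /gaussd -expR0 ler_expR mulNr oppr_le0 divr_ge0// mulr_ge0 ?sqr_ge0//.
exact: dot_ge0.
Qed.

Lemma measurable_gaussd a : measurable_fun setT (gaussd a).
Proof.
have m := @measurable_tensor R d (fun=> gauss a) (fun=> measurable_gauss a).
by rewrite (_ : gaussd a = tensor (fun=> gauss a))//; apply/funext/gaussdE.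
Qed.

Lemma integrable_gaussd a : 0 < a -> mu.-integrable setT (EFin \o gaussd a).
Proof.
move=> a0; have := @integrable_tensor R d _ (fun=> integrable_gauss a0).
by apply: integrable_congr => w; rewrite gaussdE.
Qed.

Lemma twopi_factorE : kappa = (Num.sqrt (2 * pi)) ^- d.
Proof.
have p0 : 0 <= 2 * pi :> R by rewrite mulr_ge0// pi_ge0.
by rewrite /twopi_factor powRN (mulrC d%:R) powRrM powR12_sqrt// powR_mulrn ?sqrtr_ge0.
Qed.

Lemma twopi_factor_gt0 : 0 < kappa.
Proof. by rewrite twopi_factorE invr_gt0 exprn_gt0// sqrtr_gt0 mulr_gt0// pi_gt0. Qed.

Lemma osc_gaussd a u : 0 < a ->
  osc mu (gaussd a) u = (kappa^-1 * a ^- d * gaussd a^-1 u)%:C%C.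
Proof.
move=> a0; rewrite (_ : gaussd a = tensor (fun=> gauss a)); last first.
  exact/funext/gaussdE.
rewrite osc_tensor; last by move=> i; exact: integrable_gauss.
under eq_bigr do rewrite osc1_gauss//.
rewrite -(rmorph_prod (real_complex R))/=; congr (_ +i* _)%C.
rewrite big_split/= prodr_const card_ord gaussdE twopi_factorE invrK.
by rewrite expr_div_n.
Qed.

Lemma Rintegral_gaussd_cos a u : 0 < a ->
  (\int[mu]_w (gaussd a w * cos (dot u w)))%R =
  kappa^-1 * a ^- d * gaussd a^-1 u.
Proof.
move=> a0; have := osc_gaussd u a0; rewrite /osc => -[<- _].
by apply: eq_Rintegral => w _; rewrite dotC.
Qed.

Lemma integral_gaussd_sub a x : 0 < a ->
  (\int[mu]_y (gaussd a (x - y))%:E = (kappa^-1 * a ^- d)%:E)%E.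
Proof.
move=> a0; under eq_integral do rewrite gaussd_subE.
rewrite ge0_integral_tensor; last 2 first.
- by move=> i; exact: measurable_gauss_sub.
- by move=> i t; exact: expR_ge0.
under eq_bigr do rewrite integral_gauss_sub//.
rewrite prodEFin prodr_const card_ord twopi_factorE invrK.
by rewrite expr_div_n.
Qed.

Lemma integrable_gaussd_sub a x : 0 < a ->
  mu.-integrable setT (EFin \o (fun y => gaussd a (x - y))).
Proof.
move=> a0; apply: ge0_lty_integrable.
- by apply: (measurableT_comp (@measurable_gaussd a)); exact: measurable_subr_rV.
- by move=> y; exact: gaussd_ge0.
- by rewrite integral_gaussd_sub// ltry.
Qed.
End gaussd.

(** * Fubini and square integrable functions *)
Section real_fubini.
Context d1 d2 (T1 : measurableType d1) (T2 : measurableType d2) (R : realType).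
Variable m1 : {sigma_finite_measure set T1 -> \bar R}.
Variable m2 : {sigma_finite_measure set T2 -> \bar R}.

(** Domination by a product of integrable functions stands for integrability on
   the product space: every integrand below is bounded in this form. *)
Lemma Rfubini (h : T1 * T2 -> R) (a : T1 -> R) (b : T2 -> R) :
  measurable_fun setT h ->
  m1.-integrable setT (EFin \o a) -> m2.-integrable setT (EFin \o b) ->
  (forall x y, `|h (x, y)| <= a x * b y) ->
  [/\ m1.-integrable setT (EFin \o (fun x => \int[m2]_y h (x, y))%R),
      m2.-integrable setT (EFin \o (fun y => \int[m1]_x h (x, y))%R) &
      (\int[m1]_x \int[m2]_y h (x, y) = \int[m2]_y \int[m1]_x h (x, y))%R].
Proof.
move=> mh ai bi hab.
have hi : (m1 \x m2)%E.-integrable setT (EFin \o h).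
  apply: (dominated_integrable (g := fun z => a z.1 * b z.2)) => //.
  - by move=> [x y]; exact: hab.
  - exact: integrable_prodM.
have mh1 x : measurable_fun setT (fun y => h (x, y)).
  by apply: (measurableT_comp mh); exact: measurable_pair1.
have mh2 y : measurable_fun setT (fun x => h (x, y)).
  by apply: (measurableT_comp mh); exact: measurable_pair2.
have h1 x : m2.-integrable setT (EFin \o (fun y => h (x, y))).
  apply: (dominated_integrable (g := fun y => a x * b y)) => //.
  exact: integrable_mulZl.
have h2 y : m1.-integrable setT (EFin \o (fun x => h (x, y))).
  apply: (dominated_integrable (g := fun x => a x * b y)) => //.
  have := integrable_mulZl (b y) ai.
  by apply: integrable_congr => x; rewrite mulrC.
have E1 : fubini_F m2 (EFin \o h) = EFin \o (fun x => \int[m2]_y h (x, y))%R.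
  by apply/funext => x; rewrite /= -RintegralE.
have E2 : fubini_G m1 (EFin \o h) = EFin \o (fun y => \int[m1]_x h (x, y))%R.
  by apply/funext => y; rewrite /= -RintegralE.
have i1 := integrable_fubini_F hi; rewrite E1 in i1.
have i2 : m2.-integrable setT (EFin \o (fun y => \int[m1]_x h (x, y))%R).
  apply: (@dominated_integrable _ _ _ m2 _ (fun y => (\int[m1]_x a x)%R * b y)).
  - by have := measurable_fubini_G hi; rewrite E2 => /measurable_EFinP.
  - move=> y; rewrite mulrC -RintegralZT//; apply: norm_RintegralT => //.
    + exact: integrable_mulZl.
    + by move=> x; rewrite mulrC.
  - exact: integrable_mulZl.
split => //.
apply: EFin_inj; rewrite -!RintegralE//.
have := integral12_prod_meas1 hi; have := integral21_prod_meas1 hi.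
by rewrite E1 E2 => -> ->.
Qed.

End real_fubini.

Lemma cvge0_near_le (R : realType) (u : nat -> \bar R) :
  (forall n, (0 <= u n)%E) -> (u n @[n --> \oo] --> 0)%E ->
  forall e, 0 < e -> \forall n \near \oo, (u n <= e%:E)%E.
Proof.
move=> up u0 e e0; have /fine_cvgP[fin /cvgrPdist_le/(_ e e0) H] := u0.
near=> n.
have : `|0 - fine (u n)| <= e by near: n.
have F : u n \is a fin_num by near: n.
rewrite sub0r normrN ger0_norm; first by rewrite -lee_fin fineK.
exact: fine_ge0.
Unshelve. all: by end_near. Qed.

Section L2.
Context d (T : measurableType d) (R : realType).
Variable mu : {measure set T -> \bar R}.

Lemma Lfun2P (f : T -> R) : f \in Lfun mu 2%:E <->
  measurable_fun setT f /\ mu.-integrable setT (EFin \o (fun x => f x ^+ 2)).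
Proof.
split=> [f2|[mf fi]].
  split; last exact: Lfun2_integrable_sqr.
  by move: f2; rewrite inE => /andP[]; rewrite inE.
rewrite inE; apply/andP; split; rewrite inE//=.
rewrite /finite_norm unlock /=.
apply: poweR_lty.
under eq_integral => x _ do rewrite powR_mulrn// real_normK ?num_real//.
have /integrableP[_] := fi; apply: le_lt_trans.
by under [leRHS]eq_integral => x _ do rewrite /= ger0_norm ?sqr_ge0//.
Qed.

Lemma integrable_mul_L2 (f g : T -> R) :
  measurable_fun setT f -> measurable_fun setT g ->
  mu.-integrable setT (EFin \o (fun x => f x ^+ 2)) ->
  mu.-integrable setT (EFin \o (fun x => g x ^+ 2)) ->
  mu.-integrable setT (EFin \o (fun x => f x * g x)).
Proof.
move=> mf mg fi gi.
apply: (@dominated_integrable _ _ _ _ _ (fun x => f x ^+ 2 + g x ^+ 2)).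
- exact: measurable_funM.
- move=> x; rewrite normrM -(real_normK (num_real (f x))).
  rewrite -(real_normK (num_real (g x))).
  by have := normr_ge0 (f x); have := normr_ge0 (g x); nra.
- exact: integrable_addr.
Qed.

(** Cauchy-Schwarz up to a constant; the free parameter [s] replaces the square
   roots of the two integrals. *)
Lemma norm_integral_mul_le (f g : T -> R) (s : R) : 0 < s ->
  measurable_fun setT f -> measurable_fun setT g ->
  mu.-integrable setT (EFin \o (fun x => f x ^+ 2)) ->
  mu.-integrable setT (EFin \o (fun x => g x ^+ 2)) ->
  `|\int[mu]_x (f x * g x)|%R <=
    (s * (\int[mu]_x g x ^+ 2) + s^-1 * (\int[mu]_x f x ^+ 2))%R.
Proof.
move=> s0 mf mg fi gi.
rewrite -!RintegralZT// -RintegralDT; [|exact: integrable_mulZl..].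
apply: norm_RintegralT.
- exact: measurable_funM.
- by apply: integrable_addr; exact: integrable_mulZl.
- move=> x; rewrite normrM -(real_normK (num_real (f x))).
  rewrite -(real_normK (num_real (g x))).
  have := normr_ge0 (f x); have := normr_ge0 (g x).
  move: (`|f x|) (`|g x|) => u v v0 u0.
  have := sqr_ge0 (s * v - u).
  have V0 : 0 < s^-1 by rewrite invr_gt0.
  move=> H; have := ler_wpM2l (ltW V0) H; rewrite mulr0.
  have -> : s^-1 * (s * v - u) ^+ 2 = s * v ^+ 2 + s^-1 * u ^+ 2 - 2 * (u * v).
    by field; rewrite gt_eqF.
  by have := mulr_ge0 u0 v0; nra.
Qed.

(** Strong convergence in L^2 implies weak convergence. Integrability holds only
   eventually, since the first integrals of squares may be infinite. *)
Lemma L2_cvg0 (u : nat -> T -> R) (v : T -> R) :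
  (forall n, measurable_fun setT (u n)) -> measurable_fun setT v ->
  (\int[mu]_x ((u n x) ^+ 2)%:E @[n --> \oo] --> 0)%E ->
  mu.-integrable setT (EFin \o (fun x => v x ^+ 2)) ->
  (\forall n \near \oo,
     mu.-integrable setT (EFin \o (fun x => u n x * v x))) /\
  (\int[mu]_x (u n x * v x))%R @[n --> \oo] --> 0.
Proof.
move=> mu_ mv u0 vi.
have small := cvge0_near_le _ u0.
have ui : \forall n \near \oo, mu.-integrable setT (EFin \o (fun x => u n x ^+ 2)).
  near=> n; apply: ge0_lty_integrable.
  - exact: measurable_funX.
  - by move=> x; exact: sqr_ge0.
  - apply: (@le_lt_trans _ _ 1%:E); last exact: ltry.
    by near: n; apply: small => // k; apply: integral_ge0 => x _; rewrite lee_fin sqr_ge0.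
split.
  by near=> n; apply: integrable_mul_L2 => //; near: n.
apply/cvgrPdist_le => e e0.
set V := (\int[mu]_x v x ^+ 2)%R.
have V0 : 0 <= V by apply: Rintegral_ge0 => x _; exact: sqr_ge0.
pose s := e / (2 * (V + 1)).
have s0 : 0 < s by rewrite divr_gt0// mulr_gt0// ltr_wpDl.
near=> n; rewrite sub0r normrN.
have un : mu.-integrable setT (EFin \o (fun x => u n x ^+ 2)) by near: n.
have un_le : (\int[mu]_x u n x ^+ 2)%R <= e * s / 2.
  rewrite -lee_fin -RintegralE//; near: n; apply: small.
    by move=> k; apply: integral_ge0 => x _; rewrite lee_fin sqr_ge0.
  by rewrite divr_gt0// mulr_gt0.
apply: (le_trans (norm_integral_mul_le s0 _ _ un vi)) => //.
rewrite -/V [leRHS]splitr lerD//.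
  by rewrite /s mulrAC ler_pdivrMr ?mulr_gt0 ?ltr_wpDl//; nra.
rewrite ler_pdivrMl//; apply: (le_trans un_le); lra.
Unshelve. all: by end_near. Qed.

End L2.

(** * Transforms of integrable functions *)
Section fourier_facts.
Context (R : realType) (d : nat).
Local Notation mu := (lebesgue_rV R d).
Local Notation kappa := (twopi_factor R d).
Implicit Types (x y u v w : 'rV[R]_d) (f F : 'rV[R]_d -> R).
Implicit Types (g : 'rV[R]_d -> R[i]).

(** The real part of [z * exp (i t)]. *)
Definition wave (z : R[i]) (t : R) : R :=
  complex.Re z * cos t - complex.Im z * sin t.

Lemma sqnormc_ge0 (z : R[i]) : 0 <= sqnormc z.
Proof. by rewrite /sqnormc addr_ge0 ?sqr_ge0. Qed.

Lemma wave_sqr_le (z : R[i]) t : wave z t ^+ 2 <= sqnormc z.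
Proof.
rewrite /wave /sqnormc; have := sqr_ge0 (complex.Re z * sin t + complex.Im z * cos t).
by have := cos2Dsin2 t; nra.
Qed.

Lemma wave_norm_le (z : R[i]) t :
  `|wave z t| <= `|complex.Re z| + `|complex.Im z|.
Proof.
rewrite /wave (le_trans (ler_normB _ _))// lerD// normrM ler_piMr//.
  exact: norm_cos_le1.
exact: norm_sin_le1.
Qed.

Lemma waveB (z z' : R[i]) t : wave (z - z') t = wave z t - wave z' t.
Proof. by case: z => a b; case: z' => a' b'; rewrite /wave /=; ring. Qed.

Definition cmeasurable g :=
  measurable_fun setT (fun w => complex.Re (g w)) /\
  measurable_fun setT (fun w => complex.Im (g w)).

Lemma measurable_dotr x : measurable_fun setT (fun w => dot x w).
Proof. by apply: measurable_dot. Qed.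

Lemma measurable_wave g x : cmeasurable g ->
  measurable_fun setT (fun w => wave (g w) (dot x w)).
Proof.
move=> [mr mi]; apply: measurable_funB; apply: measurable_funM => //.
- exact: (measurableT_comp (@measurable_cos R) (measurable_dotr x)).
- exact: (measurableT_comp (@measurable_sin R) (measurable_dotr x)).
Qed.

Lemma measurable_sqnormc g : cmeasurable g ->
  measurable_fun setT (fun w => sqnormc (g w)).
Proof.
by move=> [mr mi]; apply: measurable_funD; apply: measurable_funX.
Qed.

Lemma cmeasurableB g g' : cmeasurable g -> cmeasurable g' ->
  cmeasurable (fun w => g w - g' w).
Proof.
move=> [mr mi] [mr' mi']; split.
- rewrite (_ : (fun _ => _) = fun w => complex.Re (g w) - complex.Re (g' w)).
    exact: measurable_funB.
  by apply/funext => w; case: (g w) => a b; case: (g' w).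
- rewrite (_ : (fun _ => _) = fun w => complex.Im (g w) - complex.Im (g' w)).
    exact: measurable_funB.
  by apply/funext => w; case: (g w) => a b; case: (g' w).
Qed.

Lemma measurable_sqnormcB g g' : cmeasurable g -> cmeasurable g' ->
  measurable_fun setT (fun w => (sqnormc (g w - g' w))%:E).
Proof.
move=> mg mg'; apply/measurable_EFinP; apply: measurable_sqnormc.
exact: cmeasurableB.
Qed.

Lemma measurable_dot2r : measurable_fun setT
  (fun z : 'rV[R]_d * 'rV[R]_d => dot z.2 z.1).
Proof. by apply: measurable_dot; [exact: measurable_snd|exact: measurable_fst]. Qed.

Section L1.
Variable F : 'rV[R]_d -> R.
Hypothesis Fi : mu.-integrable setT (EFin \o F).

Let gaussd1 := @integrable_gaussd R d 1 ltr01.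

(** [F y * t (dot y w)] is not integrable in [w], so a Gaussian weight in [w] is
   inserted before Fubini and divided out afterwards. *)
Let measurable_trig (t : R -> R) : measurable_fun setT t ->
  (forall s, `|t s| <= 1) ->
  measurable_fun setT (fun w => (\int[mu]_y (F y * t (dot y w)))%R).
Proof.
move=> mt t1.
pose h (z : 'rV[R]_d * 'rV[R]_d) := gaussd 1 z.1 * F z.2 * t (dot z.2 z.1).
have mh : measurable_fun setT h.
  apply: measurable_funM; first apply: measurable_funM.
  - exact: (measurableT_comp (@measurable_gaussd R d 1) measurable_fst).
  - exact: (measurableT_comp (integrable_mfun Fi) measurable_snd).
  - exact: (measurableT_comp mt measurable_dot2r).
have hb w y : `|h (w, y)| <= gaussd 1 w * `|F y|.
  rewrite /h /= !normrM (ger0_norm (gaussd_ge0 _ _)) ler_piMr// mulr_ge0//.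
  exact: gaussd_ge0.
have [i1 _ _] := Rfubini mh gaussd1 (integrable_norm Fi) hb.
have it w : mu.-integrable setT (EFin \o (fun y => F y * t (dot y w))).
  apply: (integrableM_bounded (M := 1)) => //.
  exact: (measurableT_comp mt (measurable_dotl w)).
have -> : (fun w => (\int[mu]_y (F y * t (dot y w)))%R) =
    fun w => expR (1 ^+ 2 * dot w w / 2) * (\int[mu]_y h (w, y))%R.
  apply/funext => w; transitivity
      (expR (1 ^+ 2 * dot w w / 2) * (gaussd 1 w * \int[mu]_y (F y * t (dot y w))))%R.
    by rewrite mulrA /gaussd mulNr expRN divff ?mul1r// gt_eqF// expR_gt0.
  rewrite -RintegralZT//; congr (_ * _); apply: eq_Rintegral => y _.
  by rewrite /h /= mulrA.
apply: measurable_funM; last exact: integrable_mfun i1.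
apply: measurableT_comp => //; apply: measurable_funM => //.
by apply: measurable_funM => //; exact: measurable_dot.
Qed.

Lemma integrable_cos_sub x w :
  mu.-integrable setT (EFin \o (fun y => F y * cos (dot (x - y) w))).
Proof.
apply: (integrableM_bounded (M := 1)) => //.
- apply: (measurableT_comp (@measurable_cos R)).
  by apply: measurable_dot => //; exact: measurable_subr_rV.
- by move=> y; exact: norm_cos_le1.
Qed.

Lemma cmeasurable_fourier_L1 : cmeasurable (fourier_L1 F).
Proof.
split; rewrite /fourier_L1 /=.
- apply: measurable_funM => //; apply: measurable_trig; first exact: measurable_cos.
  exact: norm_cos_le1.
- apply: measurableT_comp => //.
  apply: measurable_funM => //; apply: measurable_trig; first exact: measurable_sin.
  exact: norm_sin_le1.
Qed.

Lemma integrable_cosM w :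
  mu.-integrable setT (EFin \o (fun y => F y * cos (dot y w))).
Proof.
apply: (integrableM_bounded (M := 1)) => //.
- exact: (measurableT_comp (@measurable_cos R) (measurable_dotl w)).
- by move=> y; exact: norm_cos_le1.
Qed.

Lemma integrable_sinM w :
  mu.-integrable setT (EFin \o (fun y => F y * sin (dot y w))).
Proof.
apply: (integrableM_bounded (M := 1)) => //.
- exact: (measurableT_comp (@measurable_sin R) (measurable_dotl w)).
- by move=> y; exact: norm_sin_le1.
Qed.

Lemma wave_fourier_L1 x w :
  wave (fourier_L1 F w) (dot x w) =
  kappa * (\int[mu]_y (F y * cos (dot (x - y) w)))%R.
Proof.
rewrite /wave /= mulNr opprK -!mulrA -mulrDr; congr (_ * _).
rewrite mulrC [X in _ + X]mulrC.
rewrite -RintegralZT; last exact: integrable_cosM.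
rewrite -RintegralZT; last exact: integrable_sinM.
rewrite -RintegralDT; last 2 first.
- by apply: integrable_mulZl; exact: integrable_cosM.
- by apply: integrable_mulZl; exact: integrable_sinM.
by apply: eq_Rintegral => y _; rewrite dotBl cosB; ring.
Qed.

(** One factor of the squared modulus is written out as an integral, to prepare
   an exchange of integrals over [x] and [w]. *)
Lemma sqnormc_fourier_L1 w :
  sqnormc (fourier_L1 F w) =
  kappa * (\int[mu]_x (F x * wave (fourier_L1 F w) (dot x w)))%R.
Proof.
rewrite {1}/sqnormc.
set z := fourier_L1 F w.
have -> : complex.Re z ^+ 2 = kappa * (complex.Re z * \int[mu]_x (F x * cos (dot x w)))%R.
  by rewrite /z /=; ring.
have -> : complex.Im z ^+ 2 = kappa * (- complex.Im z * \int[mu]_x (F x * sin (dot x w)))%R.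
  by rewrite /z /=; ring.
rewrite -mulrDr; congr (_ * _).
rewrite -RintegralZT; last exact: integrable_cosM.
rewrite -RintegralZT; last exact: integrable_sinM.
rewrite -RintegralDT; last 2 first.
- by apply: integrable_mulZl; exact: integrable_cosM.
- by apply: integrable_mulZl; exact: integrable_sinM.
by apply: eq_Rintegral => y _; rewrite /wave; ring.
Qed.

Let bound : R := kappa * (\int[mu]_y `|F y|)%R.

Lemma wave_fourier_L1_le x w : `|wave (fourier_L1 F w) (dot x w)| <= bound.
Proof.
rewrite wave_fourier_L1 normrM (ger0_norm (ltW (twopi_factor_gt0 _ _))).
rewrite ler_wpM2l ?(ltW (twopi_factor_gt0 _ _))//; apply: norm_RintegralT.
- apply: measurable_funM; first exact: integrable_mfun Fi.
  apply: (measurableT_comp (@measurable_cos R)).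
  by apply: measurable_dot => //; exact: measurable_subr_rV.
- exact: integrable_norm.
- by move=> y; rewrite normrM ler_piMr// norm_cos_le1.
Qed.

(** Fubini moves the Gaussian onto the exponentials, where its transform is
   known: a Gaussian multiplier on the transform side becomes a convolution with
   a Gaussian of inverse width. *)
Lemma wave_gauss_fourier_L1 a x : 0 < a ->
  (\int[mu]_w (wave (fourier_L1 F w) (dot x w) * gaussd a w) =
   \int[mu]_y (F y * (a ^- d * gaussd a^-1 (x - y))))%R.
Proof.
move=> a0.
pose h (z : 'rV[R]_d * 'rV[R]_d) :=
  kappa * (gaussd a z.1 * F z.2 * cos (dot (x - z.2) z.1)).
have mh : measurable_fun setT h.
  apply: measurable_funM => //; apply: measurable_funM; first apply: measurable_funM.
  - exact: (measurableT_comp (@measurable_gaussd R d a) measurable_fst).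
  - exact: (measurableT_comp (integrable_mfun Fi) measurable_snd).
  - apply: (measurableT_comp (@measurable_cos R)).
    apply: measurable_dot; last exact: measurable_fst.
    exact: (measurableT_comp (measurable_subr_rV x) measurable_snd).
have hb w y : `|h (w, y)| <= gaussd a w * (kappa * `|F y|).
  rewrite /h /= !normrM (ger0_norm (gaussd_ge0 _ _)).
  rewrite (ger0_norm (ltW (twopi_factor_gt0 _ _))) [leRHS]mulrCA ler_wpM2l//.
    exact: ltW (twopi_factor_gt0 _ _).
  by rewrite ler_piMr ?norm_cos_le1// mulr_ge0// gaussd_ge0.
have Fk := integrable_mulZl kappa (integrable_norm Fi).
have [_ _ E] := Rfubini mh (integrable_gaussd d a0) Fk hb.
transitivity (\int[mu]_w \int[mu]_y h (w, y))%R.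
  apply: eq_Rintegral => w _; have ic := integrable_cos_sub x w.
  rewrite wave_fourier_L1 -RintegralZT// mulrC -RintegralZT; last first.
    exact: integrable_mulZl.
  by apply: eq_Rintegral => y _; rewrite /h /=; ring.
rewrite E; apply: eq_Rintegral => y _.
transitivity (kappa * F y * \int[mu]_w (gaussd a w * cos (dot (x - y) w)))%R.
  rewrite -RintegralZT; last first.
    apply: (integrableM_bounded (M := 1)); last exact: integrable_gaussd.
    + exact: (measurableT_comp (@measurable_cos R) (measurable_dotr _)).
    + by move=> w; exact: norm_cos_le1.
  by apply: eq_Rintegral => w _; rewrite /h /=; ring.
rewrite Rintegral_gaussd_cos//; field.
by rewrite !gt_eqF ?twopi_factor_gt0 ?exprn_gt0.
Qed.

End L1.
End fourier_facts.

(** * The inequality half of Plancherel's theorem *)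
Section plancherel.
Context (R : realType) (d : nat).
Local Notation mu := (lebesgue_rV R d).
Local Notation kappa := (twopi_factor R d).
Implicit Types (x y u v w : 'rV[R]_d) (f F : 'rV[R]_d -> R).
Implicit Types (g : 'rV[R]_d -> R[i]).

Lemma gaussd_subC a x y : gaussd a (x - y) = gaussd a (y - x).
Proof.
suff E : dot (x - y) (x - y) = dot (y - x) (y - x) by rewrite /gaussd E.
by apply: eq_bigr => i _; rewrite !mxE; ring.
Qed.

Lemma gaussd_cvg1 w : gaussd n.+1%:R^-1 w @[n --> \oo] --> (1 : R).
Proof.
rewrite -[X in _ --> X](_ : expR (- (0 * 0 * dot w w) / 2) = 1); last first.
  by rewrite !mul0r oppr0 mul0r expR0.
apply: continuous_cvg; first exact: continuous_expR.
apply: cvgMl; apply: cvgN; apply: cvgMl.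
under eq_fun do rewrite expr2.
by apply: cvgM; exact: cvg_harmonic.
Qed.

(** The Gaussian of width [a], scaled to the total mass [kappa^-1]. *)
Definition bell (a : R) u : R := a ^- d * gaussd a^-1 u.

Lemma bell_ge0 a u : 0 < a -> 0 <= bell a u.
Proof. by move=> a0; rewrite mulr_ge0 ?gaussd_ge0// invr_ge0 exprn_ge0// ltW. Qed.

Lemma measurable_bell_sub a x : measurable_fun setT (fun y => bell a (x - y)).
Proof.
apply: measurable_funM => //.
by apply: (measurableT_comp (@measurable_gaussd R d _)); exact: measurable_subr_rV.
Qed.

Lemma integral_bell_sub a x : 0 < a ->
  (\int[mu]_y (bell a (x - y))%:E = kappa^-1%:E)%E.
Proof.
move=> a0; under eq_integral do rewrite EFinM.
rewrite ge0_integralZl//; last 3 first.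
- apply/measurable_EFinP.
  by apply: (measurableT_comp (@measurable_gaussd R d _)); exact: measurable_subr_rV.
- by move=> y _; rewrite lee_fin gaussd_ge0.
- by rewrite lee_fin invr_ge0 exprn_ge0// ltW.
rewrite integral_gaussd_sub ?invr_gt0// -EFinM; congr EFin.
rewrite exprVn invrK mulrCA mulVf ?mulr1//.
by rewrite expf_neq0// gt_eqF.
Qed.

Lemma integral_bell_subr a y : 0 < a ->
  (\int[mu]_x (bell a (x - y))%:E = kappa^-1%:E)%E.
Proof.
move=> a0; rewrite -(integral_bell_sub y a0); apply: eq_integral => x _.
by rewrite /bell gaussd_subC.
Qed.

Lemma integrable_bell_sub a x : 0 < a ->
  mu.-integrable setT (EFin \o (fun y => bell a (x - y))).
Proof.
move=> a0; apply: ge0_lty_integrable; first exact: measurable_bell_sub.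
- by move=> y; exact: bell_ge0.
- by rewrite integral_bell_sub// ltry.
Qed.

Lemma sqr_bell_sub a x : 0 < a ->
  mu.-integrable setT (EFin \o (fun y => bell a (x - y) ^+ 2)).
Proof.
move=> a0.
apply: (@dominated_integrable _ _ _ mu _ (fun y => a ^- d * bell a (x - y))).
- by apply: measurable_funX; exact: measurable_bell_sub.
- move=> y; rewrite ger0_norm ?sqr_ge0// expr2 ler_wpM2r ?bell_ge0//.
  by rewrite /bell ler_piMr ?gaussd_le1// invr_ge0 exprn_ge0// ltW.
- by apply: integrable_mulZl; exact: integrable_bell_sub.
Qed.

Lemma measurable_wavel (c : R[i]) w :
  measurable_fun setT (fun x => wave c (dot x w)).
Proof.
apply: measurable_funB; apply: measurable_funM => //.
  exact: (measurableT_comp (@measurable_cos R) (measurable_dotl w)).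
exact: (measurableT_comp (@measurable_sin R) (measurable_dotl w)).
Qed.

Section L1L2.
Variable F : 'rV[R]_d -> R.
Hypothesis Fi : mu.-integrable setT (EFin \o F).
Hypothesis F2 : mu.-integrable setT (EFin \o (fun x => F x ^+ 2)).

Let k0 : 0 < kappa. Proof. exact: twopi_factor_gt0. Qed.

Let mF : measurable_fun setT F. Proof. exact: integrable_mfun Fi. Qed.

(** [2 * F x * F y <= F x ^+ 2 + F y ^+ 2], integrated in [y] against a bell of
   mass [kappa^-1]. *)
Let conv_le a x : 0 < a ->
  (`|kappa * (F x * \int[mu]_y (F y * bell a (x - y)))%R|%:E <=
   (F x ^+ 2 / 2)%:E +
   (kappa / 2)%:E * \int[mu]_y (F y ^+ 2 * bell a (x - y))%:E)%E.
Proof.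
move=> a0; have mb := measurable_bell_sub a x.
have k2 : 0 <= kappa / 2 by rewrite divr_ge0// ltW.
have Fb : mu.-integrable setT (EFin \o (fun y => F y * bell a (x - y))).
  by apply: integrable_mul_L2 => //; exact: sqr_bell_sub.
have -> : kappa * (F x * \int[mu]_y (F y * bell a (x - y)))%R =
    (\int[mu]_y (kappa * F x * (F y * bell a (x - y))))%R.
  by rewrite RintegralZT// mulrA.
have Gi := integrable_mulZl (kappa * F x) Fb.
rewrite EFin_normr_Rintegral//.
apply: (le_trans (le_abse_integral _ _ _)) => //.
  exact: measurable_int Gi.
apply: (@le_trans _ _ (\int[mu]_y ((kappa / 2 * F x ^+ 2) * bell a (x - y) +
    kappa / 2 * (F y ^+ 2 * bell a (x - y)))%:E)%E).
  apply: ge0_le_integral => //.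
  - by apply: measurableT_comp => //; exact: measurable_int Gi.
  - apply/measurable_EFinP; apply: measurable_funD; apply: measurable_funM => //.
    by apply: measurable_funM => //; exact: measurable_funX.
  - move=> y _; rewrite lee_fin normrM normrM normrM.
    rewrite (gtr0_norm k0) (ger0_norm (bell_ge0 _ a0)).
    have := bell_ge0 (x - y) a0.
    rewrite -(real_normK (num_real (F x))) -(real_normK (num_real (F y))).
    move: (`|F x|) (`|F y|) (bell a (x - y)) => s t b b0.
    have := sqr_ge0 (s - t) => H; have := mulr_ge0 b0 H => {}H.
    have := mulr_ge0 (ltW k0) H; nra.
under eq_integral do rewrite EFinD.
rewrite ge0_integralD//; last 4 first.
- by move=> y _; rewrite lee_fin mulr_ge0 ?bell_ge0// mulr_ge0// sqr_ge0.
- by apply/measurable_EFinP; apply: measurable_funM.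
- by move=> y _; rewrite lee_fin mulr_ge0// mulr_ge0 ?bell_ge0// sqr_ge0.
- apply/measurable_EFinP; apply: measurable_funM => //.
  by apply: measurable_funM => //; exact: measurable_funX.
apply: leeD.
  under eq_integral do rewrite EFinM.
  rewrite ge0_integralZl//; last 3 first.
  - exact/measurable_EFinP.
  - by move=> y _; rewrite lee_fin bell_ge0.
  - by rewrite lee_fin mulr_ge0// sqr_ge0.
  rewrite integral_bell_sub// -EFinM lee_fin.
  by rewrite le_eqVlt; apply/orP; left; apply/eqP; field; rewrite gt_eqF.
under eq_integral do rewrite EFinM.
rewrite ge0_integralZl//.
- apply/measurable_EFinP.
  by apply: measurable_funM => //; exact: measurable_funX.
- by move=> y _; rewrite lee_fin mulr_ge0 ?bell_ge0// sqr_ge0.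
Qed.

Let measurable_conv a : measurable_fun setT (fun z : 'rV[R]_d * 'rV[R]_d =>
  (F z.2 ^+ 2 * bell a (z.1 - z.2))%:E).
Proof.
apply/measurable_EFinP; apply: measurable_funM.
  apply: measurable_funX.
  exact: (measurableT_comp mF measurable_snd).
apply: measurable_funM => //.
apply: (measurableT_comp (@measurable_gaussd R d _)).
apply: measurable_fun_rVP => i.
rewrite (_ : (fun _ => _) = (fun z : 'rV[R]_d * 'rV[R]_d =>
    z.1 ord0 i - z.2 ord0 i)); last by apply/funext => z; rewrite !mxE.
apply: measurable_funB.
  exact: (measurableT_comp (measurable_coord i) measurable_fst).
exact: (measurableT_comp (measurable_coord i) measurable_snd).
Qed.

Let conv_ge0 a (z : 'rV[R]_d * 'rV[R]_d) : 0 < a ->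
  (0 <= (F z.2 ^+ 2 * bell a (z.1 - z.2))%:E)%E.
Proof. by move=> a0; rewrite lee_fin mulr_ge0 ?bell_ge0// sqr_ge0. Qed.

Let conv_total a : 0 < a ->
  (\int[mu]_x \int[mu]_y (F y ^+ 2 * bell a (x - y))%:E =
   (kappa^-1)%:E * \int[mu]_y (F y ^+ 2)%:E)%E.
Proof.
move=> a0; have m2 := measurable_conv a.
rewrite (fubini_tonelli _ m2); last first.
  by move=> z; rewrite lee_fin mulr_ge0 ?bell_ge0// sqr_ge0.
rewrite -ge0_integralZl//; last 3 first.
- by apply/measurable_EFinP; exact: measurable_funX.
- by move=> y _; rewrite lee_fin sqr_ge0.
- by rewrite lee_fin invr_ge0 ltW.
apply: eq_integral => y _ /=.
under eq_integral do rewrite EFinM.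
rewrite ge0_integralZl//; last 3 first.
- apply/measurable_EFinP.
  rewrite (_ : (fun _ => _) = fun x => bell a (y - x)).
    exact: measurable_bell_sub.
  by apply/funext => x; rewrite /bell gaussd_subC.
- by move=> x _; rewrite lee_fin bell_ge0.
- by rewrite lee_fin sqr_ge0.
by rewrite integral_bell_subr// muleC.
Qed.

(** By [wave_gauss_fourier_L1] and Fubini, the left side is the integral of [F]
   times its convolution with a bell; convolution with a positive kernel of fixed
   mass does not increase the L^2 norm. *)
Let damped a : 0 < a ->
  (\int[mu]_w (sqnormc (fourier_L1 F w) * gaussd a w)%:E <=
   \int[mu]_x (F x ^+ 2)%:E)%E.
Proof.
move=> a0; pose B := kappa * (\int[mu]_y `|F y|)%R.
(* Only these properties of the transform are used; it is kept abstract. *)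
have [z [<- mz zB zE zC]] : exists z, [/\ z = fourier_L1 F, cmeasurable z,
    forall x w, `|wave (z w) (dot x w)| <= B,
    forall w, sqnormc (z w) =
      kappa * (\int[mu]_x (F x * wave (z w) (dot x w)))%R &
    forall x, (\int[mu]_w (wave (z w) (dot x w) * gaussd a w) =
      \int[mu]_y (F y * bell a (x - y)))%R].
  exists (fourier_L1 F); split => //.
  - exact: cmeasurable_fourier_L1.
  - exact: wave_fourier_L1_le.
  - exact: sqnormc_fourier_L1.
  - by move=> x; exact: wave_gauss_fourier_L1.
pose h (p : 'rV[R]_d * 'rV[R]_d) :=
  kappa * (F p.2 * (wave (z p.1) (dot p.2 p.1) * gaussd a p.1)).
have [mr mi] := mz.
have mwave : measurable_fun setT (fun p : 'rV[R]_d * 'rV[R]_d =>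
    wave (z p.1) (dot p.2 p.1)).
  have md := @measurable_dot2r R d.
  apply: measurable_funB; apply: measurable_funM.
  - exact: (measurableT_comp mr measurable_fst).
  - exact: (measurableT_comp (@measurable_cos R) md).
  - exact: (measurableT_comp mi measurable_fst).
  - exact: (measurableT_comp (@measurable_sin R) md).
have mh : measurable_fun setT h.
  apply: measurable_funM => //; apply: measurable_funM.
    exact: (measurableT_comp mF measurable_snd).
  apply: measurable_funM => //.
  exact: (measurableT_comp (@measurable_gaussd R d a) measurable_fst).
have hb w x : `|h (w, x)| <= gaussd a w * (kappa * B * `|F x|).
  rewrite /h /= !normrM (ger0_norm (gaussd_ge0 _ _)) (gtr0_norm k0).
  rewrite [leRHS](_ : _ = kappa * (`|F x| * (B * gaussd a w))); last by ring.
  apply: ler_wpM2l; first exact: ltW.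
  apply: ler_wpM2l => //; apply: ler_wpM2r; first exact: gaussd_ge0.
  exact: zB.
have Fk := integrable_mulZl (kappa * B) (integrable_norm Fi).
have [i1 i2 E] := Rfubini mh (integrable_gaussd d a0) Fk hb.
have iw w : mu.-integrable setT (EFin \o (fun x => F x * wave (z w) (dot x w))).
  apply: (@integrableM_bounded _ _ _ mu F (fun x => wave (z w) (dot x w)) B).
  - exact: measurable_wavel.
  - by move=> x; exact: zB.
  - exact: Fi.
have E1 : (fun w => \int[mu]_x h (w, x))%R =
    fun w => sqnormc (z w) * gaussd a w.
  apply/funext => w; rewrite zE -mulrA [in RHS]mulrC.
  rewrite [RHS](_ : _ = (kappa * gaussd a w) *
      (\int[mu]_x (F x * wave (z w) (dot x w)))%R); last by ring.
  rewrite -(RintegralZT _ (iw w)).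
  apply: eq_Rintegral => x _.
  by rewrite /h /=; ring.
have E2 : (fun x => \int[mu]_w h (w, x))%R =
    fun x => kappa * (F x * \int[mu]_y (F y * bell a (x - y)))%R.
  apply/funext => x; rewrite -zC mulrA -RintegralZT.
    by apply: eq_Rintegral => w _; rewrite /h /=; ring.
  apply: (@dominated_integrable _ _ _ mu _ (fun w => B * gaussd a w)).
  - apply: measurable_funM; first by apply: measurable_wave.
    exact: measurable_gaussd.
  - move=> w; rewrite normrM (ger0_norm (gaussd_ge0 _ _)).
    by rewrite ler_wpM2r ?gaussd_ge0.
  - by apply: integrable_mulZl; exact: integrable_gaussd.
rewrite E1 in i1 E; rewrite E2 in i2 E.
rewrite RintegralE// E -RintegralE//.
have mc : measurable_fun setT
    (fun x => \int[mu]_y (F y ^+ 2 * bell a (x - y))%:E)%E.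
  apply: (measurable_fun_fubini_tonelli_F _ (measurable_conv a)) => p.
  exact: conv_ge0.
have c0 x : (0 <= \int[mu]_y (F y ^+ 2 * bell a (x - y))%:E)%E.
  by apply: integral_ge0 => y _; exact: (conv_ge0 (x, y)).
have mF2 : measurable_fun setT (fun x => (F x ^+ 2 / 2)%:E).
  by apply/measurable_EFinP; apply: measurable_funM => //; exact: measurable_funX.
have k2 : (0 <= (kappa / 2)%:E)%E by rewrite lee_fin divr_ge0// ltW.
have F0 x : (0 <= (F x ^+ 2 / 2)%:E)%E by rewrite lee_fin divr_ge0// sqr_ge0.
apply: (@le_trans _ _ (\int[mu]_x ((F x ^+ 2 / 2)%:E +
   (kappa / 2)%:E * \int[mu]_y (F y ^+ 2 * bell a (x - y))%:E))%E).
  apply: (@le_trans _ _ (\int[mu]_x `|(kappa *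
      (F x * \int[mu]_y (F y * bell a (x - y))))%R|%:E)%E).
    have := @le_abse_integral _ _ _ mu setT _ measurableT (measurable_int _ i2).
    by apply: le_trans; exact: lee_abs.
  apply: ge0_le_integral => //.
  - apply/measurable_EFinP; apply: measurableT_comp => //.
    exact: integrable_mfun i2.
  - by apply: emeasurable_funD => //; exact: emeasurable_funM.
  - by move=> x _; exact: conv_le.
rewrite ge0_integralD//; last 2 first.
- by move=> x _; rewrite mule_ge0.
- exact: emeasurable_funM.
rewrite ge0_integralZl// conv_total//.
rewrite muleA -EFinM.
rewrite (_ : kappa / 2 / kappa = 2^-1); last by field; rewrite gt_eqF.
have -> : (\int[mu]_x (F x ^+ 2 / 2)%:E = 2^-1%:E * \int[mu]_x (F x ^+ 2)%:E)%E.
  under eq_integral do rewrite mulrC EFinM.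
  rewrite ge0_integralZl//; first exact/measurable_EFinP/measurable_funX.
  by move=> x _; rewrite lee_fin sqr_ge0.
rewrite (RintegralE F2) -!EFinM -EFinD lee_fin; lra.
Qed.

(** The Gaussians increase to 1, so [damped] passes to the limit by monotone
   convergence. *)
Lemma plancherel_le :
  (\int[mu]_w (sqnormc (fourier_L1 F w))%:E <= \int[mu]_x (F x ^+ 2)%:E)%E.
Proof.
have ms := measurable_sqnormc (cmeasurable_fourier_L1 Fi).
have zp w := sqnormc_ge0 (fourier_L1 F w).
move: (fourier_L1 F) ms zp damped => z ms zp dz.
pose h (n : nat) w := (sqnormc (z w) * gaussd n.+1%:R^-1 w)%:E.
have hl w : h ^~ w @ \oo --> (sqnormc (z w))%:E.
  apply: cvg_EFin; first exact: nearW.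
  by rewrite -[X in _ --> X]mulr1; apply: cvgMr; exact: gaussd_cvg1.
have E : (\int[mu]_w (sqnormc (z w))%:E = \int[mu]_w limn (h ^~ w))%E.
  by apply: eq_integral => w _; apply/esym/cvg_lim.
rewrite E monotone_convergence//; last 3 first.
- move=> n; apply/measurable_EFinP; apply: measurable_funM => //.
  exact: measurable_gaussd.
- by move=> n w _; rewrite lee_fin mulr_ge0 ?gaussd_ge0.
- move=> w _ m n mn; rewrite lee_fin ler_wpM2l// ler_expR !mulNr lerN2.
  rewrite ler_wpM2r// ler_wpM2r ?dot_ge0// lerXn2r ?nnegrE//.
  by rewrite lef_pV2 ?posrE// ler_nat.
apply: lime_le.
  apply: ereal_nondecreasing_is_cvgn => m n mn.
  apply: ge0_le_integral => //.
  - by move=> w _; rewrite lee_fin mulr_ge0 ?gaussd_ge0.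
  - apply/measurable_EFinP; apply: measurable_funM => //.
    exact: measurable_gaussd.
  - apply/measurable_EFinP; apply: measurable_funM => //.
    exact: measurable_gaussd.
  - move=> w _; rewrite lee_fin ler_wpM2l// ler_expR !mulNr lerN2.
    rewrite ler_wpM2r// ler_wpM2r ?dot_ge0// lerXn2r ?nnegrE//.
    by rewrite lef_pV2 ?posrE// ler_nat.
by apply: nearW => n; apply: dz; rewrite invr_gt0.
Qed.

End L1L2.
End plancherel.

(** * Fourier-Plancherel transforms *)
Section transform.
Context (R : realType) (d : nat).
Local Notation mu := (lebesgue_rV R d).
Local Notation kappa := (twopi_factor R d).
Implicit Types (x y u v w : 'rV[R]_d) (f F : 'rV[R]_d -> R).
Implicit Types (g : 'rV[R]_d -> R[i]).

Lemma fourier_L1B F G w : mu.-integrable setT (EFin \o F) ->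
  mu.-integrable setT (EFin \o G) ->
  fourier_L1 (fun x => F x - G x) w = fourier_L1 F w - fourier_L1 G w.
Proof.
move=> Fi Gi; rewrite /fourier_L1; simpc.
have E t : (forall y, t y = cos (dot y w)) \/ (forall y, t y = sin (dot y w)) ->
    (\int[mu]_y ((F y - G y) * t y) =
     \int[mu]_y (F y * t y) - \int[mu]_y (G y * t y))%R.
  move=> tE; rewrite -RintegralBT.
  - by apply: eq_Rintegral => y _; rewrite mulrBl.
  - case: tE => /funext ->; [exact: integrable_cosM|exact: integrable_sinM].
  - case: tE => /funext ->; [exact: integrable_cosM|exact: integrable_sinM].
congr (_ +i* _)%C.
- by rewrite (E (fun y => cos (dot y w))) ?mulrBr//; left.
- by rewrite (E (fun y => sin (dot y w))); [ring|right].
Qed.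

Lemma fourier_L1Z c F w : mu.-integrable setT (EFin \o F) ->
  sqnormc (fourier_L1 (fun x => c * F x) w) = c ^+ 2 * sqnormc (fourier_L1 F w).
Proof.
move=> Fi; rewrite /fourier_L1 /sqnormc /=.
have -> : (\int[mu]_y (c * F y * cos (dot y w)) =
    c * \int[mu]_y (F y * cos (dot y w)))%R.
  rewrite -RintegralZT; last exact: integrable_cosM.
  by apply: eq_Rintegral => y _; rewrite mulrA.
have -> : (\int[mu]_y (c * F y * sin (dot y w)) =
    c * \int[mu]_y (F y * sin (dot y w)))%R.
  rewrite -RintegralZT; last exact: integrable_sinM.
  by apply: eq_Rintegral => y _; rewrite mulrA.
ring.
Qed.

Lemma is_fourier_L1 F : mu.-integrable setT (EFin \o F) ->
  mu.-integrable setT (EFin \o (fun x => F x ^+ 2)) ->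
  is_fourier F (fourier_L1 F).
Proof.
move=> Fi F2; have [mr mi] := cmeasurable_fourier_L1 Fi.
have FL : F \in Lfun mu 2%:E by apply/Lfun2P; split => //; exact: integrable_mfun Fi.
split => //; exists (fun=> F); split.
- by move=> n; split => //; apply/Lfun1_integrable.
- under eq_fun do under eq_integral do rewrite subrr expr0n/=.
  by rewrite integral0; exact: cvg_cst.
- have -> : (fun n : nat => \int[mu]_w (sqnormc (fourier_L1 F w - fourier_L1 F w))%:E)%E
      = fun=> 0%E.
    apply/funext => _; apply: integral0_eq => w _.
    by rewrite subrr /sqnormc/= expr0n/= addr0.
  exact: cvg_cst.
Qed.

Lemma sqnormcB3_le (a b c e : R[i]) : sqnormc (a - e) <=
  3 * (sqnormc (b - a) + sqnormc (b - c) + sqnormc (c - e)).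
Proof.
case: a b c e => [a a'] [b b'] [c c'] [e e']; rewrite /sqnormc /=.
have K (p q r : R) : (p + q + r) ^+ 2 <= 3 * (p ^+ 2 + q ^+ 2 + r ^+ 2).
  by have := sqr_ge0 (p - q); have := sqr_ge0 (q - r); have := sqr_ge0 (p - r); nra.
have := K (a - b) (b - c) (c - e); have := K (a' - b') (b' - c') (c' - e').
rewrite (_ : a - b + (b - c) + (c - e) = a - e); last by ring.
rewrite (_ : a' - b' + (b' - c') + (c' - e') = a' - e'); last by ring.
by rewrite -(sqrrN (b - a)) -(sqrrN (b' - a')) !opprB; lra.
Qed.

Local Notation energy g := (\int[mu]_w (sqnormc (g w))%:E)%E.

(** The difference of two sequences that approximate [f] tends to 0 in L^2, hence
   so does the difference of their transforms, by [plancherel_le]. *)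
Lemma is_fourier_unique f g g' : is_fourier f g -> is_fourier f g' ->
  (energy (fun w => g w - g' w) = 0)%E.
Proof.
move=> [fL mr mi [F [FL Ff Fg]]] [_ mr' mi' [G [GL Gf Gg]]].
have [mf f2] := (Lfun2P _ _).1 fL.
have F1 n := (Lfun1_integrable _ _).1 (FL n).1.
have G1 n := (Lfun1_integrable _ _).1 (GL n).1.
have [mF F2] : (forall n, measurable_fun setT (F n)) /\
    (forall n, mu.-integrable setT (EFin \o (fun x => F n x ^+ 2))).
  by split=> n; have [] := (Lfun2P _ _).1 (FL n).2.
have [mG G2] : (forall n, measurable_fun setT (G n)) /\
    (forall n, mu.-integrable setT (EFin \o (fun x => G n x ^+ 2))).
  by split=> n; have [] := (Lfun2P _ _).1 (GL n).2.
have FG n : (energy (fun w => fourier_L1 (F n) w - fourier_L1 (G n) w) <=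
    2%:E * (\int[mu]_x ((F n x - f x) ^+ 2)%:E) +
    2%:E * (\int[mu]_x ((G n x - f x) ^+ 2)%:E))%E.
  have FGi := integrable_subr (F1 n) (G1 n).
  have FG2 : mu.-integrable setT (EFin \o (fun x => (F n x - G n x) ^+ 2)).
    have := integrable_addr (F2 n) (G2 n); move/(integrable_mulZl 2).
    apply: (dominated_integrable); first exact/measurable_funX/measurable_funB.
    move=> x; rewrite ger0_norm ?sqr_ge0//.
    by have := sqr_ge0 (F n x + G n x); nra.
  have := plancherel_le FGi FG2.
  under eq_integral do rewrite fourier_L1B//.
  move=> /le_trans; apply.
  rewrite -!ge0_integralZl//; last 4 first.
  - by apply/measurable_EFinP/measurable_funX/measurable_funB.
  - by move=> x _; rewrite lee_fin sqr_ge0.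
  - by apply/measurable_EFinP/measurable_funX/measurable_funB.
  - by move=> x _; rewrite lee_fin sqr_ge0.
  rewrite -ge0_integralD//; last 4 first.
  - by move=> x _; rewrite mule_ge0// lee_fin sqr_ge0.
  - by apply: emeasurable_funM => //; apply/measurable_EFinP/measurable_funX/measurable_funB.
  - by move=> x _; rewrite mule_ge0// lee_fin sqr_ge0.
  - by apply: emeasurable_funM => //; apply/measurable_EFinP/measurable_funX/measurable_funB.
  apply: ge0_le_integral => //.
  - by move=> x _; rewrite lee_fin sqr_ge0.
  - by apply/measurable_EFinP/measurable_funX/measurable_funB.
  - by apply: emeasurable_funD; apply: emeasurable_funM => //;
      apply/measurable_EFinP/measurable_funX/measurable_funB.
  - move=> x _; rewrite -!EFinM -EFinD lee_fin.
    by have := sqr_ge0 (F n x - f x + (G n x - f x)); nra.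
have p0 (z : R[i]) : (0 <= (sqnormc z)%:E)%E by rewrite lee_fin sqnormc_ge0.
have mg : cmeasurable g by [].
have mg' : cmeasurable g' by [].
have mFn n := cmeasurable_fourier_L1 (F1 n).
have mGn n := cmeasurable_fourier_L1 (G1 n).
have mA n := measurable_sqnormcB (mFn n) mg.
have mB n := measurable_sqnormcB (mFn n) (mGn n).
have mC n := measurable_sqnormcB (mGn n) mg'.
have T n : (energy (fun w => g w - g' w) <= 3%:E *
    (energy (fun w => fourier_L1 (F n) w - g w)%R +
     energy (fun w => fourier_L1 (F n) w - fourier_L1 (G n) w)%R +
     energy (fun w => fourier_L1 (G n) w - g' w)%R))%E.
  rewrite -ge0_integralD// -ge0_integralD//; last 2 first.
  - by move=> w _; rewrite adde_ge0.
  - exact: emeasurable_funD.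
  rewrite -ge0_integralZl//; last 2 first.
  - by apply: emeasurable_funD => //; exact: emeasurable_funD.
  - by move=> w _; rewrite !adde_ge0.
  apply: ge0_le_integral => //.
  - exact: measurable_sqnormcB.
  - apply: emeasurable_funM => //.
    by apply: emeasurable_funD => //; exact: emeasurable_funD.
  - by move=> w _; rewrite -!EFinD -EFinM lee_fin sqnormcB3_le.
apply/eqP; rewrite eq_le; apply/andP; split; last first.
  by apply: integral_ge0 => w _; rewrite lee_fin sqnormc_ge0.
apply/lee_addgt0Pr => e e0; rewrite add0e.
pose s := e / 18; have s0 : 0 < s by rewrite divr_gt0.
have ge0i (h : 'rV[R]_d -> R) : (forall x, 0 <= h x) -> (0 <= \int[mu]_x (h x)%:E)%E.
  by move=> h0; apply: integral_ge0 => x _; rewrite lee_fin.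
near \oo => n.
apply: (le_trans (T n)).
have a1 : (energy (fun w => fourier_L1 (F n) w - g w)%R <= s%:E)%E.
  near: n; apply: cvge0_near_le => // n; apply: ge0i => w; exact: sqnormc_ge0.
have a2 : (energy (fun w => fourier_L1 (G n) w - g' w)%R <= s%:E)%E.
  near: n; apply: cvge0_near_le => // n; apply: ge0i => w; exact: sqnormc_ge0.
have a3 : (\int[mu]_x ((F n x - f x) ^+ 2)%:E <= s%:E)%E.
  near: n; apply: cvge0_near_le => // n; apply: ge0i => w; exact: sqr_ge0.
have a4 : (\int[mu]_x ((G n x - f x) ^+ 2)%:E <= s%:E)%E.
  near: n; apply: cvge0_near_le => // n; apply: ge0i => w; exact: sqr_ge0.
have b := FG n.
have {b}b : (energy (fun w => fourier_L1 (F n) w - fourier_L1 (G n) w)%R <= (4 * s)%:E)%E.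
  have -> : (4 * s)%:E = (2%:E * s%:E + 2%:E * s%:E)%E.
    by rewrite -!EFinM -EFinD; congr EFin; ring.
  by apply: (le_trans b); apply: leeD; rewrite lee_pmul2l.
have -> : e%:E = (3%:E * (s%:E + (4 * s)%:E + s%:E))%E.
  by rewrite -!EFinD -EFinM; congr EFin; rewrite /s; field.
by rewrite lee_pmul2l// !leeD.
Unshelve. all: by end_near. Qed.

(** [fourier f] is picked by choice among the transforms of [f]; under an
   integral, any explicit transform may take its place. *)
Lemma eq_fourier_integral f g g' (W : 'rV[R]_d -> R) :
  is_fourier f g -> is_fourier f g' ->
  measurable_fun setT W -> (forall w, 0 <= W w) ->
  (\int[mu]_w (sqnormc (g w) * W w)%:E = \int[mu]_w (sqnormc (g' w) * W w)%:E)%E.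
Proof.
move=> fg fg' mW W0; have E := is_fourier_unique fg fg'.
have [_ mr mi _] := fg; have [_ mr' mi' _] := fg'.
have ms : measurable_fun setT (fun w => (sqnormc (g w - g' w))%:E).
  exact: measurable_sqnormcB.
have [N [mN N0 subN]] : ae_eq mu setT (fun w => (sqnormc (g w - g' w))%:E) (cst 0%E).
  apply/ae_eq_integral_abs => //; rewrite -E; apply: eq_integral => w _.
  by rewrite /= ger0_norm// sqnormc_ge0.
apply: ge0_ae_eq_integral => //.
- by apply/measurable_EFinP; apply: measurable_funM => //; exact: measurable_sqnormc.
- by apply/measurable_EFinP; apply: measurable_funM => //; exact: measurable_sqnormc.
- by move=> w _; rewrite lee_fin mulr_ge0 ?sqnormc_ge0.
- by move=> w _; rewrite lee_fin mulr_ge0 ?sqnormc_ge0.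
exists N; split => // w nw; apply: subN => /=; apply: contra_not nw => nw _.
have := nw I => -[]; case: (g w) => a b; case: (g' w) => a' b'.
rewrite /sqnormc/= => /eqP; rewrite paddr_eq0 ?sqr_ge0// !sqrf_eq0 !subr_eq0.
by move=> /andP[/eqP -> /eqP ->].
Qed.

End transform.

(** * Fourier inversion *)
Section inversion.
Context (R : realType) (d : nat).
Local Notation mu := (lebesgue_rV R d).
Local Notation kappa := (twopi_factor R d).
Implicit Types (x y u v w : 'rV[R]_d) (f F : 'rV[R]_d -> R).
Implicit Types (g : 'rV[R]_d -> R[i]).

Lemma integrable_sqr_gaussd a : 0 < a ->
  mu.-integrable setT (EFin \o (fun w => gaussd a w ^+ 2)).
Proof.
move=> a0; apply: (@dominated_integrable _ _ _ mu _ (gaussd a)).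
- by apply: measurable_funX; exact: measurable_gaussd.
- move=> w; rewrite ger0_norm ?sqr_ge0// expr2 ler_piMr ?gaussd_ge0//.
  exact: gaussd_le1.
- exact: integrable_gaussd.
Qed.

(** [wave_gauss_fourier_L1] passes to limits in L^2, because the Gaussian and the
   bell are square integrable. *)
Lemma wave_gauss f g a x : is_fourier f g -> 0 < a ->
  (\int[mu]_w (wave (g w) (dot x w) * gaussd a w) =
   \int[mu]_y (f y * bell a (x - y)))%R.
Proof.
move=> [fL mr mi [F [FL Ff Fg]]] a0.
have mg : cmeasurable g by [].
have [mf f2] := (Lfun2P _ _).1 fL.
have F1 n := (Lfun1_integrable _ _).1 (FL n).1.
have mF n : measurable_fun setT (F n) by have [] := (Lfun2P _ _).1 (FL n).2.
have F2 n : mu.-integrable setT (EFin \o (fun x => F n x ^+ 2)).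
  by have [] := (Lfun2P _ _).1 (FL n).2.
have mb := @measurable_bell_sub R d a x.
have b2 := sqr_bell_sub x a0.
have fb : mu.-integrable setT (EFin \o (fun y => f y * bell a (x - y))).
  exact: integrable_mul_L2.
have Fb n : mu.-integrable setT (EFin \o (fun y => F n y * bell a (x - y))).
  exact: integrable_mul_L2.
have mFf n : measurable_fun setT (fun y => F n y - f y) by exact: measurable_funB.
have [_ l1] := L2_cvg0 mFf mb Ff b2.
have {}l1 : (\int[mu]_y (F n y * bell a (x - y)))%R @[n --> \oo] -->
    (\int[mu]_y (f y * bell a (x - y)))%R.
  apply/subr_cvg0; apply: cvg_trans l1; apply: near_eq_cvg; apply: nearW => n.
  rewrite -RintegralBT//; apply: eq_Rintegral => y _; by rewrite mulrBl.
pose u n w := wave (fourier_L1 (F n) w - g w) (dot x w).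
have mu_ n : measurable_fun setT (u n).
  apply: measurable_wave; apply: cmeasurableB => //.
  exact: cmeasurable_fourier_L1.
have u0 : (\int[mu]_w (u n w ^+ 2)%:E @[n --> \oo] --> 0)%E.
  apply: (@squeeze_cvge _ _ _ _ (cst 0%E) _
    (fun n => \int[mu]_w (sqnormc (fourier_L1 (F n) w - g w))%:E)%E) => //.
    apply: nearW => n; apply/andP; split.
      by apply: integral_ge0 => w _; rewrite lee_fin sqr_ge0.
    apply: ge0_le_integral => //.
    - by move=> w _; rewrite lee_fin sqr_ge0.
    - by apply/measurable_EFinP; apply: measurable_funX.
    - by apply: measurable_sqnormcB => //; exact: cmeasurable_fourier_L1.
    - by move=> w _; rewrite lee_fin wave_sqr_le.
  exact: cvg_cst.
have [ui l2] := L2_cvg0 mu_ (@measurable_gaussd R d a) u0 (integrable_sqr_gaussd a0).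
have Fw n : mu.-integrable setT
    (EFin \o (fun w => wave (fourier_L1 (F n) w) (dot x w) * gaussd a w)).
  apply: (@dominated_integrable _ _ _ mu _
    (fun w => kappa * (\int[mu]_y `|F n y|)%R * gaussd a w)).
  - apply: measurable_funM; last exact: measurable_gaussd.
    by apply: measurable_wave; exact: cmeasurable_fourier_L1.
  - move=> w; rewrite normrM (ger0_norm (gaussd_ge0 _ _)).
    by rewrite ler_wpM2r ?gaussd_ge0// wave_fourier_L1_le.
  - by apply: integrable_mulZl; exact: integrable_gaussd.
have uE n w : u n w * gaussd a w =
    wave (fourier_L1 (F n) w) (dot x w) * gaussd a w - wave (g w) (dot x w) * gaussd a w.
  by rewrite /u waveB mulrBl.
have gi : mu.-integrable setT (EFin \o (fun w => wave (g w) (dot x w) * gaussd a w)).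
  near \oo => n.
  have uin : mu.-integrable setT (EFin \o (fun w => u n w * gaussd a w)) by near: n.
  have := integrable_subr (Fw n) uin.
  by apply: integrable_congr => w; rewrite uE; ring.
apply: (cvg_unique _ _ l1) => //.
have {}l2 : (\int[mu]_w (wave (fourier_L1 (F n) w) (dot x w) * gaussd a w))%R @[n --> \oo] -->
    (\int[mu]_w (wave (g w) (dot x w) * gaussd a w))%R.
  apply/subr_cvg0; apply: cvg_trans l2; apply: near_eq_cvg; apply: nearW => n.
  by rewrite -RintegralBT//; apply: eq_Rintegral => w _; rewrite uE.
apply: cvg_trans l2; apply: near_eq_cvg; apply: nearW => n.
by rewrite wave_gauss_fourier_L1.
Unshelve. all: by end_near. Qed.

Lemma dot_self_ge (u : 'rV[R]_d) i : u ord0 i ^+ 2 <= dot u u.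
Proof.
rewrite /dot (bigD1 i)//= -expr2 lerDl.
by apply: sumr_ge0 => j _; rewrite -expr2 sqr_ge0.
Qed.

(** The height [N ^+ d] of a bell of width [N^-1] is negligible against its decay
   away from the centre. *)
Lemma far_le (c : R) : 0 < c ->
  (fun n : nat => n.+1%:R ^+ d * expR (- (n.+1%:R ^+ 2 * c))) @ \oo --> (0 : R).
Proof.
move=> c0; pose K := (d.+1)`!%:R / c ^+ d.+1.
have K0 : 0 < K by rewrite divr_gt0 ?exprn_gt0// ltr0n fact_gt0.
apply: (@squeeze_cvgr _ _ _ _ (cst 0) (fun n => K * n.+1%:R^-1)).
- apply: nearW => n; set N := n.+1%:R.
  have N0 : 0 < N by rewrite ltr0n.
  have N1 : 1 <= N by rewrite ler1n.
  apply/andP; split; first by rewrite mulr_ge0 ?exprn_ge0 ?expR_ge0 ?ltW.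
  rewrite expRN ler_pdivrMr ?expR_gt0//.
  have y0 : 0 <= N ^+ 2 * c by rewrite mulr_ge0 ?sqr_ge0 ?ltW.
  have H := expR_ge1Dxn d y0.
  have P0 : 0 <= K / N by rewrite divr_ge0 ?ltW.
  apply: (@le_trans _ _ (K / N * ((N ^+ 2 * c) ^+ d.+1 / (d.+1)`!%:R))); last first.
    by rewrite ler_wpM2l// (le_trans _ H)// lerDr.
  have -> : K / N * ((N ^+ 2 * c) ^+ d.+1 / (d.+1)`!%:R) = N ^+ d * N ^+ d.+1.
    rewrite exprMn -exprM mul2n -addnn exprD /K (exprS N d).
    by field; rewrite !gt_eqF ?exprn_gt0// ltr0n fact_gt0.
  by rewrite ler_peMr ?exprn_ge0 ?exprn_ege1// ltW.
- exact: cvg_cst.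
- rewrite -[X in _ --> X](mulr0 K); apply: cvgMr; exact: cvg_harmonic.
Qed.

(** The bells form an approximate identity. Near [x], the oscillation of [f] is
   small; away from [x], the bells are small multiples of one fixed Gaussian,
   against which the square integrable [f] is integrable. *)
Lemma bell_cvg f x : measurable_fun setT f ->
  mu.-integrable setT (EFin \o (fun y => f y ^+ 2)) ->
  {for x, continuous f} ->
  (\int[mu]_y (f y * bell n.+1%:R^-1 (x - y)))%R @[n --> \oo] --> kappa^-1 * f x.
Proof.
move=> mf f2 cf.
have n0 n : 0 < n.+1%:R^-1 :> R by rewrite invr_gt0.
have ib n := integrable_bell_sub x (n0 n).
have fb n : mu.-integrable setT (EFin \o (fun y => f y * bell n.+1%:R^-1 (x - y))).
  by apply: integrable_mul_L2 => //; [exact: measurable_bell_sub|exact: sqr_bell_sub].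
have ig : mu.-integrable setT (EFin \o (fun y => gaussd 1 (x - y))).
  exact: integrable_gaussd_sub.
pose D y := (`|f y| + `|f x|) * gaussd 1 (x - y).
have mgs : measurable_fun setT (fun y => gaussd 1 (x - y)).
  by apply: (measurableT_comp (@measurable_gaussd R d _)); exact: measurable_subr_rV.
have iD : mu.-integrable setT (EFin \o D).
  apply: (@dominated_integrable _ _ _ mu _
    (fun y => f y ^+ 2 + (1 + `|f x|) * gaussd 1 (x - y))).
  - by apply: measurable_funM => //; apply: measurable_funD => //; exact: measurableT_comp.
  - move=> y; rewrite /D ger0_norm ?mulr_ge0 ?gaussd_ge0 ?addr_ge0//.
    have g0 := gaussd_ge0 1 (x - y); have g1 := gaussd_le1 1 (x - y).
    rewrite -(real_normK (num_real (f y))).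
    have := normr_ge0 (f x); have := normr_ge0 (f y).
    move: (gaussd _ _) g0 g1 (`|f x|) (`|f y|) => b b0 b1 s t t0 s0.
    have := sqr_ge0 (t - b / 2); nra.
  - by apply: integrable_addr => //; exact: integrable_mulZl.
apply/cvgrPdist_le => e e0.
pose eta := e * kappa / 2.
have k0 := twopi_factor_gt0 R d.
have eta0 : 0 < eta by rewrite divr_gt0// mulr_gt0.
have [r r0 fr] : exists2 r, 0 < r & forall y, ball x r y -> `|f x - f y| <= eta.
  have /cvgrPdist_le/(_ eta eta0)/nbhs_ballP[r r0 H] := cf.
  by exists r => // y /H.
have farl : forall y, ~ ball x r y -> r ^+ 2 <= dot (x - y) (x - y).
  move=> y nb; have [i Hi] : exists i, r <= `|x ord0 i - y ord0 i|.
    apply: contrapT => /forallNP H; apply: nb; split => // i j.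
    by rewrite ord1; have /negP := H j; rewrite -ltNge.
  apply: le_trans (dot_self_ge (x - y) i); rewrite !mxE.
  by rewrite -(real_normK (num_real (_ - _))) lerXn2r ?nnegrE// ltW.
pose c n := n.+1%:R ^+ d * expR (- (n.+1%:R ^+ 2 * (r ^+ 2 / 4))) : R.
have c0 : c @ \oo --> (0 : R) by apply: far_le; rewrite divr_gt0// exprn_gt0.
pose I := (\int[mu]_y D y)%R.
have I0 : 0 <= I.
  by apply: Rintegral_ge0 => y _; rewrite mulr_ge0 ?gaussd_ge0// addr_ge0.
have cI : (fun n => c n * I) @ \oo --> (0 : R).
  by rewrite -(mul0r I); apply: cvgMl.
near=> n.
have cIn : `|0 - c n * I| <= e / 2.
  by near: n; move/cvgrPdist_le: cI; apply; rewrite divr_gt0.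
have n1 : (1 <= n)%N by near: n; exact: nbhs_infty_ge.
have -> : kappa^-1 * f x = (\int[mu]_y (f x * bell n.+1%:R^-1 (x - y)))%R.
  by rewrite RintegralZT// mulrC /Rintegral integral_bell_sub.
rewrite -RintegralBT//; last exact: integrable_mulZl.
apply: (@le_trans _ _ (\int[mu]_y (eta * bell n.+1%:R^-1 (x - y) + c n * D y))%R).
  apply: norm_RintegralT.
  - apply: measurable_funB; apply: measurable_funM => //; exact: measurable_bell_sub.
  - by apply: integrable_addr; exact: integrable_mulZl.
  move=> y; rewrite -mulrBl normrM (ger0_norm (bell_ge0 _ (n0 n))).
  have b0 := bell_ge0 (x - y) (n0 n).
  have c_ge0 : 0 <= c n by rewrite mulr_ge0 ?exprn_ge0 ?expR_ge0.
  have D0 : 0 <= D y by rewrite mulr_ge0 ?gaussd_ge0// addr_ge0.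
  have [/fr H|/farl H] := pselect (ball x r y).
    rewrite -[leLHS]addr0; apply: lerD; last exact: mulr_ge0.
    exact: ler_wpM2r.
  rewrite -[leLHS]add0r; apply: lerD; first by rewrite mulr_ge0// ltW.
  rewrite /D [leRHS]mulrCA; apply: ler_pM => //; first by rewrite [leRHS]addrC; exact: ler_normB.
  rewrite /bell exprVn invrK /c -mulrA ler_wpM2l ?exprn_ge0//.
  rewrite /gaussd -expRD ler_expR invrK.
  have N4 : 4 <= n.+1%:R ^+ 2 :> R.
    have N2 : 2 <= n.+1%:R :> R by rewrite ler_nat.
    by nra.
  rewrite expr1n mul1r.
  have := dot_ge0 (x - y); move: (dot _ _) H (n.+1%:R ^+ 2) N4 => q qr N N4 q0.
  nra.
rewrite RintegralDT; [|exact: integrable_mulZl..].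
rewrite RintegralZT// RintegralZT// -/I [leRHS]splitr lerD//.
  by rewrite /Rintegral integral_bell_sub//= /eta mulrAC mulfK ?gt_eqF.
by apply: le_trans cIn; rewrite sub0r normrN ler_norm.
Unshelve. all: by end_near. Qed.

(** In [wave_gauss], let the Gaussians tend to 1: the transform side converges by
   domination, the other side because the bells are an approximate identity. *)
Lemma fourier_inversion f g x : is_fourier f g -> {for x, continuous f} ->
  mu.-integrable setT
    (EFin \o (fun w => `|complex.Re (g w)| + `|complex.Im (g w)|)) ->
  f x = kappa * (\int[mu]_w wave (g w) (dot x w))%R.
Proof.
move=> fg cf ig; have [fL mr mi _] := fg; have [mf f2] := (Lfun2P _ _).1 fL.
have mg : cmeasurable g by [].
have k0 := twopi_factor_gt0 R d.
have l1 := bell_cvg mf f2 cf.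
pose h (n : nat) w := wave (g w) (dot x w) * gaussd n.+1%:R^-1 w.
have [_ l2] : mu.-integrable setT (EFin \o (fun w => wave (g w) (dot x w))) /\
   (\int[mu]_w h n w)%R @[n --> \oo] --> (\int[mu]_w wave (g w) (dot x w))%R.
  apply: (@Rdominated_cvg _ _ _ mu h _
    (fun w => `|complex.Re (g w)| + `|complex.Im (g w)|)) => //.
  - move=> n; apply: measurable_funM; last exact: measurable_gaussd.
    exact: measurable_wave.
  - move=> w; rewrite -[X in _ --> X]mulr1; apply: cvgMr.
    exact: gaussd_cvg1.
  - move=> n w; rewrite /h normrM (ger0_norm (gaussd_ge0 _ _)).
    rewrite -[leRHS]mulr1 ler_pM ?gaussd_ge0 ?gaussd_le1//.
    exact: wave_norm_le.
have E : kappa^-1 * f x = (\int[mu]_w wave (g w) (dot x w))%R.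
  apply: (cvg_unique _ l1) => //; apply: cvg_trans l2.
  apply: near_eq_cvg; apply: nearW => n.
  by rewrite /h (wave_gauss x fg)// invr_gt0.
by rewrite -E mulrA mulfV ?mul1r// gt_eqF.
Qed.

End inversion.

(** * Integrability of powers of the bracket *)
Section decay.
Context (R : realType).
Local Notation leb := (@lebesgue_measure R).

Lemma cvgy_powRN (r : R) : 0 < r -> (1 + x) `^ (- r) @[x --> +oo] --> (0 : R).
Proof.
move=> r0; apply/cvgrPdist_le => e e0; near=> x.
rewrite sub0r normrN ger0_norm ?powR_ge0// powRN -[leRHS]invrK.
have x1 : e^-1 `^ r^-1 <= x by near: x; apply: nbhs_pinfty_ge; exact: num_real.
have x0 : 0 < 1 + x by rewrite ltr_pwDl// (le_trans _ x1)// powR_ge0.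
rewrite lef_pV2 ?posrE ?invr_gt0 ?powR_gt0//.
have {1}-> : e^-1 = (e^-1 `^ r^-1) `^ r.
  by rewrite -powRrM mulVf ?gt_eqF// powRr1// invr_ge0 ltW.
apply: (ge0_ler_powR (ltW r0)); rewrite ?nnegrE ?powR_ge0 ?ltW//.
by rewrite (le_lt_trans x1)// ltrDr.
Unshelve. all: by end_near. Qed.

Lemma continuous_powR_gt0 (a r : R) : 0 < a -> {for a, continuous (fun z : R => z `^ r)}.
Proof.
move=> a0; apply: differentiable_continuous; apply/derivable1_diffP.
by have [] := is_derive1_powR r a0.
Qed.

Lemma integrable_powRN1 (p : R) : 1 < p ->
  leb.-integrable setT (EFin \o (fun x => (1 + `|x|) `^ (- p))).
Proof.
move=> p1; pose f (x : R) := (1 + `|x|) `^ (- p).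
have cf : continuous f.
  move=> x; apply: (@continuous_comp _ _ _ (fun y : R => 1 + `|y|) (fun z : R => z `^ (- p))).
    by apply: cvgD; [exact: cvg_cst|exact: norm_continuous].
  by apply: continuous_powR_gt0; rewrite ltr_pwDl.
pose F (x : R) := - (p - 1)^-1 * (1 + x) `^ (1 - p).
have dF (x : R) : 0 <= x -> is_derive x 1 F ((1 + x) `^ (- p)).
  move=> x0; have x1 : 0 < 1 + x by rewrite ltr_pwDl.
  have d1 : is_derive (1 + x) 1 (fun z : R => z `^ (1 - p)) ((1 - p) * (1 + x) `^ (1 - p - 1)).
    exact: is_derive1_powR.
  have d2 : is_derive x 1 (fun y : R => 1 + y) 1.
    by apply: is_derive_eq; rewrite add0r mulr1.
  have d3 := @is_derive1_comp _ (fun z : R => z `^ (1 - p)) (fun y : R => 1 + y) x _ _ d1 d2.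
  have := @is_deriveZ _ _ _ _ (- (p - 1)^-1) x 1 _ d3.
  rewrite /GRing.scale/=.
  rewrite (_ : 1 - p - 1 = - p); last by ring.
  rewrite (_ : - (p - 1)^-1 * ((1 - p) * (1 + x) `^ (- p) * 1) = (1 + x) `^ (- p))//.
  by field; rewrite subr_eq0 gt_eqF.
have cF (x : R) : 0 <= x -> {for x, continuous F}.
  move=> x0; apply: differentiable_continuous; apply/derivable1_diffP.
  by have [] := dF x x0.
apply: ge0_lty_integrable.
- exact: continuous_measurable_fun.
- by move=> x; exact: powR_ge0.
rewrite (ge0_symfun_integralT _ cf); [|by move=> x; exact: powR_ge0|]; last first.
  by move=> x /=; rewrite /f /= normrN.
apply: lte_mul_pinfty => //.
rewrite -set_itvcy.
have -> : (\int[leb]_(x in `[0%R, +oo[) ((1 + `|x|) `^ (- p))%:E = 0%:E - (F 0)%:E)%E.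
  apply: (@ge0_continuous_FTC2y _ f F).
  - by move=> x _; exact: powR_ge0.
  - exact: continuous_subspaceT.
  - rewrite -(mulr0 (- (p - 1)^-1)); apply: cvgMr; rewrite -opprB.
    by apply: cvgy_powRN; rewrite subr_gt0.
  - by move=> x /ltW x0; have [] := dF x x0.
  - by apply: cvg_at_right_filter; exact: cF.
  - move=> x; rewrite in_itv/= andbT => /ltW x0.
    by rewrite derive1E /f ger0_norm//; have := dF x x0 => dFx; apply: derive_val.
by rewrite -EFinB ltry.
Qed.

Lemma integrable_powRN_sqr (s : R) : 1 < 2 * s ->
  leb.-integrable setT (EFin \o (fun x => (1 + x ^+ 2) `^ (- s))).
Proof.
move=> s1; have s0 : 0 <= s by lra.
apply: (@dominated_integrable _ _ _ leb _ (fun x => 2 `^ s * (1 + `|x|) `^ (- (2 * s)))).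
- apply: continuous_measurable_fun => x.
  apply: (@continuous_comp _ _ _ (fun y : R => 1 + y ^+ 2) (fun z : R => z `^ (- s))).
    by apply: cvgD; [exact: cvg_cst|exact: exprn_continuous].
  by apply: continuous_powR_gt0; rewrite ltr_pwDl// sqr_ge0.
- move=> x; rewrite ger0_norm ?powR_ge0// 2!powRN powRrM powR_mulrn; last first.
    by rewrite addr_ge0.
  have x0 : 0 < 1 + x ^+ 2 by rewrite ltr_pwDl// sqr_ge0.
  rewrite ler_pdivlMr ?powR_gt0 ?exprn_gt0 ?ltr_pwDl//.
  rewrite mulrC ler_pdivrMr ?powR_gt0//.
  rewrite -powRM ?(ltW x0)//; apply: (ge0_ler_powR s0); rewrite ?nnegrE ?sqr_ge0//.
    by rewrite mulr_ge0 ?(ltW x0).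
  by rewrite -(real_normK (num_real x)); have := sqr_ge0 (`|x| - 1); nra.
- by apply: integrable_mulZl; apply: integrable_powRN1.
Qed.

Section bracket.
Variable d : nat.
Local Notation mu := (lebesgue_rV R d).
Implicit Types w : 'rV[R]_d.

(** The Japanese bracket, squared. *)
Definition bracket w : R := 1 + dot w w.

Lemma bracket_ge1 w : 1 <= bracket w.
Proof. by rewrite lerDl dot_ge0. Qed.

Lemma bracket_gt0 w : 0 < bracket w.
Proof. exact: lt_le_trans (bracket_ge1 w). Qed.

Lemma measurable_bracketN s : measurable_fun setT (fun w => bracket w `^ s).
Proof.
apply: (measurableT_comp (measurable_powR s)).
by apply: measurable_funD => //; exact: measurable_dot.
Qed.

(** The bracket dominates each [1 + w_i ^+ 2], hence also the geometric mean of
   these [d] numbers, which leaves a product of integrals on the line. *)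
Lemma integrable_bracketN (s : R) : (0 < d)%N -> d%:R < 2 * s ->
  mu.-integrable setT (EFin \o (fun w => bracket w `^ (- s))).
Proof.
move=> d0 ds; have d0' : 0 < d%:R :> R by rewrite ltr0n.
have s0 : 0 < s by have : 0 < 2 * s by [exact: lt_trans ds]; lra.
apply: (@dominated_integrable _ _ _ mu _
  (tensor (fun=> (fun x : R => (1 + x ^+ 2) `^ (- (s / d%:R)))))).
- exact: measurable_bracketN.
- move=> w; rewrite ger0_norm ?powR_ge0//.
  have -> : bracket w `^ (- s) = \prod_(i < d) bracket w `^ (- (s / d%:R)).
    rewrite prodr_const card_ord -powR_mulrn ?powR_ge0// -powRrM.
    by congr (_ `^ _); field; rewrite gt_eqF.
  apply: ler_prod => i _; rewrite powR_ge0/= !powRN lef_pV2 ?posrE; last 2 first.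
  - by rewrite powR_gt0// bracket_gt0.
  - by rewrite powR_gt0// ltr_pwDl// sqr_ge0.
  apply: ge0_ler_powR; rewrite ?nnegrE ?divr_ge0 ?addr_ge0 ?sqr_ge0 ?dot_ge0 ?(ltW s0)//.
  by rewrite lerD2l dot_self_ge.
- apply: integrable_tensor => _; apply: integrable_powRN_sqr.
  by rewrite mulrA ltr_pdivlMr// mul1r.
Qed.

End bracket.
End decay.

(** * Native spaces and the power function *)
Section sums.
Context d (T : measurableType d) (R : realType).
Variable mu : {measure set T -> \bar R}.

Lemma measurable_inv_gt0 (k : T -> R) : measurable_fun setT k ->
  (forall x, 0 < k x) -> measurable_fun setT (fun x => (k x)^-1).
Proof.
move=> mk k0; rewrite (_ : (fun _ => _) = fun x => k x `^ (- 1)).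
  exact: (measurableT_comp (measurable_powR (- 1)) mk).
by apply/funext => x; rewrite powR_inv1// ltW.
Qed.

Lemma Rintegral_sumT (I : Type) (s : seq I) (h : I -> T -> R) :
  (forall i, mu.-integrable setT (EFin \o h i)) ->
  mu.-integrable setT (EFin \o (fun x => \sum_(i <- s) h i x)) /\
  (\int[mu]_x (\sum_(i <- s) h i x) = \sum_(i <- s) \int[mu]_x h i x)%R.
Proof.
move=> hi; elim: s => [|i s [IHi IHe]].
  split; last by rewrite big_nil; under eq_Rintegral do rewrite big_nil;
    rewrite /Rintegral integral0.
  by apply: (integrable_congr (f := fun=> 0)); [move=> x; rewrite big_nil|
    exact: integrable0].
have E x : h i x + \sum_(j <- s) h j x = \sum_(j <- i :: s) h j x by rewrite big_cons.
split; first by apply: (integrable_congr E); exact: integrable_addr.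
by under eq_Rintegral do rewrite -E; rewrite RintegralDT// IHe big_cons.
Qed.

End sums.

Section kernel_bounds.
Context (R : realType) (d : nat).
Local Notation mu := (lebesgue_rV R d).
Local Notation kappa := (twopi_factor R d).
Implicit Types (x y u v w : 'rV[R]_d) (f : 'rV[R]_d -> R) (K : ti_kernel R d).
Implicit Types (X : {fset 'rV[R]_d}).

Lemma enorm_sqr w : enorm w ^+ 2 = dot w w.
Proof. by rewrite /enorm sqr_sqrtr// dot_ge0. Qed.

Lemma enorm_ge0 w : 0 <= enorm w. Proof. exact: sqrtr_ge0. Qed.

Lemma coord_le_enorm w i : `|w ord0 i| <= enorm w.
Proof. by rewrite -sqrtr_sqr ler_wsqrtr// dot_self_ge. Qed.

(** Finite smoothness with exponent [2 * s], in a form without an exceptional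
   ball. *)
Definition comparable_kernel K (s c0 c1 : R) :=
  [/\ 0 < c0, 0 < c1 & forall w,
    c0 * bracket w `^ (- s) <= khat K w /\ khat K w <= c1 * bracket w `^ (- s)].

Lemma continuous_bounded_on_ball (h : 'rV[R]_d -> R) (c : R) : continuous h ->
  exists2 M : R, 0 < M & forall w, enorm w <= c -> h w <= M.
Proof.
move=> ch.
pose A : set 'rV[R]_d := [set v | forall i, `[- c, c]%classic (v ord0 i)].
have cA : compact A.
  by apply: (@rV_compact _ _ (fun=> `[- c, c]%classic)) => _; exact: segment_compact.
have : compact (h @` A).
  by apply: continuous_compact => //; exact: continuous_subspaceT.
move=> /compact_bounded[M [Mr MM]].
exists (`|M| + 1); first by rewrite ltr_pwDr.
move=> w wc; apply: le_trans (ler_norm _) _; apply: MM.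
  by rewrite (le_lt_trans (ler_norm _))// ltrDl.
exists w => // i /=; rewrite in_itv/= -ler_norml.
exact: le_trans (coord_le_enorm w i) wc.
Qed.

(** Outside the ball of radius [c], [enorm] and the bracket are comparable; inside,
   [khat K] and its inverse are bounded by compactness. *)
Lemma finite_smoothness_comparable K beta : 0 < beta ->
  continuous (khat K) -> (forall w, 0 < khat K w) -> finite_smoothness K beta ->
  exists c0 c1, comparable_kernel K (beta / 2) c0 c1.
Proof.
move=> b0 ck kp [c [c0 [c1 [c_gt0 c00 c10 H]]]].
have b2 : 0 <= beta / 2 by rewrite divr_ge0// ltW.
have [M M0 HM] := continuous_bounded_on_ball c ck.
have ci : continuous (fun w => (khat K w)^-1).
  by move=> w; apply: (cvgV _ (ck w)); rewrite gt_eqF.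
have [N N0 HN] := continuous_bounded_on_ball c ci.
have eb w : c <= enorm w -> enorm w `^ (- beta) = (enorm w ^+ 2) `^ (- (beta / 2)).
  move=> cw; rewrite -powR_mulrn ?enorm_ge0// -powRrM; congr (_ `^ _).
  by field.
have q0 w : c <= enorm w -> 0 < enorm w ^+ 2.
  by move=> cw; rewrite exprn_gt0// (lt_le_trans c_gt0).
pose L := (c ^- 2 + 1) `^ (beta / 2).
have L0 : 0 < L by rewrite powR_gt0// ltr_pwDr// invr_ge0 sqr_ge0.
pose L' := (1 + c ^+ 2) `^ (beta / 2).
have L'0 : 0 < L' by rewrite powR_gt0// ltr_pwDl// sqr_ge0.
have pw (u v : R) : 0 < u -> u <= v -> v `^ (- (beta / 2)) <= u `^ (- (beta / 2)).
  move=> u0 uv; have v0 := lt_le_trans u0 uv.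
  rewrite !powRN lef_pV2 ?posrE ?powR_gt0//.
  by apply: ge0_ler_powR; rewrite ?nnegrE ?(ltW u0) ?(ltW v0).
have J1 w : bracket w `^ (- (beta / 2)) <= 1.
  by apply: (le_trans (pw 1 _ ltr01 (bracket_ge1 w))); rewrite powR1.
have Jb w : enorm w <= c -> 1 <= L' * bracket w `^ (- (beta / 2)).
  move=> wc; rewrite powRN ler_pdivlMr ?powR_gt0 ?bracket_gt0// mul1r.
  apply: ge0_ler_powR; rewrite ?nnegrE ?(ltW (bracket_gt0 _)) ?addr_ge0 ?sqr_ge0//.
  by rewrite /bracket lerD2l -enorm_sqr lerXn2r ?nnegrE ?enorm_ge0// ltW.
exists (Num.min c0 N^-1), (Num.max (c1 * L) (M * L')); split.
- by rewrite lt_min c00 invr_gt0 N0.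
- by rewrite lt_max mulr_gt0.
move=> w; have B0 := powR_ge0 (bracket w) (- (beta / 2)).
have [cw|/ltW wc] := leP c (enorm w).
  have [h1 h2] := H w cw; split.
    apply: (le_trans _ h1); apply: ler_pM => //.
    + by rewrite le_min (ltW c00) invr_ge0 ltW.
    + by rewrite ge_min lexx.
    + by rewrite eb//; apply: pw; rewrite ?q0// enorm_sqr lerDr.
  apply: (le_trans h2); apply: (@le_trans _ _ (c1 * L * bracket w `^ (- (beta / 2)))).
    rewrite -mulrA ler_wpM2l ?(ltW c10)// eb//.
    rewrite !powRN ler_pdivlMr ?powR_gt0 ?bracket_gt0//.
    rewrite mulrC ler_pdivrMr ?powR_gt0 ?q0// -powRM; last 2 first.
    + by rewrite addr_ge0// invr_ge0 sqr_ge0.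
    + by rewrite sqr_ge0.
    apply: ge0_ler_powR; rewrite ?nnegrE ?(ltW (bracket_gt0 _))//.
      by rewrite mulr_ge0 ?sqr_ge0// addr_ge0// invr_ge0 sqr_ge0.
    rewrite /bracket -enorm_sqr mulrDl mul1r lerD2r mulrC ler_pdivlMr ?exprn_gt0//.
    by rewrite mul1r lerXn2r ?nnegrE ?enorm_ge0// ltW.
  by rewrite ler_wpM2r// le_max lexx.
split.
  apply: (@le_trans _ _ N^-1).
    rewrite -[leRHS]mulr1; apply: ler_pM => //.
      by rewrite le_min (ltW c00) invr_ge0 ltW.
    by rewrite ge_min lexx orbT.
  by rewrite -[leRHS]invrK lef_pV2 ?posrE ?invr_gt0//; exact: HN.
apply: (le_trans (HM w wc)); apply: (@le_trans _ _ (M * L' * bracket w `^ (- (beta / 2)))).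
  by rewrite -mulrA ler_peMr ?(ltW M0)// Jb.
by rewrite ler_wpM2r// le_max lexx orbT.
Qed.

(** The squared modulus of [exp (i x.w) - \sum_y a y * exp (i y.w)]. *)
Definition defect X (a : {ffun X -> R}) x w : R :=
  (cos (dot x w) - \sum_(y : X) a y * cos (dot (val y) w)) ^+ 2 +
  (sin (dot x w) - \sum_(y : X) a y * sin (dot (val y) w)) ^+ 2.

Lemma measurable_defect X (a : {ffun X -> R}) x :
  measurable_fun setT (defect a x).
Proof.
have mc y : measurable_fun setT (fun w => cos (dot y w)).
  exact: (measurableT_comp (@measurable_cos R) (measurable_dotr y)).
have ms y : measurable_fun setT (fun w => sin (dot y w)).
  exact: (measurableT_comp (@measurable_sin R) (measurable_dotr y)).
apply: measurable_funD; apply: measurable_funX; apply: measurable_funB => //.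
- by apply: measurable_sum => y; apply: measurable_funM.
- by apply: measurable_sum => y; apply: measurable_funM.
Qed.

Lemma defect_ge0 X (a : {ffun X -> R}) x w : 0 <= defect a x w.
Proof. by rewrite addr_ge0 ?sqr_ge0. Qed.

Lemma fourierP f : (exists g, is_fourier f g) -> is_fourier f (fourier f).
Proof. by move=> [g fg]; rewrite /fourier; case: xgetP => [//|/(_ g)]. Qed.

Lemma native_sqnorm_ge0 K f : (forall w, 0 < khat K w) -> (0 <= native_sqnorm K f)%E.
Proof.
move=> kp; apply: mule_ge0; first by rewrite lee_fin ltW// twopi_factor_gt0.
by apply: integral_ge0 => w _; rewrite lee_fin divr_ge0 ?sqnormc_ge0// ltW.
Qed.

Lemma native_integrable K f : measurable_fun setT (khat K) ->
  (forall w, 0 < khat K w) -> is_fourier f (fourier f) ->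
  (native_sqnorm K f < +oo)%E ->
  mu.-integrable setT (EFin \o (fun w => sqnormc (fourier f w) / khat K w)).
Proof.
move=> mk kp [_ mr mi _] fin.
apply: ge0_lty_integrable.
- apply: measurable_funM; first exact: measurable_sqnormc.
  exact: measurable_inv_gt0.
- by move=> w; rewrite divr_ge0 ?sqnormc_ge0// ltW.
have k0 := twopi_factor_gt0 R d.
rewrite -(@lte_pmul2l _ kappa%:E)// ?lte_fin//.
by rewrite [ltRHS]gt0_muley ?lte_fin.
Qed.

(** The bound [p + q <= (p ^+ 2 + q ^+ 2) / k + k], with [k = khat K w], makes the
   transform of a function of finite norm integrable, as [fourier_inversion]
   requires. *)
Lemma native_inversion K f x : measurable_fun setT (khat K) ->
  (forall w, 0 < khat K w) -> mu.-integrable setT (EFin \o khat K) ->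
  native_space K f ->
  mu.-integrable setT (EFin \o (fun w => wave (fourier f w) (dot x w))) /\
  f x = kappa * (\int[mu]_w wave (fourier f w) (dot x w))%R.
Proof.
move=> mk kp ki [cf /fourierP ff fin].
have [_ mr mi _] := ff.
have fi := native_integrable mk kp ff fin.
have gi : mu.-integrable setT (EFin \o
    (fun w => `|complex.Re (fourier f w)| + `|complex.Im (fourier f w)|)).
  apply: (@dominated_integrable _ _ _ mu _
    (fun w => sqnormc (fourier f w) / khat K w + khat K w)).
  - by apply: measurable_funD; apply: measurableT_comp.
  - move=> w; rewrite ger0_norm ?addr_ge0// /sqnormc.
    rewrite -(real_normK (num_real (complex.Re _))) -(real_normK (num_real (complex.Im _))).
    have := kp w; move: (khat K w) (`|complex.Re _|) (`|complex.Im _|) => k p q k0.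
    rewrite -subr_ge0.
    have -> : (p ^+ 2 + q ^+ 2) / k + k - (p + q) =
        k^-1 * ((p - k / 2) ^+ 2 + (q - k / 2) ^+ 2 + k ^+ 2 / 2).
      by field; rewrite gt_eqF.
    by rewrite mulr_ge0 ?invr_ge0 ?addr_ge0 ?sqr_ge0 ?divr_ge0 ?sqr_ge0// ltW.
  - exact: integrable_addr.
split; last by apply: fourier_inversion => //; exact: cf.
apply: (@dominated_integrable _ _ _ mu _ (fun w =>
  `|complex.Re (fourier f w)| + `|complex.Im (fourier f w)|)) => //.
- exact: measurable_wave.
- by move=> w; exact: wave_norm_le.
Qed.

(** Pointwise Cauchy-Schwarz in additive form: the weights are those for which
   [power_function_le] ends up with exactly [D]. *)
Lemma wave_sum_le X (a : {ffun X -> R}) x w (z : R[i]) (k D : R) : 0 < k -> 0 < D ->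
  `|wave z (dot x w) - \sum_(y : X) a y * wave z (dot (val y) w)| <=
  D / 2 * (sqnormc z / k) + (D * 2)^-1 * (defect a x w * k).
Proof.
move=> k0 D0.
have -> : wave z (dot x w) - \sum_(y : X) a y * wave z (dot (val y) w) =
  complex.Re z * (cos (dot x w) - \sum_(y : X) a y * cos (dot (val y) w)) -
  complex.Im z * (sin (dot x w) - \sum_(y : X) a y * sin (dot (val y) w)).
  have -> : \sum_(y : X) a y * wave z (dot (val y) w) =
      complex.Re z * (\sum_(y : X) a y * cos (dot (val y) w)) -
      complex.Im z * (\sum_(y : X) a y * sin (dot (val y) w)).
    rewrite !mulr_sumr -sumrB; apply: eq_bigr => y _; rewrite /wave; ring.
  by rewrite /wave; ring.
rewrite /defect /sqnormc.
move: (cos _ - _) (sin _ - _) (complex.Re z) (complex.Im z) => A B p q.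
have P (u v : R) : `|u * v| <= D / 2 * (u ^+ 2 / k) + (D * 2)^-1 * (v ^+ 2 * k).
  rewrite normrM -(real_normK (num_real u)) -(real_normK (num_real v)).
  move: (`|u|) (`|v|) => s t; rewrite -subr_ge0.
  have -> : D / 2 * (s ^+ 2 / k) + (D * 2)^-1 * (t ^+ 2 * k) - s * t =
      (2 * D * k)^-1 * (D * s - t * k) ^+ 2 by field; rewrite !gt_eqF.
  by rewrite mulr_ge0 ?sqr_ge0// invr_ge0 !mulr_ge0// ltW.
apply: (le_trans (ler_normB _ _)); apply: le_trans (lerD (P p A) (P q B)) _.
by rewrite le_eqVlt; apply/orP; left; apply/eqP; ring.
Qed.

(** Inversion turns the functional into an integral against the transform of [f];
   Cauchy-Schwarz with weight [khat K] separates the norm of [f] from the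
   weighted integral of the defect. *)
Lemma power_function_le K X x (a : {ffun X -> R}) D :
  measurable_fun setT (khat K) -> (forall w, 0 < khat K w) ->
  mu.-integrable setT (EFin \o khat K) -> 0 < D ->
  mu.-integrable setT (EFin \o (fun w => defect a x w * khat K w)) ->
  kappa * (\int[mu]_w (defect a x w * khat K w))%R <= D ^+ 2 ->
  (power_function K X x <= D%:E)%E.
Proof.
move=> mk kp ki D0 di dD; have k0 := twopi_factor_gt0 R d.
apply: (@le_trans _ _ (dual_norm K (fun f => f x - \sum_(y : X) a y * f (val y)))).
  by apply: ereal_inf_lbound; exists a.
apply: ge_ereal_sup => _ [f [fK f1] <-].
have [cf /fourierP ff fin] := fK.
have fi := native_integrable mk kp ff fin.
have n1 : kappa * (\int[mu]_w (sqnormc (fourier f w) / khat K w))%R <= 1.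
  have : (native_sqnorm K f <= 1)%E.
    have E : sqrte 1%E = 1%E :> \bar R by rewrite /= sqrtr1.
    by move: f1; rewrite /native_norm -[X in (_ <= X)%E]E lee_sqrt.
  by rewrite /native_sqnorm RintegralE// -EFinM lee_fin.
have inv y := native_inversion y mk kp ki fK.
rewrite lee_fin.
have -> : f x - \sum_(y : X) a y * f (val y) =
    kappa * (\int[mu]_w (wave (fourier f w) (dot x w) -
       \sum_(y : X) a y * wave (fourier f w) (dot (val y) w)))%R.
  have iw (y : X) : mu.-integrable setT (EFin \o (fun w => a y * wave (fourier f w) (dot (val y) w))).
    by apply: integrable_mulZl; have [] := inv (val y).
  have [is_ Es] := Rintegral_sumT (index_enum X) iw.
  rewrite RintegralBT//; last by have [] := inv x.
  rewrite mulrBr; have [_ <-] := inv x; congr (_ - _).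
  rewrite Es mulr_sumr; apply: eq_bigr => y _.
  by have [iy ->] := inv (val y); rewrite RintegralZT// mulrCA.
rewrite normrM (gtr0_norm k0).
apply: (@le_trans _ _ (kappa * (\int[mu]_w (D / 2 * (sqnormc (fourier f w) / khat K w) +
    (D * 2)^-1 * (defect a x w * khat K w)))%R)).
  rewrite ler_wpM2l ?(ltW k0)//; apply: norm_RintegralT.
  - apply: measurable_funB; first by apply: measurable_wave; have [] := ff.
    apply: measurable_sum => y; apply: measurable_funM => //.
    by apply: measurable_wave; have [] := ff.
  - by apply: integrable_addr; exact: integrable_mulZl.
  - by move=> w; exact: wave_sum_le.
rewrite RintegralDT; [|exact: integrable_mulZl..].
rewrite !RintegralZT// mulrDr.
rewrite (mulrCA kappa) (mulrCA kappa (D * 2)^-1).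
apply: (@le_trans _ _ (D / 2 * 1 + (D * 2)^-1 * D ^+ 2)).
  apply: lerD; apply: ler_wpM2l => //.
    by rewrite divr_ge0// ltW.
  by rewrite invr_ge0 mulr_ge0// ltW.
by rewrite le_eqVlt; apply/orP; left; apply/eqP; field; rewrite gt_eqF.
Qed.

End kernel_bounds.

(** * Reproduction of polynomials on dense sets *)
Section reproduction.
Context (R : realType) (d l : nat).
Implicit Types (x y w : 'rV[R]_d) (X : {fset 'rV[R]_d}).

Local Notation expo := {ffun 'I_d -> 'I_l.+1}.

(** Monomials of degree at most [l] in each variable; the exponents also serve
   as the nodes of a cubic grid. *)
Definition monomial (al : expo) x : R := \prod_i x ord0 i ^+ al i.

(** The power of the sum is expanded over words in the coordinates; several words
   may give the same monomial. *)
Lemma dot_pow_monomial (n : nat) : (n < l.+1)%N ->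
  exists (I : finType) (c : I -> 'rV[R]_d -> R) (al : I -> expo),
  forall x w, dot x w ^+ n = \sum_(i : I) c i w * monomial (al i) x.
Proof.
move=> nl; exists {ffun 'I_n -> 'I_d}.
have cl (phi : {ffun 'I_n -> 'I_d}) (i : 'I_d) : (#|[pred j | phi j == i]| < l.+1)%N.
  by apply: leq_ltn_trans nl; rewrite -[leqRHS]card_ord; exact: max_card.
exists (fun (phi : {ffun 'I_n -> 'I_d}) w => \prod_j w ord0 (phi j)).
exists (fun phi : {ffun 'I_n -> 'I_d} => [ffun i => Ordinal (cl phi i)]) => x w.
rewrite -[n in LHS]card_ord -prodr_const /dot bigA_distr_bigA/=.
apply: eq_bigr => phi _; rewrite big_split/= mulrC; congr (_ * _).
rewrite /monomial (partition_big (fun j => phi j) xpredT)//=.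
apply: eq_bigr => i _; rewrite ffunE /=.
rewrite (eq_bigr (fun=> x ord0 i)); last by move=> j /eqP ->.
by rewrite prodr_const.
Qed.

Local Notation N := #|{: expo}|.

Definition collocation (P : 'M[R]_(N, d)) : 'M[R]_N :=
  \matrix_(k, al) monomial (enum_val al) (row k P).

Lemma continuous_det_collocation : continuous (fun P => \det (collocation P)).
Proof.
have cM : continuous (fun x : R * R => x.1 * x.2) by exact: mul_continuous.
have cD : continuous (fun x : R * R => x.1 + x.2) by exact: add_continuous.
have cm (k al : 'I_N) : continuous (fun P => collocation P k al).
  have -> : (fun P => collocation P k al) =
      fun P => \prod_i P k i ^+ (enum_val al i).
    by apply/funext => P; rewrite !mxE; apply: eq_bigr => i _; rewrite mxE.
  apply: (continuous_big cM) => i _ P.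
  apply: (@continuous_comp _ _ _ (fun Q : 'M[R]_(N, d) => Q k i)
    (fun t => t ^+ (enum_val al i))); last exact: exprn_continuous.
  exact: coord_continuous.
have cp (s : {perm 'I_N}) : continuous (fun P => \prod_k collocation P k (s k)).
  by apply: (continuous_big cM) => k _; exact: cm.
have cs (s : {perm 'I_N}) :
    continuous (fun P => (-1) ^+ s * \prod_k collocation P k (s k)).
  move=> P; apply: (continuous_comp (cp s P)); exact: mulrl_continuous.
by apply: (continuous_big cD) => s _; exact: cs.
Qed.

Definition grid (x0 : 'rV[R]_d) (delta : R) : 'M[R]_(N, d) :=
  \matrix_(k, i) (x0 ord0 i + delta * ((enum_val k : expo) i)%:R).

(** On a grid, the collocation matrix is a tensor product of Vandermonde matrices,
   and [W] is the tensor product of their inverses. *)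
Lemma det_grid_neq0 x0 delta : 0 < delta -> \det (collocation (grid x0 delta)) != 0.
Proof.
move=> delta0.
pose V (i : 'I_d) : 'M[R]_l.+1 :=
  (Vandermonde l.+1 (\row_(j < l.+1) (x0 ord0 i + delta * j%:R)))^T.
have Vu i : V i \in unitmx.
  rewrite unitmx_tr unitmxE det_Vandermonde unitfE.
  apply/prodf_neq0 => j _; apply/prodf_neq0 => k jk; rewrite !mxE.
  rewrite opprD addrACA subrr add0r -mulrBr mulf_neq0 ?gt_eqF// subr_gt0 ltr_nat//.
pose W : 'M[R]_N := \matrix_(al, ga)
  \prod_i invmx (V i) ((enum_val al : expo) i) ((enum_val ga : expo) i).
suff E : collocation (grid x0 delta) *m W = 1%:M.
  have := mulmx1_unit E; rewrite !unitmxE !unitfE => -[-> _]; done.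
apply/matrixP => k ga; rewrite !mxE.
transitivity (\sum_(al : expo) \prod_i
    (V i ((enum_val k : expo) i) (al i) * invmx (V i) (al i) ((enum_val ga : expo) i))).
  rewrite [RHS](eq_bigl (fun al => al \in {: expo}))//= [RHS]big_enum_val.
  apply: eq_bigr => al _; rewrite !mxE /monomial -big_split/=.
  by apply: eq_bigr => i _; rewrite !mxE.
rewrite -(bigA_distr_bigA (fun i j =>
  V i ((enum_val k : expo) i) j * invmx (V i) j ((enum_val ga : expo) i))).
transitivity (\prod_i (((enum_val k : expo) i == (enum_val ga : expo) i)%:R : R)).
  apply: eq_bigr => i _.
  have := mulmxV (Vu i) => /matrixP /(_ ((enum_val k : expo) i) ((enum_val ga : expo) i)).
  by rewrite !mxE.
have [->|kga] := eqVneq k ga; first by rewrite big1// => i _; rewrite eqxx.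
have [i Hi] : exists i, (enum_val k : expo) i != (enum_val ga : expo) i.
  apply/existsP; rewrite -negb_forall; apply: contra kga => /forallP H.
  by apply/eqP; apply: enum_val_inj; apply/ffunP => i; exact/eqP.
by rewrite (bigD1 i)//= (negbTE Hi) mul0r.
Qed.

Lemma bounded_set_coord (Omega : set 'rV[R]_d) : bounded_set Omega ->
  exists2 rho : R, 1 <= rho & forall x i, Omega x -> `|x ord0 i| <= rho.
Proof.
move=> [M [Mr MO]]; exists (`|M| + 1); first by rewrite lerDr.
move=> x i Ox; have : `|x| <= `|M| + 1.
  by apply: MO => //; rewrite (le_lt_trans (ler_norm _))// ltrDl.
apply: le_trans; rewrite [leRHS]/Num.norm/= mx_normE.
exact: (le_bigmax _ (fun i : 'I_1 * 'I_d => `|x i.1 i.2|%:nng%R) (ord0, i)).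
Qed.

(** Points of [X] close to the nodes of a grid still determine the polynomials of
   degree at most [l] in each variable, since the collocation determinant is
   continuous. The coefficients are read off the inverse of that one matrix, which
   bounds them uniformly in [x]. Polynomials in [dot x w] suffice, as the Taylor
   polynomials of [exp (i x.w)] are of this form. *)
Lemma polynomial_reproduction (Omega : set 'rV[R]_d) :
  open Omega -> Omega !=set0 -> bounded_set Omega ->
  exists2 h0 : R, 0 < h0 & forall X, (fill_distance X Omega <= h0%:E)%E ->
  exists2 A : R, 0 < A & forall x, Omega x ->
  exists2 a : {ffun X -> R}, \sum_y `|a y| <= A &
  forall (p : {poly R}) w, (size p <= l.+1)%N ->
    p.[dot x w] = \sum_(y : X) a y * p.[dot (val y) w].
Proof.
move=> oO [x0 Ox0] bO.
have [r r0 rO] : exists2 r, 0 < r & forall y, (forall i, `|x0 ord0 i - y ord0 i| < r) -> Omega y.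
  have /nbhs_ballP[r r0 H] := oO _ Ox0; exists r => // y Hy.
  by apply: H; split => // i j; rewrite ord1; exact: Hy.
pose delta := r / l.+2%:R.
have delta0 : 0 < delta by rewrite divr_gt0// ltr0n.
pose Z := grid x0 delta.
have ZO k : Omega (row k Z).
  apply: rO => i; rewrite !mxE opprD addrA subrr add0r normrN.
  rewrite ger0_norm; last by rewrite mulr_ge0 ?(ltW delta0).
  rewrite /delta mulrAC ltr_pdivrMr ?ltr0n//.
  by rewrite ltr_pM2l// ltr_nat (leq_trans (ltn_ord _)).
have [eta eta0 Heta] : exists2 eta, 0 < eta &
    forall P : 'M[R]_(N, d), (forall k i, `|Z k i - P k i| < eta) -> \det (collocation P) != 0.
  have D0 : `|\det (collocation Z)| > 0 by rewrite normr_gt0 det_grid_neq0.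
  have /cvgrPdist_lt/(_ _ D0)/nbhs_ballP[eta eta0 H] := @continuous_det_collocation Z.
  exists eta => // P HP; apply/eqP => P0.
  have : `|\det (collocation Z) - \det (collocation P)| < `|\det (collocation Z)|.
    by apply: H; split => // k i; exact: HP.
  by rewrite P0 subr0 ltxx.
exists (eta / 2); first by rewrite divr_gt0.
move=> X HX.
have near_node y : Omega y -> exists x : X, enorm (val x - y) < eta.
  move=> Oy.
  have : (ereal_inf [set (enorm (x - y))%:E | x in [set` X]] < eta%:E)%E.
    apply: (@le_lt_trans _ _ (eta / 2)%:E); last by rewrite lte_fin ltr_pdivrMr// ltr_pMr// ltr1n.
    by apply: le_trans HX; apply: ereal_sup_ubound; exists y.
  move=> /ereal_inf_lt[_ [x /= xX <-]]; rewrite lte_fin => xy.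
  by exists [` xX]%fset.
have /choice[xi Hxi] : forall k, exists x : X, enorm (val x - row k Z) < eta.
  by move=> k; apply: near_node.
pose P : 'M[R]_(N, d) := \matrix_(k, i) val (xi k) ord0 i.
have rowPE k : row k P = val (xi k) by apply/rowP => i; rewrite !mxE.
have GP : collocation P \in unitmx.
  rewrite unitmxE unitfE; apply: Heta => k i.
  apply: le_lt_trans (Hxi k); rewrite distrC.
  by have := coord_le_enorm (val (xi k) - row k Z) i; rewrite !mxE.
have [rho rho1 Hrho] := bounded_set_coord bO.
have rho0 : 0 <= rho by exact: le_trans rho1.
pose mon x : 'rV[R]_N := \row_al monomial (enum_val al) x.
pose b x : 'rV[R]_N := mon x *m invmx (collocation P).
have bE x (al : expo) : monomial al x = \sum_k b x ord0 k * monomial al (val (xi k)).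
  have : b x *m collocation P = mon x by rewrite mulmxKV.
  move=> /rowP/(_ (enum_rank al)); rewrite !mxE enum_rankK => <-.
  by apply: eq_bigr => k _; rewrite [in RHS]mxE [collocation _ _ _]mxE enum_rankK rowPE mxE.
pose B : R := \sum_k \sum_al rho ^+ (l * d) * `|invmx (collocation P) al k|.
have bB x : Omega x -> \sum_k `|b x ord0 k| <= B.
  move=> Ox; apply: ler_sum => k _; rewrite mxE (le_trans (ler_norm_sum _ _ _))//.
  apply: ler_sum => al _; rewrite normrM ler_wpM2r// mxE normr_prod.
  have -> : rho ^+ (l * d) = \prod_(i < d) rho ^+ l.
    by rewrite prodr_const card_ord exprM.
  apply: ler_prod => i _.
  rewrite normr_ge0/= normrX.
  apply: (@le_trans _ _ (rho ^+ (enum_val al : expo) i)).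
    by rewrite lerXn2r ?nnegrE// Hrho.
  by rewrite ler_weXn2l// -ltnS ltn_ord.
have B0 : 0 <= B.
  by apply: sumr_ge0 => k _; apply: sumr_ge0 => al _; rewrite mulr_ge0 ?exprn_ge0.
exists (B + 1); first by rewrite ltr_pwDr.
move=> x Ox.
have sumxi (F : X -> R) : \sum_y (\sum_(k | xi k == y) b x ord0 k) * F y =
    \sum_k b x ord0 k * F (xi k).
  rewrite [RHS](partition_big xi xpredT)//=; apply: eq_bigr => y _.
  by rewrite mulr_suml; apply: eq_bigr => k /eqP ->.
exists [ffun y => \sum_(k | xi k == y) b x ord0 k].
  apply: (@le_trans _ _ B); last by rewrite lerDl.
  apply: le_trans (bB x Ox); rewrite [leRHS](partition_big xi xpredT)//=.
  by apply: ler_sum => y _; rewrite ffunE ler_norm_sum.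
move=> p w sp.
have powE (n : nat) : (n < l.+1)%N ->
    dot x w ^+ n = \sum_k b x ord0 k * dot (val (xi k)) w ^+ n.
  move=> nl; have [I [c [al E]]] := dot_pow_monomial nl.
  rewrite E; under [RHS]eq_bigr do rewrite E mulr_sumr.
  rewrite exchange_big/=; apply: eq_bigr => i _; rewrite bE mulr_sumr.
  by apply: eq_bigr => k _; rewrite mulrCA.
under eq_bigr do rewrite ffunE.
rewrite (sumxi (fun y : X => p.[dot (val y) w])) horner_coef.
under [RHS]eq_bigr do rewrite horner_coef mulr_sumr.
rewrite exchange_big/=; apply: eq_bigr => n _.
rewrite powE; last exact: leq_trans (ltn_ord n) sp.
by rewrite mulr_sumr; apply: eq_bigr => k _; rewrite mulrCA.
Qed.

End reproduction.

(** * Taylor polynomials of the cosine and the sine *)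
Section taylor.
Context (R : realType).

Definition primitive (p : {poly R}) : {poly R} :=
  \poly_(i < (size p).+1) (if i is j.+1 then p`_j / j.+1%:R else 0).

Lemma deriv_primitive p : (primitive p)^`() = p.
Proof.
apply/polyP => i; rewrite coef_deriv coef_poly ltnS.
case: ltnP => [ip|pi]; last by rewrite mul0rn nth_default.
by rewrite -[LHS]mulr_natr divfK// pnatr_eq0.
Qed.

Lemma primitive0 p : (primitive p).[0] = 0.
Proof. by rewrite horner_coef0 coef_poly. Qed.

Lemma size_primitive p : (size (primitive p) <= (size p).+1)%N.
Proof. exact: size_poly. Qed.

Lemma mean_value_pow_le (h h' : R -> R) n (u : R) :
  (forall x : R, is_derive x 1 h (h' x)) -> h 0 = 0 ->
  (forall x, `|h' x| <= `|x| ^+ n) -> `|h u| <= `|u| ^+ n.+1.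
Proof.
move=> dh h0 hb.
have ch : continuous h.
  by move=> x; apply: differentiable_continuous; apply/derivable1_diffP; have [] := dh x.
have key (c : R) : `|c| <= `|u| -> `|h' c * u| <= `|u| ^+ n.+1.
  move=> cu; rewrite normrM exprSr ler_wpM2r// (le_trans (hb c))//.
  by rewrite lerXn2r ?nnegrE.
have [u0|u0|->] := ltgtP u 0; last by rewrite h0 normr0 exprn_ge0.
- have [c] := @MVT _ h h' u 0 u0 (fun x _ => dh x) (continuous_subspaceT ch).
  rewrite in_itv/= => /andP[uc c0]; rewrite h0 !sub0r => /eqP.
  rewrite mulrN eqr_opp => /eqP ->; apply: key.
  by rewrite !ltr0_norm// lerN2 ltW.
- have [c] := @MVT _ h h' 0 u u0 (fun x _ => dh x) (continuous_subspaceT ch).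
  rewrite in_itv/= => /andP[c0 cu]; rewrite h0 !subr0 => ->; apply: key.
  by rewrite !gtr0_norm// ltW.
Qed.

(** Each of the two polynomials is a primitive of the other one at the previous
   order, and the mean value theorem raises the order of the error. *)
Lemma trig_taylor n : exists P Q : {poly R},
  [/\ (size P <= n)%N, (size Q <= n)%N,
      forall u, `|cos u - P.[u]| <= `|u| ^+ n &
      forall u, `|sin u - Q.[u]| <= `|u| ^+ n].
Proof.
elim: n => [|n [P [Q [sP sQ hP hQ]]]].
  exists 0, 0; rewrite size_poly0; split => // u.
  - by rewrite horner0 subr0 expr0 norm_cos_le1.
  - by rewrite horner0 subr0 expr0 norm_sin_le1.
exists (1 - primitive Q), (primitive P); split.
- rewrite (leq_trans (size_polyD _ _))// geq_max size_poly1 size_polyN/=.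
  by rewrite (leq_trans (size_primitive _)).
- by rewrite (leq_trans (size_primitive _)).
- move=> u; pose h u := cos u - (1 - primitive Q).[u].
  apply: (@mean_value_pow_le h (fun x => - (sin x - Q.[x]))).
  + move=> x; have dp := is_derive_poly (1 - primitive Q) x.
    apply: is_derive_eq; rewrite derivB deriv_primitive derivC sub0r hornerN.
    by ring.
  + by rewrite /h cos0 !hornerE primitive0 subr0 subrr.
  + by move=> x; rewrite normrN.
- move=> u; pose h u := sin u - (primitive P).[u].
  apply: (@mean_value_pow_le h (fun x => cos x - P.[x])) => //.
  + move=> x; have dp := is_derive_poly (primitive P) x.
    by apply: is_derive_eq; rewrite deriv_primitive.
  + by rewrite /h sin0 primitive0 subr0.
Qed.

End taylor.

(** * Scaled kernels *)
Section scaled.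
Context (R : realType) (d : nat).
Local Notation mu := (lebesgue_rV R d).
Local Notation kappa := (twopi_factor R d).
Implicit Types (x y w : 'rV[R]_d) (f : 'rV[R]_d -> R) (K : ti_kernel R d).
Implicit Types (X : {fset 'rV[R]_d}) (Omega : set 'rV[R]_d).

Lemma norm_dot_le y w (rho : R) : (forall i, `|y ord0 i| <= rho) ->
  `|dot y w| <= d%:R * rho * enorm w.
Proof.
move=> yr; rewrite (le_trans (ler_norm_sum _ _ _))//.
apply: (@le_trans _ _ (\sum_(i < d) rho * enorm w)).
  by apply: ler_sum => i _; rewrite normrM ler_pM// coord_le_enorm.
by rewrite sumr_const card_ord -mulrA mulr_natl.
Qed.

Lemma residual_le X (a : {ffun X -> R}) A (r : 'rV[R]_d -> R) x (t : R) :
  0 <= t -> \sum_y `|a y| <= A -> `|r x| <= t -> (forall y : X, `|r (val y)| <= t) ->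
  `|r x - \sum_(y : X) a y * r (val y)| <= (1 + A) * t.
Proof.
move=> t0 aA rx ry; rewrite (le_trans (ler_normB _ _))// mulrDl mul1r lerD//.
rewrite (le_trans (ler_norm_sum _ _ _))//.
apply: (@le_trans _ _ ((\sum_y `|a y|) * t)); last exact: ler_wpM2r.
by rewrite mulr_suml; apply: ler_sum => y _; rewrite normrM ler_wpM2l.
Qed.

Lemma defect_le_cst X (a : {ffun X -> R}) A x w : \sum_y `|a y| <= A ->
  defect a x w <= 2 * (1 + A) ^+ 2.
Proof.
move=> aA; have A0 : 0 <= 1 + A.
  by rewrite addr_ge0// (le_trans _ aA)// sumr_ge0.
have P (t : R -> R) : (forall s, `|t s| <= 1) ->
    (t (dot x w) - \sum_(y : X) a y * t (dot (val y) w)) ^+ 2 <= (1 + A) ^+ 2.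
  move=> t1; rewrite -(real_normK (num_real (_ - _))) lerXn2r ?nnegrE//.
  by rewrite -[leRHS]mulr1; apply: (residual_le (r := fun y => t (dot y w))).
rewrite /defect mulr_natl mulr2n lerD// P// => s; [exact: norm_cos_le1|exact: norm_sin_le1].
Qed.

(** Coefficients that reproduce the Taylor polynomials of [exp (i x.w)] leave only
   the remainders, of order [l.+1] in [enorm w], in the defect. *)
Lemma defect_le_pow X (a : {ffun X -> R}) A x w l (rho : R) : 0 <= rho ->
  (forall i, `|x ord0 i| <= rho) -> (forall (y : X) i, `|(val y) ord0 i| <= rho) ->
  \sum_y `|a y| <= A ->
  (forall p : {poly R}, (size p <= l.+1)%N ->
     p.[dot x w] = \sum_(y : X) a y * p.[dot (val y) w]) ->
  defect a x w <= 2 * (1 + A) ^+ 2 * (d%:R * rho) ^+ (2 * l.+1) * dot w w ^+ l.+1.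
Proof.
move=> rho0 xr Xr aA rep; have A0 : 0 <= 1 + A.
  by rewrite addr_ge0// (le_trans _ aA)// sumr_ge0.
pose t := (d%:R * rho * enorm w) ^+ l.+1.
have c0 : 0 <= d%:R * rho * enorm w by rewrite !mulr_ge0 ?enorm_ge0.
have t0 : 0 <= t by rewrite exprn_ge0.
have P (h : R -> R) (p : {poly R}) : (size p <= l.+1)%N ->
    (forall u, `|h u - p.[u]| <= `|u| ^+ l.+1) ->
    (h (dot x w) - \sum_(y : X) a y * h (dot (val y) w)) ^+ 2 <= ((1 + A) * t) ^+ 2.
  move=> sp hp.
  have b y : (forall i, `|y ord0 i| <= rho) -> `|h (dot y w) - p.[dot y w]| <= t.
    by move=> yr; rewrite (le_trans (hp _))// lerXn2r ?nnegrE// norm_dot_le.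
  have -> : h (dot x w) - \sum_(y : X) a y * h (dot (val y) w) =
      (h (dot x w) - p.[dot x w]) -
      \sum_(y : X) a y * (h (dot (val y) w) - p.[dot (val y) w]).
    under [in RHS]eq_bigr do rewrite mulrBr.
    by rewrite sumrB -rep//; ring.
  rewrite -(real_normK (num_real (_ - _))) lerXn2r ?nnegrE ?mulr_ge0//.
  apply: (residual_le (r := fun y => h (dot y w) - p.[dot y w])) => //; first exact: b.
  by move=> y; apply: b => i; exact: Xr.
have [pc [ps [sc ss hc hs]]] := trig_taylor R l.+1.
have -> : 2 * (1 + A) ^+ 2 * (d%:R * rho) ^+ (2 * l.+1) * dot w w ^+ l.+1 =
    ((1 + A) * t) ^+ 2 + ((1 + A) * t) ^+ 2.
  have -> : 2 * (1 + A) ^+ 2 * (d%:R * rho) ^+ (2 * l.+1) * dot w w ^+ l.+1 =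
      2 * (1 + A) ^+ 2 * t ^+ 2.
    by rewrite -enorm_sqr -[LHS]mulrA exprM -exprMn -[in LHS]exprMn exprAC.
  by rewrite exprMn; ring.
by apply: lerD; [exact: P sc hc|exact: P ss hs].
Qed.

Variable K : ti_kernel R d.
Variables (s c0 c1 : R).
Hypothesis mK : measurable_fun setT (khat K).
Hypothesis Kp : forall w, 0 < khat K w.
Hypothesis Kc : comparable_kernel K s c0 c1.
Hypothesis d0 : (0 < d)%N.
Hypothesis ds : d%:R < 2 * s.

Let s0 : 0 < s.
Proof. by have : 0 < 2 * s by [apply: le_lt_trans ds]; lra. Qed.

Let k0 : 0 < kappa. Proof. exact: twopi_factor_gt0. Qed.

Lemma dotZ (e : R) w : dot (e *: w) (e *: w) = e ^+ 2 * dot w w.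
Proof. by rewrite /dot mulr_sumr; apply: eq_bigr => i _; rewrite !mxE; ring. Qed.

Lemma eq_bracket_scale e w : 0 < e ->
  e ^- d * bracket (e^-1 *: w) `^ (- s) =
  e `^ (2 * s - d%:R) * (e ^+ 2 + dot w w) `^ (- s).
Proof.
move=> e0; have q0 := dot_ge0 w; have e20 : 0 < e ^+ 2 by rewrite exprn_gt0.
have -> : bracket (e^-1 *: w) = (e ^+ 2)^-1 * (e ^+ 2 + dot w w).
  by rewrite /bracket dotZ; field; rewrite gt_eqF.
rewrite powRM ?invr_ge0 ?(ltW e20) ?addr_ge0 ?(ltW e20)// mulrA; congr (_ * _).
rewrite powRB; last by rewrite (gt_eqF e0) implybT.
rewrite powRrM powR_mulrn ?(ltW e0)// powR_mulrn ?(ltW e0)//.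
have -> : (e ^+ 2)^-1 `^ (- s) = (e ^+ 2) `^ s.
  by rewrite -[(e ^+ 2)^-1]powR_inv1 ?(ltW e20)// -powRrM mulrNN mul1r.
by rewrite mulrC.
Qed.

Lemma measurable_scale_khat e : measurable_fun setT (khat (scale_kernel e K)).
Proof.
apply: measurable_funM => //; apply: (measurableT_comp mK).
apply: measurable_fun_rVP => i.
rewrite (_ : (fun _ => _) = fun w : 'rV[R]_d => e^-1 * w ord0 i).
  by apply: measurable_funM => //; exact: measurable_coord.
by apply/funext => w; rewrite mxE.
Qed.

Lemma scale_khat_gt0 e w : 0 < e -> 0 < khat (scale_kernel e K) w.
Proof. by move=> e0; rewrite /= mulr_gt0// invr_gt0 exprn_gt0. Qed.

Lemma scale_khat_bounds e w : 0 < e ->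
  c0 * (e `^ (2 * s - d%:R) * (e ^+ 2 + dot w w) `^ (- s)) <=
    khat (scale_kernel e K) w /\
  khat (scale_kernel e K) w <=
    c1 * (e `^ (2 * s - d%:R) * (e ^+ 2 + dot w w) `^ (- s)).
Proof.
move=> e0; have [_ _ /(_ (e^-1 *: w))[h0 h1]] := Kc.
have E0 : 0 <= e ^- d by rewrite invr_ge0 exprn_ge0// ltW.
by rewrite -eq_bracket_scale//=; split; rewrite mulrCA ler_wpM2l.
Qed.

Let I := (\int[mu]_w (bracket w `^ (- s)))%R.

Let I0 : 0 <= I.
Proof. by apply: Rintegral_ge0 => w _; exact: powR_ge0. Qed.

Let bi := @integrable_bracketN R d s d0 ds.

Lemma integrable_scale_khat e : 0 < e ->
  mu.-integrable setT (EFin \o khat (scale_kernel e K)).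
Proof.
move=> e0; have [_ c10 _] := Kc.
pose t := Num.max 1 (e `^ (- (2 * s))).
apply: (@dominated_integrable _ _ _ mu _
  (fun w => c1 * e `^ (2 * s - d%:R) * t * bracket w `^ (- s))).
- exact: measurable_scale_khat.
- move=> w; rewrite ger0_norm ?(ltW (scale_khat_gt0 _ _))//.
  have [_ h] := scale_khat_bounds w e0; apply: (le_trans h).
  rewrite -!mulrA ler_wpM2l ?(ltW c10)// ler_wpM2l ?powR_ge0//.
  have q0 := dot_ge0 w; have e20 : 0 < e ^+ 2 by rewrite exprn_gt0.
  have qe0 : 0 < e ^+ 2 + dot w w by rewrite ltr_pwDl.
  have [e1|e1] := leP 1 e.
    apply: (@le_trans _ _ (bracket w `^ (- s))).
      rewrite !powRN lef_pV2 ?posrE ?powR_gt0 ?bracket_gt0//.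
      apply: ge0_ler_powR; rewrite ?nnegrE ?(ltW s0) ?(ltW qe0) ?(ltW (bracket_gt0 _))//.
      by rewrite /bracket lerD2r expr_ge1 ?(ltW e0).
    by rewrite ler_peMl ?powR_ge0// le_max lexx.
  apply: (@le_trans _ _ (e `^ (- (2 * s)) * bracket w `^ (- s))); last first.
    by rewrite ler_wpM2r ?powR_ge0// le_max lexx orbT.
  rewrite !powRN powRrM powR_mulrn ?(ltW e0)// -invfM -powRM; last 2 first.
  + exact: ltW.
  + by rewrite ltW// bracket_gt0.
  rewrite lef_pV2 ?posrE ?powR_gt0 ?mulr_gt0 ?bracket_gt0//.
  apply: ge0_ler_powR; rewrite ?nnegrE ?(ltW s0) ?(ltW qe0)//.
    by rewrite mulr_ge0 ?(ltW e20)// ltW// bracket_gt0.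
  rewrite /bracket mulrDr mulr1 lerD2l ler_piMl//.
  by rewrite expr_le1 ?(ltW e0) ?(ltW e1).
- exact: integrable_mulZl.
Qed.

(** [eq_bracket_scale] splits the scaled transform into a power of [e] and a weight
   that becomes singular at the origin. Where the defect compensates this
   singularity, the integral that remains does not depend on [e]. The summand 1
   keeps the square root positive. *)
Lemma power_scale_le X (a : {ffun X -> R}) x e M : 0 < e -> 0 <= M ->
  (forall w, defect a x w * (e ^+ 2 + dot w w) `^ (- s) <= M * bracket w `^ (- s)) ->
  (power_function (scale_kernel e K) X x <=
    (Num.sqrt (kappa * c1 * M * I + 1) * e `^ ((2 * s - d%:R) / 2))%:E)%E.
Proof.
move=> e0 M0 H; have [_ c10 _] := Kc.
have B0 : 0 < kappa * c1 * M * I + 1.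
  by rewrite ltr_pwDr// !mulr_ge0// ltW.
have Ep : 0 < e `^ (2 * s - d%:R) by rewrite powR_gt0.
have le w : defect a x w * khat (scale_kernel e K) w <=
    c1 * e `^ (2 * s - d%:R) * M * bracket w `^ (- s).
  have [_ h] := scale_khat_bounds w e0.
  apply: (le_trans (ler_wpM2l (defect_ge0 _ _ _) h)).
  rewrite [leLHS](_ : _ = c1 * e `^ (2 * s - d%:R) *
     (defect a x w * (e ^+ 2 + dot w w) `^ (- s))); last by ring.
  by rewrite -[leRHS]mulrA ler_wpM2l// mulr_ge0 ?powR_ge0// ltW.
have di : mu.-integrable setT
    (EFin \o (fun w => defect a x w * khat (scale_kernel e K) w)).
  apply: (@dominated_integrable _ _ _ mu _
    (fun w => c1 * e `^ (2 * s - d%:R) * M * bracket w `^ (- s))).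
  - apply: measurable_funM; first exact: measurable_defect.
    exact: measurable_scale_khat.
  - move=> w; rewrite ger0_norm ?le// mulr_ge0 ?defect_ge0//.
    by rewrite ltW// scale_khat_gt0.
  - exact: integrable_mulZl.
apply: (@power_function_le _ _ _ _ _ a) => //.
- exact: measurable_scale_khat.
- by move=> w; exact: scale_khat_gt0.
- exact: integrable_scale_khat.
- by rewrite mulr_gt0 ?sqrtr_gt0 ?powR_gt0.
rewrite exprMn sqr_sqrtr ?(ltW B0)//.
have -> : (e `^ ((2 * s - d%:R) / 2)) ^+ 2 = e `^ (2 * s - d%:R).
  by rewrite -powR_mulrn ?powR_ge0// -powRrM; congr (_ `^ _); by field.
apply: (@le_trans _ _ (kappa * (c1 * e `^ (2 * s - d%:R) * M * I))).
  rewrite ler_wpM2l ?(ltW k0)// -RintegralZT//.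
  by apply: le_RintegralT => //; exact: integrable_mulZl.
rewrite -subr_ge0.
rewrite [leRHS](_ : _ = e `^ (2 * s - d%:R)); first exact: ltW.
by ring.
Qed.

(** The scaled transform now stands in the denominator: the power of [e] is the
   inverse of the one in the squared power function. *)
Lemma native_sqnorm_scale_le f e t : 0 < e -> 0 <= t ->
  (exists g, is_fourier f g) ->
  (forall w, (e ^+ 2 + dot w w) `^ s <= t * bracket w `^ s) ->
  (native_sqnorm (scale_kernel e K) f <=
   (c1 / c0 * e `^ (d%:R - 2 * s) * t)%:E * native_sqnorm K f)%E.
Proof.
move=> e0 t0 /fourierP[_ mr mi _] H; have [c00 c10 Kb] := Kc.
have ms : measurable_fun setT (fun w => sqnormc (fourier f w)).
  exact: measurable_sqnormc.
rewrite /native_sqnorm muleCA lee_pmul2l ?lte_fin//.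
have C0 : 0 <= c1 / c0 * e `^ (d%:R - 2 * s) * t.
  by rewrite !mulr_ge0 ?powR_ge0 ?invr_ge0// ltW.
rewrite -ge0_integralZl//; last 2 first.
- apply/measurable_EFinP; apply: measurable_funM => //.
  exact: measurable_inv_gt0.
- by move=> w _; rewrite lee_fin divr_ge0 ?sqnormc_ge0// ltW.
apply: ge0_le_integral => //.
- by move=> w _; rewrite lee_fin divr_ge0 ?sqnormc_ge0// ltW// scale_khat_gt0.
- apply/measurable_EFinP; apply: measurable_funM => //.
  apply: measurable_inv_gt0; first exact: measurable_scale_khat.
  by move=> w; exact: scale_khat_gt0.
- apply: emeasurable_funM => //; apply/measurable_EFinP; apply: measurable_funM => //.
  exact: measurable_inv_gt0.
move=> w _; rewrite -EFinM lee_fin mulrCA ler_wpM2l ?sqnormc_ge0//.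
have [h _] := scale_khat_bounds w e0; have [_ h'] := Kb w.
have qe0 : 0 < e ^+ 2 + dot w w by rewrite ltr_pwDl ?dot_ge0// exprn_gt0.
have Ep : 0 < e `^ (2 * s - d%:R) by rewrite powR_gt0.
have Ed : e `^ (d%:R - 2 * s) = (e `^ (2 * s - d%:R))^-1 by rewrite -powRN opprB.
apply: (@le_trans _ _ (c0 * (e `^ (2 * s - d%:R) * (e ^+ 2 + dot w w) `^ (- s)))^-1).
  by rewrite lef_pV2 ?posrE ?scale_khat_gt0// !mulr_gt0// powR_gt0.
rewrite Ed powRN !invfM invrK.
apply: (@le_trans _ _ (c0^-1 * ((e `^ (2 * s - d%:R))^-1 * (t * (c1 / khat K w))))).
  rewrite !ler_wpM2l ?invr_ge0 ?(ltW c00) ?(ltW Ep)//.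
  apply: (le_trans (H w)); rewrite ler_wpM2l// ler_pdivlMr//.
  by move: h'; rewrite powRN ler_pdivlMr ?powR_gt0 ?bracket_gt0// mulrC.
by rewrite le_eqVlt; apply/orP; left; apply/eqP; ring.
Qed.

End scaled.

(** * Bumps with decaying transform *)
Lemma deriv_mul_exp (R : comNzRingType) (Q q : {poly R}) n :
  (Q * q ^+ n.+1)^`() = (Q^`() * q + Q * q^`() *+ n.+1) * q ^+ n.
Proof.
rewrite derivM deriv_exp /= mulrDl exprS mulrA; congr (_ + _).
by rewrite mulrnAr mulrnAl mulrA.
Qed.

Section hump.
Context (R : realType).
Local Notation leb := (@lebesgue_measure R).
Variables al be : R.
Hypothesis ab : al < be.

Let q : {poly R} := ('X - al%:P) * (be%:P - 'X).

Let q0 : q.[al] = 0.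
Proof. by rewrite /q !hornerE subrr mul0r. Qed.

Let q1 : q.[be] = 0.
Proof. by rewrite /q !hornerE subrr mulr0. Qed.

Let itv_integrable (f : R -> R) : continuous f -> leb.-integrable `[al, be] (EFin \o f).
Proof.
move=> cf; apply: continuous_compact_integrable; first exact: segment_compact.
exact: continuous_subspaceT.
Qed.

Let derivable_cont (f : R -> R) : (forall x : R, derivable f x 1) -> continuous f.
Proof. by move=> df x; apply: differentiable_continuous; exact/derivable1_diffP. Qed.

Let cos_sin_ibp (P : {poly R}) w : P.[al] = 0 -> P.[be] = 0 ->
  w * (\int[leb]_(t in `[al, be]) (P.[t] * cos (t * w)))%R =
    - (\int[leb]_(t in `[al, be]) (P^`().[t] * sin (t * w)))%R /\
  w * (\int[leb]_(t in `[al, be]) (P.[t] * sin (t * w)))%R =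
    (\int[leb]_(t in `[al, be]) (P^`().[t] * cos (t * w)))%R.
Proof.
move=> Pa Pb.
have dc (t : R) : is_derive t 1 (fun t => cos (t * w)) (- w * sin (t * w)).
  by apply: is_derive_eq; rewrite /GRing.scale /=; ring.
have ds (t : R) : is_derive t 1 (fun t => sin (t * w)) (w * cos (t * w)).
  by apply: is_derive_eq; rewrite /GRing.scale /=; ring.
have cp (p : {poly R}) (t : R) := is_derive_poly p t.
have cc (p : {poly R}) : continuous (fun t : R => p.[t] * cos (t * w)).
  by apply: derivable_cont => t; have := dc t; have := cp p t => ? ?; apply: ex_derive.
have cs (p : {poly R}) : continuous (fun t : R => p.[t] * sin (t * w)).
  by apply: derivable_cont => t; have := ds t; have := cp p t => ? ?; apply: ex_derive.
have ic p := itv_integrable (cc p); have is_ p := itv_integrable (cs p).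
have mab : measurable (`[al, be] : set (measurableTypeR R)) by [].
pose u1 t := P^`().[t] * sin (t * w) + w * (P.[t] * cos (t * w)).
pose u2 t := P^`().[t] * cos (t * w) - w * (P.[t] * sin (t * w)).
have d1 (t : R) : is_derive t 1 (fun t => P.[t] * sin (t * w)) (u1 t).
  have := ds t; have := cp P t => ? ?.
  by apply: is_derive_eq; rewrite /u1 /GRing.scale /=; ring.
have d2 (t : R) : is_derive t 1 (fun t => P.[t] * cos (t * w)) (u2 t).
  have := dc t; have := cp P t => ? ?.
  by apply: is_derive_eq; rewrite /u2 /GRing.scale /=; ring.
have c1 : continuous u1.
  by move=> t; apply: cvgD; [exact: cs|apply: cvgMr; exact: cc].
have c2 : continuous u2.
  by move=> t; apply: cvgB; [exact: cc|apply: cvgMr; exact: cs].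
have E1 := Rintegral_is_derive ab d1 c1; have E2 := Rintegral_is_derive ab d2 c2.
rewrite Pa Pb !mul0r subrr in E1 E2.
have iz f : leb.-integrable `[al, be] (EFin \o f) ->
    leb.-integrable `[al, be] (EFin \o (fun t => w * f t)).
  by move=> fi; have := integrableZl mab w fi; apply: eq_integrable.
rewrite RintegralD// ?RintegralZl// in E1; last by apply: iz.
rewrite RintegralB// ?RintegralZl// in E2; last by apply: iz.
by split; lra.
Qed.

(** Each integration by parts gains a factor [w] and uses up one of the [n] zeros
   of [q ^+ n] at either end, which is what kills the boundary terms. *)
Lemma oscillatory_decay n (Q : {poly R}) : exists C : R, forall w : R,
  `|w| ^+ n * `|\int[leb]_(t in `[al, be]) ((Q * q ^+ n).[t] * cos (t * w))|%R <= C /\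
  `|w| ^+ n * `|\int[leb]_(t in `[al, be]) ((Q * q ^+ n).[t] * sin (t * w))|%R <= C.
Proof.
elim: n Q => [|n IH] Q.
  exists (\int[leb]_(t in `[al, be]) `|Q.[t]|)%R => w.
  have mab : measurable (`[al, be] : set (measurableTypeR R)) by [].
  have cQ : continuous (fun t : R => Q.[t]) by exact: continuous_horner.
  have key (g : R -> R) : continuous g -> (forall t, `|g t| <= 1) ->
      `|\int[leb]_(t in `[al, be]) (Q.[t] * g t)|%R <=
      (\int[leb]_(t in `[al, be]) `|Q.[t]|)%R.
    move=> cg g1; have cQg : continuous (fun t : R => Q.[t] * g t).
      by move=> t; apply: cvgM; [exact: cQ|exact: cg].
    have cn (h : R -> R) : continuous h -> continuous (fun t => `|h t|).
      by move=> ch t; apply: continuous_comp; [exact: ch|exact: norm_continuous].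
    rewrite (le_trans (le_normr_Rintegral _ _))//; first exact: itv_integrable.
    apply: le_Rintegral => //.
    - by apply: itv_integrable; exact: cn.
    - by apply: itv_integrable; exact: cn.
    - by move=> t _; rewrite normrM ler_piMr.
  have c_lin (t : R) : (fun t => t * w) s @[s --> t] --> t * w.
    by apply: cvgMl; exact: cvg_id.
  rewrite !expr0 !mul1r !mulr1; split; apply: key => t.
  - by apply: continuous_comp; [exact: c_lin|exact: continuous_cos].
  - exact: norm_cos_le1.
  - by apply: continuous_comp; [exact: c_lin|exact: continuous_sin].
  - exact: norm_sin_le1.
have [C HC] := IH (Q^`() * q + Q * q^`() *+ n.+1).
exists C => w; have [Hc Hs] := HC w.
have D : (Q * q ^+ n.+1)^`() = (Q^`() * q + Q * q^`() *+ n.+1) * q ^+ n.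
  exact: deriv_mul_exp.
have [|| Ec Es] := @cos_sin_ibp (Q * q ^+ n.+1) w.
- by rewrite hornerM horner_exp q0 expr0n mulr0.
- by rewrite hornerM horner_exp q1 expr0n mulr0.
rewrite D in Ec Es.
split; rewrite exprSr -mulrA -normrM ?Ec ?Es ?normrN//.
Qed.

(** A bump that is a polynomial on its support [`[al, be]], so that integrations by
   parts are derivations of polynomials. *)
Definition hump n (t : R) : R := Num.max 0 ((t - al) * (be - t)) ^+ n.

Lemma continuous_hump n : continuous (hump n).
Proof.
move=> t; rewrite /hump; apply: (@continuous_comp _ _ _
  (fun t => Num.max 0 ((t - al) * (be - t))) (fun u => u ^+ n)); last exact: exprn_continuous.
apply: continuous_max; first exact: cvg_cst.
by apply: cvgM; apply: cvgB => //; exact: cvg_cst.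
Qed.

Lemma hump_out n t : (0 < n)%N -> t \notin `[al, be] -> hump n t = 0.
Proof.
move=> n0 tab; rewrite /hump max_l ?expr0n ?gtn_eqF//.
move: tab; rewrite in_itv/= negb_and -!ltNge => /orP[h|h].
  by rewrite nmulr_rle0 ?subr_lt0// subr_ge0 ltW// (lt_trans h).
by rewrite pmulr_rle0 ?subr_le0 ?subr_gt0 ?(lt_trans _ h)// ltW.
Qed.

Lemma hump_in n t : t \in `[al, be] -> hump n t = (1 * q ^+ n).[t].
Proof.
rewrite in_itv/= => /andP[h h']; rewrite /hump mul1r horner_exp /q !hornerE.
by rewrite max_r// mulr_ge0 ?subr_ge0.
Qed.

Lemma hump_gt0 n t : al < t < be -> 0 < hump n t.
Proof.
move=> /andP[h h']; rewrite /hump exprn_gt0// lt_max; apply/orP; right.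
by rewrite mulr_gt0 ?subr_gt0.
Qed.

Lemma Rintegral_hump n (g : R -> R) : (0 < n)%N ->
  (\int[leb]_t (hump n t * g t) =
   \int[leb]_(t in `[al, be]) ((1 * q ^+ n).[t] * g t))%R.
Proof.
move=> n0; rewrite [RHS]Rintegral_mkcond; apply: eq_Rintegral => t _.
rewrite patchE; case: ifPn => [|tab]; first by rewrite inE/= => tab; rewrite hump_in.
by rewrite hump_out ?mul0r//; apply: contra tab; rewrite inE.
Qed.

Lemma integrable_hump n : (0 < n)%N -> leb.-integrable setT (EFin \o hump n).
Proof.
move=> n0.
have mab : measurable (`[al, be] : set (measurableTypeR R)) by [].
have := itv_integrable (@continuous_hump n).
rewrite (integrable_mkcond _ mab); apply: eq_integrable => // t _.
rewrite patchE; case: ifPn => // tab; rewrite /= hump_out//.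
by apply: contra tab; rewrite inE.
Qed.

Lemma hump_decay n : (0 < n)%N -> exists2 C : R, 0 < C &
  forall w, sqnormc (osc1 (hump n) w) <= C * (1 + w ^+ 2) ^- n.
Proof.
move=> n0; have [C HC] := oscillatory_decay n 1.
pose B := (\int[leb]_t `|hump n t|)%R.
have B0 : 0 <= B by apply: Rintegral_ge0.
have ib := integrable_hump n0.
have mb : measurable_fun setT (hump n) by exact: integrable_mfun ib.
have osc_le w : `|complex.Re (osc1 (hump n) w)| <= B /\
    `|complex.Im (osc1 (hump n) w)| <= B.
  have in_ : leb.-integrable setT (EFin \o (fun t => `|hump n t|)) := integrable_norm ib.
  split; apply: (@norm_RintegralT _ _ _ leb _ (fun t => `|hump n t|)) => //.
  - apply: measurable_funM => //; apply: (measurableT_comp (@measurable_cos R)).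
    exact: measurable_funM.
  - by move=> t; rewrite normrM ler_piMr// norm_cos_le1.
  - apply: measurable_funM => //; apply: (measurableT_comp (@measurable_sin R)).
    exact: measurable_funM.
  - by move=> t; rewrite normrM ler_piMr// norm_sin_le1.
pose E := 2 ^+ n * (2 * B ^+ 2 + 2 * C ^+ 2) + 1.
exists E.
  have S0 : 0 <= 2 * B ^+ 2 + 2 * C ^+ 2 by have := sqr_ge0 B; have := sqr_ge0 C; lra.
  by rewrite ltr_pwDr// mulr_ge0// exprn_ge0.
move=> w; have [b1 b2] := osc_le w; have [h1 h2] := HC w.
have w0 : 0 < 1 + w ^+ 2 by rewrite ltr_pwDl// sqr_ge0.
rewrite ler_pdivlMr ?exprn_gt0//.
move: b1 b2 h1 h2; rewrite -!Rintegral_hump// => b1 b2 h1 h2.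
rewrite -[(\int[leb]_t (hump n t * cos (t * w)))%R]/(complex.Re (osc1 (hump n) w)) in h1.
rewrite -[(\int[leb]_t (hump n t * sin (t * w)))%R]/(complex.Im (osc1 (hump n) w)) in h2.
rewrite /sqnormc -(real_normK (num_real (complex.Re _))) -(real_normK (num_real (complex.Im _))).
move: (`|complex.Re _|) (`|complex.Im _|) (normr_ge0 (complex.Re (osc1 (hump n) w)))
  (normr_ge0 (complex.Im (osc1 (hump n) w))) b1 b2 h1 h2 => p r p0 r0 b1 b2 h1 h2.
have key : (1 + w ^+ 2) ^+ n <= 2 ^+ n * (1 + (`|w| ^+ n) ^+ 2).
  rewrite -exprM mulnC exprM real_normK ?num_real//.
  have [w1|w1] := leP (w ^+ 2) 1.
    apply: (@le_trans _ _ (2 ^+ n)).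
      by rewrite lerXn2r ?nnegrE ?(ltW w0)//; lra.
    by rewrite ler_peMr ?exprn_ge0// lerDl exprn_ge0// sqr_ge0.
  apply: (@le_trans _ _ ((2 * w ^+ 2) ^+ n)).
    have w2 : 0 <= 2 * w ^+ 2 by lra.
    by apply: lerXn2r; rewrite ?nnegrE ?(ltW w0)//; lra.
  by rewrite exprMn ler_wpM2l ?exprn_ge0// lerDr.
have s0 : 0 <= p ^+ 2 + r ^+ 2 by rewrite addr_ge0 ?sqr_ge0.
apply: (le_trans (ler_wpM2l s0 key)).
rewrite /E mulrCA.
apply: (@le_trans _ _ (2 ^+ n * (2 * B ^+ 2 + 2 * C ^+ 2))); last by rewrite lerDl.
rewrite ler_wpM2l ?exprn_ge0//.
have W0 : 0 <= `|w| ^+ n by rewrite exprn_ge0.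
have sq (x y : R) : 0 <= x -> x <= y -> x ^+ 2 <= y ^+ 2.
  by move=> x0 xy; rewrite lerXn2r ?nnegrE// (le_trans x0).
have := sq _ _ p0 b1; have := sq _ _ r0 b2.
have := sq _ _ (mulr_ge0 W0 p0) h1; have := sq _ _ (mulr_ge0 W0 r0) h2.
rewrite !(exprMn _ (`|w| ^+ n)) mulrDr mulr1 mulrDl.
rewrite (mulrC (p ^+ 2)) (mulrC (r ^+ 2)).
by lra.
Qed.

End hump.

(** * Lower bound for the power function *)
Section lower.
Context (R : realType) (d : nat).
Local Notation mu := (lebesgue_rV R d).
Local Notation leb := (@lebesgue_measure R).
Local Notation kappa := (twopi_factor R d).
Implicit Types (x y w : 'rV[R]_d) (f : 'rV[R]_d -> R).
Implicit Types (X : {fset 'rV[R]_d}) (Omega : set 'rV[R]_d).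

Definition humpd n (delta : R) x : 'rV[R]_d -> R :=
  tensor (fun i => hump (x ord0 i - delta) (x ord0 i + delta) n).

Lemma bracket_le_prod w : bracket w <= \prod_i (1 + w ord0 i ^+ 2).
Proof.
rewrite /bracket /dot.
suff H (r : seq 'I_d) : 1 + \sum_(i <- r) w ord0 i * w ord0 i <=
    \prod_(i <- r) (1 + w ord0 i ^+ 2) by exact: H.
elim: r => [|i r IH]; first by rewrite !big_nil addr0.
rewrite !big_cons mulrDl mul1r addrCA addrC; apply: lerD => //.
rewrite -expr2 ler_peMr ?sqr_ge0// (le_trans _ IH)// lerDl.
by apply: sumr_ge0 => j _; rewrite -expr2 sqr_ge0.
Qed.

Section humpd.
Variables (n : nat) (delta : R) (x : 'rV[R]_d).
Hypotheses (n0 : (0 < n)%N) (delta0 : 0 < delta).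
Let h := humpd n delta x.

Let ab i : x ord0 i - delta < x ord0 i + delta.
Proof. by rewrite ltrD2l gtrN. Qed.

Lemma continuous_humpd : continuous h.
Proof.
have cM : continuous (fun x : R * R => x.1 * x.2) by exact: mul_continuous.
apply: (continuous_big cM) => i _ y.
apply: (@continuous_comp _ _ _ (fun v : 'rV[R]_d => v ord0 i)
  (hump (x ord0 i - delta) (x ord0 i + delta) n)).
  exact: coord_continuous.
exact: continuous_hump.
Qed.

Lemma integrable_humpd : mu.-integrable setT (EFin \o h).
Proof. by apply: integrable_tensor => i; exact: integrable_hump. Qed.

Lemma sqr_humpd y : h y ^+ 2 = humpd (n * 2) delta x y.
Proof.
rewrite /h /humpd /tensor -prodrXl; apply: eq_bigr => i _.
by rewrite /hump exprM.
Qed.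

Lemma humpd_center : 0 < h x.
Proof. by apply: prodr_gt0 => i _; apply: hump_gt0; rewrite gtrBl ltrDl delta0. Qed.

Lemma humpd_out y : ~ ball x delta y -> h y = 0.
Proof.
move=> nb; have [i Hi] : exists i, delta <= `|x ord0 i - y ord0 i|.
  apply: contrapT => /forallNP H; apply: nb; split => // i j.
  by rewrite ord1; have /negP := H j; rewrite -ltNge.
rewrite /h /humpd /tensor (bigD1 i)//=.
have -> : hump (x ord0 i - delta) (x ord0 i + delta) n (y ord0 i) = 0.
  rewrite /hump max_l ?expr0n ?gtn_eqF//.
  have -> : (y ord0 i - (x ord0 i - delta)) * (x ord0 i + delta - y ord0 i) =
      delta ^+ 2 - (x ord0 i - y ord0 i) ^+ 2 by ring.
  rewrite subr_le0 -(real_normK (num_real (_ - _))) lerXn2r ?nnegrE ?(ltW delta0)//.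
by rewrite mul0r.
Qed.

Lemma fourier_humpd_decay : exists2 C : R, 0 < C &
  forall w, sqnormc (fourier_L1 h w) <= C * bracket w ^- n.
Proof.
have /choice[C HC] : forall i : 'I_d, exists C : R, 0 < C /\
    forall u : R, sqnormc (osc1 (hump (x ord0 i - delta) (x ord0 i + delta) n) u) <=
      C * (1 + u ^+ 2) ^- n.
  by move=> i; have [C C0 H] := hump_decay (ab i) n0; exists C.
exists (kappa ^+ 2 * \prod_i C i).
  rewrite mulr_gt0 ?exprn_gt0 ?twopi_factor_gt0//.
  by apply: prodr_gt0 => i _; have [] := HC i.
move=> w.
have -> : sqnormc (fourier_L1 h w) = kappa ^+ 2 * sqnormc (osc mu h w).
  by rewrite /sqnormc /fourier_L1 /osc /=; ring.
rewrite -mulrA ler_wpM2l ?sqr_ge0//.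
have sqM (a b : R[i]) : sqnormc (a * b) = sqnormc a * sqnormc b.
  by case: a => a a'; case: b => b b'; rewrite /sqnormc /=; ring.
rewrite /h /humpd osc_tensor; last by move=> i; exact: integrable_hump.
have -> (F : 'I_d -> R[i]) : sqnormc (\prod_i F i) = \prod_i sqnormc (F i).
  apply: (big_morph _ sqM); by rewrite /sqnormc /= expr1n expr0n addr0.
apply: (@le_trans _ _ (\prod_i (C i * (1 + w ord0 i ^+ 2) ^- n))).
  by apply: ler_prod => i _; rewrite sqnormc_ge0; have [_ ->] := HC i.
rewrite big_split/= ler_wpM2l//.
  by apply: prodr_ge0 => i _; have [/ltW] := HC i.
rewrite prodfV prodrXl lef_pV2 ?posrE ?exprn_gt0 ?bracket_gt0//.
  rewrite lerXn2r ?nnegrE ?bracket_le_prod ?(ltW (bracket_gt0 _))//.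
  by apply: prodr_ge0 => i _; rewrite addr_ge0 ?sqr_ge0.
by apply: prodr_gt0 => i _; rewrite ltr_pwDl ?sqr_ge0.
Qed.

End humpd.

Variable K : ti_kernel R d.
Variables (s c0 c1 : R).
Hypothesis mK : measurable_fun setT (khat K).
Hypothesis Kp : forall w, 0 < khat K w.
Hypothesis Kc : comparable_kernel K s c0 c1.
Hypothesis d0 : (0 < d)%N.
Hypothesis ds : d%:R < 2 * s.

Let s0 : 0 < s.
Proof. by have : 0 < 2 * s by [apply: le_lt_trans ds]; lra. Qed.

Lemma native_hump x (delta : R) : 0 < delta -> exists h : 'rV[R]_d -> R,
  [/\ continuous h, mu.-integrable setT (EFin \o h) /\
      mu.-integrable setT (EFin \o (fun y => h y ^+ 2)),
      0 < h x, forall y, ~ ball x delta y -> h y = 0 &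
      mu.-integrable setT (EFin \o (fun w => sqnormc (fourier_L1 h w) / khat K w))].
Proof.
move=> delta0; have [c00 c10 Kb] := Kc.
(* A squared transform of order [n > 2 * s] still decays like [bracket `^ (- s)]
   after division by [khat K]. *)
pose n := (Num.truncn (2 * s)).+1.
have nge : 2 * s < n%:R by exact: truncnS_gt.
exists (humpd n delta x); split.
- exact: continuous_humpd.
- split; first exact: integrable_humpd.
  have := @integrable_humpd (n * 2) delta x isT delta0.
  by apply: integrable_congr => y; rewrite sqr_humpd.
- exact: humpd_center.
- exact: humpd_out.
have ih := @integrable_humpd n delta x isT delta0.
have [C C0 HC] := @fourier_humpd_decay n delta x isT delta0.
have [Re_m Im_m] := cmeasurable_fourier_L1 ih.
apply: (@dominated_integrable _ _ _ mu _ (fun w => C / c0 * bracket w `^ (- s))).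
- apply: measurable_funM; first exact: measurable_sqnormc.
  exact: measurable_inv_gt0.
- move=> w; rewrite ger0_norm ?divr_ge0 ?sqnormc_ge0 ?(ltW (Kp _))//.
  have B0 := bracket_gt0 w; have [k0 _] := Kb w.
  rewrite ler_pdivrMr//; apply: (le_trans (HC w)).
  apply: (@le_trans _ _ (C / c0 * bracket w `^ (- s) * (c0 * bracket w `^ (- s)))); last first.
    by rewrite ler_wpM2l// mulr_ge0 ?powR_ge0// divr_ge0// ltW.
  rewrite [leRHS](_ : _ = C * (bracket w `^ (- s) * bracket w `^ (- s))); last first.
    by field; rewrite gt_eqF.
  rewrite ler_wpM2l ?(ltW C0)// -powRD; last by rewrite (gt_eqF B0) implybT.
  rewrite -powR_invn ?(ltW B0)//; apply: ler_powR; first exact: bracket_ge1.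
  by rewrite -opprD lerN2 ltW// (le_lt_trans _ nge)//; lra.
- by apply: integrable_mulZl; exact: integrable_bracketN.
Qed.

(** A bump around [x] that vanishes on [X] does not see the coefficients: its value
   at [x], after normalisation in the scaled native space, bounds from below the
   dual norm of every functional in the infimum. *)
Lemma power_scale_ge X x (delta : R) : 0 < delta ->
  (forall y, y \in X -> ~ ball x delta y) ->
  exists2 c : R, 0 < c & forall e, 0 < e -> e <= 1 ->
  ((c * e `^ ((2 * s - d%:R) / 2))%:E <= power_function (scale_kernel e K) X x)%E.
Proof.
move=> delta0 HX; have [c00 c10 _] := Kc.
have [h [ch [ih ih2] hx hout iF]] := native_hump x delta0.
pose H := kappa * (\int[mu]_w (sqnormc (fourier_L1 h w) / khat K w))%R.
have H0 : 0 <= H.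
  rewrite mulr_ge0 ?(ltW (twopi_factor_gt0 _ _))//; apply: Rintegral_ge0 => w _.
  by rewrite divr_ge0 ?sqnormc_ge0// ltW.
pose B := Num.sqrt (c1 / c0 * H + 1).
have BB : 0 < c1 / c0 * H + 1 by rewrite ltr_pwDr// mulr_ge0// divr_ge0// ltW.
have B0 : 0 < B by rewrite sqrtr_gt0.
exists (h x / B); first by rewrite divr_gt0.
move=> e e0 e1.
have [t [tE t0]] : exists t, t = e `^ ((2 * s - d%:R) / 2) / B /\ 0 < t.
  by eexists; split; [reflexivity|rewrite divr_gt0// powR_gt0].
pose th y := t * h y.
have ith : mu.-integrable setT (EFin \o th) by exact: integrable_mulZl.
have ith2 : mu.-integrable setT (EFin \o (fun y => th y ^+ 2)).
  have := integrable_mulZl (t ^+ 2) ih2.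
  by apply: integrable_congr => y; rewrite /th exprMn.
have Fth := is_fourier_L1 ith ith2.
have eF : exists g, is_fourier th g by exists (fourier_L1 th).
have EK : native_sqnorm K th = (t ^+ 2 * H)%:E.
  rewrite /native_sqnorm.
  rewrite (eq_fourier_integral (fourierP eF) Fth); last 2 first.
  - exact: measurable_inv_gt0.
  - by move=> w; rewrite invr_ge0 ltW.
  rewrite (eq_integral (fun w => (t ^+ 2 * (sqnormc (fourier_L1 h w) / khat K w))%:E)).
    rewrite RintegralE; last exact: integrable_mulZl.
    by rewrite RintegralZT// -EFinM mulrCA.
  move=> w _; by rewrite fourier_L1Z// mulrA.
have le1 : (native_sqnorm (scale_kernel e K) th <= 1)%E.
  apply: (@le_trans _ _ ((c1 / c0 * e `^ (d%:R - 2 * s) * 1)%:E * native_sqnorm K th)%E).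
    apply: (native_sqnorm_scale_le (c0 := c0) (s := s)) => //.
    move=> w; rewrite mul1r; apply: ge0_ler_powR.
    - exact: ltW.
    - by rewrite nnegrE addr_ge0 ?sqr_ge0 ?dot_ge0.
    - by rewrite nnegrE (ltW (bracket_gt0 _)).
    - by rewrite /bracket lerD2r expr_le1 ?(ltW e0).
  rewrite EK -EFinM lee_fin tE expr_div_n sqr_sqrtr ?(ltW BB)//.
  have -> : (e `^ ((2 * s - d%:R) / 2)) ^+ 2 = e `^ (2 * s - d%:R).
    by rewrite -powR_mulrn ?powR_ge0// -powRrM; congr (_ `^ _); by field.
  have -> : e `^ (d%:R - 2 * s) = (e `^ (2 * s - d%:R))^-1 by rewrite -powRN opprB.
  have Ep : 0 < e `^ (2 * s - d%:R) by rewrite powR_gt0.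
  have cc0 : 0 <= c1 / c0 by rewrite divr_ge0// ltW.
  move: (e `^ _) Ep (c1 / c0) BB cc0 => E E0 c BB cc0.
  rewrite [leLHS](_ : _ = (c * H) / (c * H + 1)); last first.
    field. by rewrite !gt_eqF.
  by rewrite ler_pdivrMr// mul1r lerDl.
have thN : native_space (scale_kernel e K) th.
  split => //; last by apply: le_lt_trans le1 _; rewrite ltry.
  by move=> y; apply: (continuous_comp (ch y)); exact: mulrl_continuous.
apply: le_ereal_inf_tmp => _ [a _ <-].
apply: ereal_sup_ubound => /=; exists th.
  split => //; rewrite /native_norm.
  have E : sqrte 1%E = 1%E :> \bar R by rewrite /= sqrtr1.
  by rewrite -[X in (_ <= X)%E]E lee_sqrt.
rewrite big1 ?subr0; last first.
  move=> y _; rewrite /th hout ?mulr0//; apply: HX; exact: valP.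
rewrite ger0_norm ?mulr_ge0 ?(ltW t0) ?(ltW hx)//.
by congr EFin; rewrite /th tE; ring.
Qed.

End lower.

(** * The flat limit *)
Section flat_limit.
Context (R : realType) (d : nat).
Local Notation mu := (lebesgue_rV R d).
Local Notation kappa := (twopi_factor R d).
Implicit Types (x y w : 'rV[R]_d) (f : 'rV[R]_d -> R).
Implicit Types (X : {fset 'rV[R]_d}) (Omega : set 'rV[R]_d).

(** Along the diagonal through a point [p] of [Omega], the first coordinate takes
   infinitely many values, of which only finitely many occur on [X]. *)
Lemma exists_separated_point X Omega : (0 < d)%N -> open Omega -> Omega !=set0 ->
  exists x (delta : R), [/\ Omega x, 0 < delta & forall y, y \in X -> ~ ball x delta y].
Proof.
move=> d0 oO [p Op]; pose i0 := Ordinal d0.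
have /nbhs_ballP[r /= r0 rO] := oO _ Op.
pose c y : R := y ord0 i0 - p ord0 i0.
pose m := \big[Num.min/r]_(y <- X | 0 < c y) c y.
have m0 : 0 < m by apply: (@big_ind R (fun z => 0 < z)) => // a b a0 b0; rewrite lt_min a0.
have mr : m <= r by exact: bigmin_le_id.
pose t := m / 2; have t0 : 0 < t by rewrite divr_gt0.
have tm : t < m by rewrite ltr_pdivrMr// ltr_pMr// ltr1n.
have tc y : y \in X -> t != c y.
  move=> yX; apply/eqP => tcy; have cy : 0 < c y by rewrite -tcy.
  have : m <= c y by exact: ge_bigmin_seq.
  by rewrite -tcy leNgt tm.
pose x : 'rV[R]_d := \row_i (p ord0 i + t).
exists x, (\big[Num.min/1]_(y <- X) `|t - c y|); split.
- apply: rO; split => // i j; rewrite /ball/= ord1 mxE opprD addrA subrr add0r normrN.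
  by rewrite gtr0_norm// (lt_le_trans tm).
- rewrite big_seq; apply: (@big_ind R (fun z => 0 < z)) => // [a b a0 b0|y yX].
    by rewrite lt_min a0.
  by rewrite normr_gt0 subr_eq0 tc.
move=> y yX [_ /(_ ord0 i0)]; rewrite /ball/= mxE.
apply/negP; rewrite -leNgt; apply: (@le_trans _ _ `|t - c y|).
  exact: ge_bigmin_seq.
by rewrite /c opprB addrA (addrC t).
Qed.

Lemma sqrte_le (y : \bar R) (b : R) : 0 <= b -> (y <= (b ^+ 2)%:E)%E ->
  (sqrte y <= b%:E)%E.
Proof.
move=> b0 yb; have -> : b%:E = sqrte (b ^+ 2)%:E by rewrite /= sqrtr_sqr ger0_norm.
by rewrite lee_sqrt// lee_fin sqr_ge0.
Qed.

Section bounds.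
Variable K : ti_kernel R d.
Variables (s c0 c1 : R).
Hypothesis mK : measurable_fun setT (khat K).
Hypothesis Kp : forall w, 0 < khat K w.
Hypothesis Kc : comparable_kernel K s c0 c1.
Hypothesis d0 : (0 < d)%N.
Hypothesis ds : d%:R < 2 * s.

Let s0 : 0 < s.
Proof. by have : 0 < 2 * s by [apply: le_lt_trans ds]; lra. Qed.

(** With [l] the integer part of [s], the defect vanishes to the order
   [2 * l.+1 >= 2 * s] at the origin, so that it absorbs the singular weight
   [(e ^+ 2 + dot w w) `^ (- s)] uniformly in [e]. *)
Lemma power_flat_limit Omega : open Omega -> Omega !=set0 -> bounded_set Omega ->
  exists2 h0 : R, 0 < h0 & forall X, (fill_distance X Omega <= h0%:E)%E ->
  [set` X] `<=` Omega ->
  exists2 C : R, 0 < C & forall e x, 0 < e -> e <= 1 -> Omega x ->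
  (power_function (scale_kernel e K) X x <=
    (C * e `^ ((2 * s - d%:R) / 2))%:E)%E.
Proof.
move=> oO nO bO; pose l := Num.truncn s.
have sl : s <= l.+1%:R by rewrite ltW// truncnS_gt.
have [h0 h00 Hrep] := polynomial_reproduction l oO nO bO.
exists h0 => // X HX XO; have [A A0 HA] := Hrep X HX.
have [rho rho1 Hrho] := bounded_set_coord bO.
have rho0 : 0 <= rho by exact: le_trans rho1.
pose N := 2 * (1 + A) ^+ 2.
have N0 : 0 <= N by rewrite mulr_ge0 ?sqr_ge0.
pose D := (d%:R * rho) ^+ (2 * l.+1).
have D1 : 1 <= D.
  by rewrite exprn_ege1// -[leLHS]mulr1 ler_pM// ler1n.
have ND0 : 0 <= N * D by rewrite mulr_ge0// (le_trans _ D1).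
pose I := (\int[mu]_w (bracket w `^ (- s)))%R.
have I0 : 0 <= I by apply: Rintegral_ge0 => w _; exact: powR_ge0.
have [_ c10 _] := Kc.
have M0 : 0 <= N * D * 2 `^ s by rewrite mulr_ge0// powR_ge0.
exists (Num.sqrt (kappa * c1 * (N * D * 2 `^ s) * I + 1)).
  rewrite sqrtr_gt0 ltr_pwDr// mulr_ge0// mulr_ge0// mulr_ge0 ?(ltW c10)//.
  exact: ltW (twopi_factor_gt0 _ _).
move=> e x e0 e1 Ox; have [a aA rep] := HA x Ox.
apply: (power_scale_le mK Kp Kc d0 ds (a := a) e0 M0) => w.
have q0 := dot_ge0 w; set q := dot w w.
have e20 : 0 < e ^+ 2 by rewrite exprn_gt0.
have qe0 : 0 < e ^+ 2 + q by rewrite ltr_pwDl.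
have B0 := bracket_gt0 w.
have dN : defect a x w <= N * D.
  by rewrite (le_trans (defect_le_cst x w aA))// ler_peMr.
have dq : defect a x w <= N * D * q ^+ l.+1.
  apply: (defect_le_pow rho0) => //.
  - by move=> i; exact: Hrho.
  - by move=> y i; apply: Hrho; apply: XO; exact: valP.
  - by move=> p; exact: rep.
rewrite !powRN ler_pdivlMr ?powR_gt0// mulrAC ler_pdivrMr ?powR_gt0//.
have [q1|q1] := leP 1 q.
  rewrite -[leRHS]mulrA; apply: ler_pM; rewrite ?defect_ge0 ?powR_ge0//.
  rewrite -powRM ?(ltW qe0)//; apply: ge0_ler_powR; rewrite ?nnegrE ?(ltW s0) ?(ltW B0)//.
    by rewrite mulr_ge0 ?(ltW qe0).
  by rewrite /bracket -/q; lra.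
rewrite [leRHS]mulrAC; apply: ler_pM; rewrite ?powR_ge0 ?defect_ge0//; last first.
  apply: ge0_ler_powR; rewrite ?nnegrE ?(ltW s0) ?(ltW B0)//.
  by rewrite /bracket -/q; lra.
apply: (le_trans dq); rewrite ler_wpM2l// -powR_mulrn//.
have [->|qn0] := eqVneq q 0; first by rewrite powR0 ?powR_ge0// pnatr_eq0.
have qp : 0 < q by rewrite lt_neqAle eq_sym qn0.
apply: (@le_trans _ _ (q `^ s)); first by rewrite ger_powR// qp ltW.
by apply: ge0_ler_powR; rewrite ?nnegrE ?(ltW s0) ?(ltW qe0)// lerDr ltW.
Qed.

Lemma native_norm_scale_le f e t : 0 < e -> 0 <= t -> native_space K f ->
  (forall w, (e ^+ 2 + dot w w) `^ s <= t * bracket w `^ s) ->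
  (native_norm (scale_kernel e K) f <=
    (Num.sqrt (c1 / c0 * t * fine (native_sqnorm K f)) * e `^ ((d%:R - 2 * s) / 2))%:E)%E.
Proof.
move=> e0 t0 [_ ff fin] H; have [c00 c10 _] := Kc.
have n0 := native_sqnorm_ge0 f Kp.
have nf : native_sqnorm K f \is a fin_num by rewrite ge0_fin_numE.
have fn0 : 0 <= fine (native_sqnorm K f) by exact: fine_ge0.
have A0 : 0 <= c1 / c0 * t * fine (native_sqnorm K f).
  by rewrite !mulr_ge0 ?invr_ge0// ltW.
apply: sqrte_le; first by rewrite mulr_ge0 ?sqrtr_ge0 ?powR_ge0.
apply: (le_trans (native_sqnorm_scale_le mK Kp Kc e0 t0 ff H)).
rewrite -[X in (_ * X)%E](fineK nf) -EFinM lee_fin exprMn sqr_sqrtr//.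
have -> : (e `^ ((d%:R - 2 * s) / 2)) ^+ 2 = e `^ (d%:R - 2 * s).
  by rewrite -powR_mulrn ?powR_ge0// -powRrM; congr (_ `^ _); by field.
by rewrite le_eqVlt; apply/orP; left; apply/eqP; ring.
Qed.

Lemma native_norm_ge0 e f : (0 <= native_norm (scale_kernel e K) f)%E.
Proof. exact: sqrte_ge0. Qed.

Lemma error_bound_le X Omega f e (P N : R) : 0 <= P ->
  (forall x, Omega x -> (power_function (scale_kernel e K) X x <= P%:E)%E) ->
  (native_norm (scale_kernel e K) f <= N%:E)%E ->
  (error_bound K X Omega f e <= (P * N)%:E)%E.
Proof.
move=> P0 HP HN; apply: ge_ereal_sup => _ [x Ox <-].
apply: (@le_trans _ _ (P%:E * native_norm (scale_kernel e K) f)%E).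
  by rewrite lee_wpmul2r ?native_norm_ge0 ?HP.
by rewrite EFinM lee_wpmul2l ?lee_fin.
Qed.

End bounds.
End flat_limit.

(** * Sobolev spaces *)
Section sobolev.
Context (R : realType) (d : nat).
Local Notation mu := (lebesgue_rV R d).
Local Notation kappa := (twopi_factor R d).
Implicit Types (x y w : 'rV[R]_d) (f : 'rV[R]_d -> R).

(** The inverse of the scaled transform is [e ^+ d * (1 + |w|^2 / e^2) ^+ m]; the
   binomial theorem applies under the integral. *)
Lemma sobolev_expansionE (K : ti_kernel R d) m f e : 0 < e ->
  (forall w, khat K w = (1 + enorm w ^+ 2) ^- m) ->
  (exists g, is_fourier f g) ->
  (sobolev_expansion m f e =
   (e `^ (2 * m%:R - d%:R))%:E * native_sqnorm (scale_kernel e K) f)%E.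
Proof.
move=> e0 kE /fourierP[_ mr mi _]; set g := fourier f.
have ms : measurable_fun setT (fun w => sqnormc (g w)) by exact: measurable_sqnormc.
have me (j : nat) : measurable_fun setT (fun w => enorm w ^+ (2 * j)).
  under eq_fun do rewrite exprM enorm_sqr.
  by apply: measurable_funX; exact: measurable_dot.
have k0 := twopi_factor_gt0 R d.
have c0 (j : nat) : 0 <= 'C(m, j)%:R * e ^- (2 * j) by rewrite mulr_ge0// invr_ge0 exprn_ge0// ltW.
have ptw w : sqnormc (g w) / khat (scale_kernel e K) w =
    e ^+ d * (\sum_(j < m.+1) 'C(m, j)%:R * e ^- (2 * j) *
      (sqnormc (g w) * enorm w ^+ (2 * j))).
  rewrite /= kE invfM !invrK enorm_sqr dotZ addrC.
  rewrite addrC exprDn mulrCA; congr (_ * _); rewrite mulr_sumr.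
  apply: eq_bigr => j _; rewrite expr1n mul1r -mulr_natl (exprM (enorm w)) enorm_sqr.
  rewrite exprMn (exprVn e 2) exprVn -exprM; ring.
have E : native_sqnorm (scale_kernel e K) f =
    ((e ^+ d)%:E * \sum_(j < m.+1) ('C(m, j)%:R * e ^- (2 * j))%:E *
                    sobolev_seminorm_sq j f)%E.
  rewrite /native_sqnorm -/g; under eq_integral do rewrite ptw.
  under eq_integral do rewrite EFinM -sumEFin.
  have sq0 j w : (0 <= ('C(m, j)%:R * e ^- (2 * j) *
      (sqnormc (g w) * enorm w ^+ (2 * j)))%:E)%E.
    by rewrite lee_fin mulr_ge0// mulr_ge0 ?sqnormc_ge0 ?exprn_ge0 ?enorm_ge0.
  have mj (j : nat) : measurable_fun setT (fun w => ('C(m, j)%:R * e ^- (2 * j) *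
      (sqnormc (g w) * enorm w ^+ (2 * j)))%:E).
    by apply/measurable_EFinP; apply: measurable_funM => //; exact: measurable_funM.
  rewrite ge0_integralZl//; last 3 first.
  - exact: emeasurable_sum.
  - by move=> w _; apply: sume_ge0 => j _; exact: sq0.
  - by rewrite lee_fin exprn_ge0// ltW.
  rewrite muleCA; congr (_ * _)%E.
  rewrite ge0_integral_sum//.
  rewrite ge0_sume_distrr; last first.
    by move=> j _; apply: integral_ge0 => w _; exact: sq0.
  apply: eq_bigr => j _; rewrite /sobolev_seminorm_sq -/g.
  under eq_integral do rewrite EFinM.
  rewrite ge0_integralZl//; last 3 first.
  - by apply/measurable_EFinP; exact: measurable_funM.
  - by move=> w _; rewrite lee_fin mulr_ge0 ?sqnormc_ge0 ?exprn_ge0 ?enorm_ge0.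
  - by rewrite lee_fin.
  by rewrite muleCA.
rewrite E /sobolev_expansion muleA -EFinM; congr (_%:E * _)%E.
rewrite powRB; last by rewrite (gt_eqF e0) implybT.
by rewrite -natrM !powR_mulrn ?(ltW e0)// divfK// expf_neq0// gt_eqF.
Qed.

End sobolev.

Unset Implicit Arguments.

Theorem theorem3 (R : realType) (d : nat) (K : ti_kernel R d)
    (Omega : set 'rV[R]_d) (C : R) :
  (0 < d)%N -> is_kernel K ->
  bounded_domain Omega -> interior_cone_condition Omega -> 0 < C ->
  (forall beta : R, d%:R < beta -> finite_smoothness K beta ->
    exists2 h0 : R, 0 < h0 &
    forall (F : set {fset 'rV[R]_d}) (X : {fset 'rV[R]_d}) (f : 'rV[R]_d -> R),
      asymptotically_uniformly_placed Omega C F -> F X ->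
      (fill_distance X Omega <= h0%:E)%E ->
      native_space K f -> f <> (fun=> 0) ->
      (exists M : R, \forall e \near 0^'+,
         (error_bound K X Omega f e <= M%:E)%E) /\
      (exists M : R, \forall e \near +oo,
         (error_bound K X Omega f e <= (M * e `^ beta)%:E)%E))
  /\
  (forall m : nat, (d < 2 * m)%N ->
    (forall w, khat K w = (1 + enorm w ^+ 2) ^- m) ->
    exists2 h0 : R, 0 < h0 &
    forall (F : set {fset 'rV[R]_d}) (X : {fset 'rV[R]_d}) (f : 'rV[R]_d -> R),
      asymptotically_uniformly_placed Omega C F -> F X ->
      (fill_distance X Omega <= h0%:E)%E ->
      native_space K f -> f <> (fun=> 0) ->
      exists c1 c2 : R, [/\ 0 < c1, 0 < c2 & \forall e \near 0^'+,
         (c1%:E * sobolev_expansion m f e <= error_bound K X Omega f e ^+ 2)%E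
         /\
         (error_bound K X Omega f e ^+ 2 <= c2%:E * sobolev_expansion m f e)%E]).
Proof.
move=> d0 [_ _ [_ mK _ _] cK Kp] [oO _ nO bO] _ _.
have {}mK : measurable_fun setT (khat K) by exact: mK.
have small (s e : R) (w : 'rV[R]_d) : 0 <= s -> 0 < e -> e <= 1 ->
    (e ^+ 2 + dot w w) `^ s <= 1 * bracket w `^ s.
  move=> s0 e0 e1; rewrite mul1r; apply: ge0_ler_powR => //.
  - by rewrite nnegrE addr_ge0 ?sqr_ge0 ?dot_ge0.
  - by rewrite nnegrE (ltW (bracket_gt0 _)).
  - by rewrite /bracket lerD2r expr_le1 ?(ltW e0).
split.
  move=> beta db fs.
  have b0 : 0 < beta by apply: le_lt_trans db.
  have [c0 [c1 Kc]] := finite_smoothness_comparable b0 cK Kp fs.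
  pose s := beta / 2.
  have s0 : 0 <= s by rewrite divr_ge0// ltW.
  have sE : 2 * s = beta by rewrite /s; field.
  have ds : d%:R < 2 * s by rewrite sE.
  have [c00 c10 _] := Kc.
  have [h0 h00 H] := power_flat_limit mK Kp Kc d0 ds oO nO bO.
  exists h0 => // F X f FX XF fill fK _.
  have XO : [set` X] `<=` Omega by have [] := FX X XF.
  have [A A0 HA] := H X fill XO.
  pose n := fine (native_sqnorm K f).
  split.
    exists (A * Num.sqrt (c1 / c0 * 1 * n)); near=> e.
    have e0 : 0 < e by near: e; exact: nbhs_right_gt.
    have e1 : e <= 1 by near: e; exact: nbhs_right_le.
    have HN := native_norm_scale_le mK Kp Kc e0 ler01 fK (fun w => small s e w s0 e0 e1).
    apply: (le_trans (error_bound_le _ (fun x Ox => HA e x e0 e1 Ox) HN)).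
      by rewrite mulr_ge0 ?powR_ge0 ?(ltW A0).
    rewrite lee_fin (_ : (d%:R - 2 * s) / 2 = - ((2 * s - d%:R) / 2)); last by field.
    rewrite powRN; have Ep : 0 < e `^ ((2 * s - d%:R) / 2) by rewrite powR_gt0.
    move: (e `^ _) Ep (Num.sqrt _) => E E0 N.
    by rewrite le_eqVlt; apply/orP; left; apply/eqP; field; rewrite gt_eqF.
  (* With zero coefficients the defect is 1, and [e ^+ 2 + dot w w] stays above the
     bracket. *)
  have [A' A'0 HA'] : exists2 A' : R, 0 <= A' & forall e x, 1 <= e ->
      (power_function (scale_kernel e K) X x <=
       (A' * e `^ ((2 * s - d%:R) / 2))%:E)%E.
    eexists; last first.
      move=> e x e1; apply: (power_scale_le mK Kp Kc d0 ds (a := [ffun=> 0]) _ ler01).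
        exact: lt_le_trans e1.
      move=> w; rewrite /defect !big1; [|by move=> y _; rewrite ffunE mul0r..].
      rewrite !subr0 cos2Dsin2 !mul1r !powRN lef_pV2 ?posrE ?powR_gt0 ?bracket_gt0//.
        apply: ge0_ler_powR; rewrite ?nnegrE ?(ltW (bracket_gt0 _)) ?addr_ge0 ?sqr_ge0 ?dot_ge0//.
        by rewrite /bracket lerD2r expr_ge1// (le_trans _ e1).
      by rewrite ltr_pwDl ?dot_ge0// exprn_gt0// (lt_le_trans _ e1).
    exact: sqrtr_ge0.
  exists (A' * Num.sqrt (c1 / c0 * n)); near=> e.
  have e1 : 1 <= e by near: e; apply: nbhs_pinfty_ge; exact: num_real.
  have e0 : 0 < e by exact: lt_le_trans e1.
  have t0 : 0 <= e `^ (2 * s) by exact: powR_ge0.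
  have Ht (w : 'rV[R]_d) : (e ^+ 2 + dot w w) `^ s <= e `^ (2 * s) * bracket w `^ s.
    have B0 := ltW (bracket_gt0 w).
    rewrite powRrM powR_mulrn ?(ltW e0)// -powRM ?sqr_ge0//.
    have e20 : 0 <= e ^+ 2 by exact: sqr_ge0.
    apply: ge0_ler_powR => //.
    - by rewrite nnegrE addr_ge0 ?dot_ge0.
    - by rewrite nnegrE mulr_ge0.
    - by rewrite /bracket mulrDr mulr1 lerD2l ler_peMl ?dot_ge0// expr_ge1// ltW.
  have HN := native_norm_scale_le mK Kp Kc e0 t0 fK Ht.
  apply: (le_trans (error_bound_le _ (fun x _ => HA' e x e1) HN)).
    by rewrite mulr_ge0 ?powR_ge0.
  rewrite lee_fin -/n.
  have n0 : 0 <= n by apply: fine_ge0; exact: native_sqnorm_ge0.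
  have cn0 : 0 <= c1 / c0 * n by rewrite mulr_ge0// divr_ge0// ltW.
  rewrite (_ : c1 / c0 * e `^ (2 * s) * n = e `^ (2 * s) * (c1 / c0 * n)); last by ring.
  rewrite sqrtrM// -powR12_sqrt// -powRrM (_ : 2 * s / 2 = s); last by field.
  rewrite (_ : (d%:R - 2 * s) / 2 = - ((2 * s - d%:R) / 2)); last by field.
  rewrite powRN; have Ep : 0 < e `^ ((2 * s - d%:R) / 2) by rewrite powR_gt0.
  have es : e `^ s <= e `^ beta by apply: ler_powR => //; rewrite -sE; lra.
  move: (e `^ ((2 * s - d%:R) / 2)) Ep (Num.sqrt _) (sqrtr_ge0 (c1 / c0 * n)) => E E0 N N0.
  rewrite (_ : _ * _ * _ = A' * N * e `^ s); last by field; rewrite gt_eqF.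
  by rewrite ler_wpM2l// mulr_ge0.
move=> m dm kE; pose s : R := m%:R.
have s0 : 0 <= s by exact: ler0n.
have ds : d%:R < 2 * s by rewrite /s -natrM ltr_nat.
have Kc : comparable_kernel K s 1 1.
  by split => // w; rewrite !mul1r kE enorm_sqr -powR_invn ?(ltW (bracket_gt0 _)).
have [h0 h00 H] := power_flat_limit mK Kp Kc d0 ds oO nO bO.
exists h0 => // F X f FX XF fill fK _.
have XO : [set` X] `<=` Omega by have [] := FX X XF.
have [A A0 HA] := H X fill XO.
have [x0 [delta [Ox0 delta0 far]]] := exists_separated_point X d0 oO nO.
have [c c_gt0 Hc] := power_scale_ge mK Kp Kc d0 ds delta0 far.
exists (c ^+ 2), (A ^+ 2); split; [by rewrite exprn_gt0..|].
near=> e.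
have e0 : 0 < e by near: e; exact: nbhs_right_gt.
have e1 : e <= 1 by near: e; exact: nbhs_right_le.
have [_ ff _] := fK.
rewrite (sobolev_expansionE e0 kE ff).
set N := native_norm (scale_kernel e K) f.
have N0 : (0 <= N)%E by exact: sqrte_ge0.
have NN : (N * N = native_sqnorm (scale_kernel e K) f)%E.
  apply: (@sqr_sqrte _ (native_sqnorm (scale_kernel e K) f)).
  by apply: native_sqnorm_ge0 => w; exact: scale_khat_gt0.
pose p := e `^ ((2 * s - d%:R) / 2).
have p0 : 0 <= p by exact: powR_ge0.
have pp : e `^ (2 * m%:R - d%:R) = p * p.
  by rewrite /p -expr2 -powR_mulrn// -powRrM; congr (_ `^ _); by rewrite /s; field.
have sq (b : R) : ((b ^+ 2)%:E * ((e `^ (2 * m%:R - d%:R))%:E *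
    native_sqnorm (scale_kernel e K) f) = ((b * p)%:E * N) * ((b * p)%:E * N))%E.
  by rewrite -NN pp muleA -EFinM muleACA -EFinM; congr (_%:E * _)%E; ring.
rewrite !sq.
have lo : ((c * p)%:E * N <= error_bound K X Omega f e)%E.
  apply: (@le_trans _ _ (power_function (scale_kernel e K) X x0 * N)%E).
    by rewrite lee_wpmul2r// Hc.
  by apply: ereal_sup_ubound; exists x0.
have hi : (error_bound K X Omega f e <= (A * p)%:E * N)%E.
  by apply: ge_ereal_sup => _ [x Ox <-]; rewrite lee_wpmul2r// HA.
have lo0 : (0 <= (c * p)%:E * N)%E by rewrite mule_ge0// lee_fin mulr_ge0// ltW.
have eb0 := le_trans lo0 lo.
by split; apply: lee_pmul.
Unshelve. all: by end_near. Qed.
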